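(* Let $\mathcal{H}$ be any finite set of closed half-planes in $\mathbb{R}^2$, and let $H(\mathcal{H})=(V,E)$ be the hypergraph with vertex set $V=\mathcal{H}$ and hyperedge set $$E=\{\,e_p : p\in\mathbb{R}^2,\ |e_p|\ge 3\,\},\qquad e_p=\{h\in\mathcal{H} : p\in h\}.$$ Then the chromatic number of $H(\mathcal{H})$ is at most two; that is, there is a mapping $\chi:\mathcal{H}\to C$ with $|C|=2$ such that every point $p\in\mathbb{R}^2$ contained in at least three half-planes of $\mathcal{H}$ is contained in half-planes of $\mathcal{H}$ of both colors. Moreover, there is a deterministic algorithm that, given $\mathcal{H}$, computes such a good $2$-coloring of $H(\mathcal{H})$ in time $O(|V|\log|V|)$.
   Context: A hypergraph $H=(V,E)$ is a set $V$ together with a system $E$ of subsets of $V$, called hyperedges. A $k$-coloring of $H$ is a mapping $\chi:V\to C$ with $|C|=k$. A hyperedge $e$ is monochromatic under $\chi$ if $\chi(v)$ is the same for all $v\in e$. A coloring under which no hyperedge is monochromatic is called good; $H$ can be $k$-colored if it has a good $k$-coloring, and the chromatic number of $H$ is the minimum $k$ such that $H$ can be $k$-colored. Running time is measured in the standard random access machine model in which every basic algebraic operation $(+,-,*,/)$ on numbers is carried out in constant time; the input is the list of half-planes in $\mathcal{H}$, each given by the (real) coefficients of a linear inequality defining it. *)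

(* Defs.v *)
From HB Require Import structures.
From mathcomp Require Import all_boot all_order all_algebra.
From mathcomp Require Import all_classical all_reals all_analysis.
Import Order.TTheory GRing.Theory Num.Theory.
Import numFieldNormedType.Exports.

Set Implicit Arguments.
Unset Strict Implicit.
Unset Printing Implicit Defensive.

Local Open Scope classical_set_scope.
Local Open Scope card_scope.
Local Open Scope ring_scope.

Record hypergraph (T : Type) := Hypergraph {
  vertices : set T;
  hyperedges : set (set T);
  hyperedge_sub : forall e, hyperedges e -> e `<=` vertices }.

(* Colorings live on the subtype of vertices, so that the hypergraph without
   vertices is 0-colorable. *)
Definition monochromatic (T C : Type) (G : hypergraph T)
    (chi : set_type (vertices G) -> C) (e : set T) : Prop :=
  forall u v : set_type (vertices G), e (val u) -> e (val v) -> chi u = chi v.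

Definition good_coloring (T C : Type) (G : hypergraph T)
    (chi : set_type (vertices G) -> C) : Prop :=
  forall e, hyperedges G e -> ~ monochromatic chi e.

Definition colorable (T : Type) (G : hypergraph T) (k : nat) : Prop :=
  exists chi : set_type (vertices G) -> 'I_k, good_coloring chi.

(* Relational, since a hypergraph with a hyperedge of size at most 1 has no good
   coloring at all. *)
Definition is_chromatic_number (T : Type) (G : hypergraph T) (k : nat) : Prop :=
  colorable G k /\ forall j, colorable G j -> (k <= j)%N.

(* The triple (a, b, c) stands for the inequality a x + b y <= c. *)
Definition half_plane (R : realType) (l : R * R * R) : set (R * R) :=
  [set p | l.1.1 * p.1 + l.1.2 * p.2 <= l.2].

Definition nondegenerate (R : realType) (l : R * R * R) : bool :=
  (l.1.1 != 0) || (l.1.2 != 0).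

Definition is_closed_half_plane (R : realType) (h : set (R * R)) : Prop :=
  exists2 l, nondegenerate l & h = half_plane l.

Definition containing (R : realType) (H : set (set (R * R))) (p : R * R) :
    set (set (R * R)) :=
  [set h | H h /\ h p].

Definition half_plane_edges (R : realType) (H : set (set (R * R))) :
    set (set (set (R * R))) :=
  [set e | exists p, e = containing H p /\ `I_3 #<= containing H p].

Lemma half_plane_edges_sub (R : realType) (H : set (set (R * R))) e :
  half_plane_edges H e -> e `<=` H.
Proof. by move=> [p [-> _]] h []. Qed.

Definition half_plane_hypergraph (R : realType) (H : set (set (R * R))) :
    hypergraph (set (R * R)) :=
  Hypergraph (@half_plane_edges_sub R H).

(* [s] lists the members of [H], each exactly once, by coefficients. *)
Definition lists (R : realType) (s : seq (R * R * R)) (H : set (set (R * R))) :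
    Prop :=
  [/\ all (@nondegenerate R) s,
      uniq [seq half_plane l | l <- s]
    & H = [set h | h \in [seq half_plane l | l <- s]]].

(* Real random access machine, with structured control flow.
   Programs are finite syntax without real constants, so they are uniform in the
   input and in its length. The memory consists of scalar registers and arrays
   (a program names finitely many of each), separately for natural numbers
   (counters and addresses) and for real numbers. Arrays are addressed
   indirectly, through a natural number register. There is no rounding, no bit
   operation, and no flow of data from reals to naturals other than by branching
   on comparisons; index arithmetic has no division. *)
Variant instr :=
  | IConst (d k : nat)          (* i_d := k *)
  | IMove (d x : nat)           (* i_d := i_x *)
  | IAdd (d x y : nat)          (* i_d := i_x + i_y *)
  | ISub (d x y : nat)          (* i_d := max(i_x - i_y, 0) *)
  | IMul (d x y : nat)          (* i_d := i_x * i_y *)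
  | ILoad (d a x : nat)         (* i_d := A_a[i_x] *)
  | IStore (a x y : nat)        (* A_a[i_x] := i_y *)
  | RConst (d k : nat)          (* r_d := k *)
  | RMove (d x : nat)           (* r_d := r_x *)
  | RAdd (d x y : nat)          (* r_d := r_x + r_y *)
  | RSub (d x y : nat)          (* r_d := r_x - r_y *)
  | RMul (d x y : nat)          (* r_d := r_x * r_y *)
  | RDiv (d x y : nat)          (* r_d := r_x / r_y, and 0 if r_y = 0 *)
  | RLoad (d a x : nat)         (* r_d := B_a[i_x] *)
  | RStore (a x y : nat).       (* B_a[i_x] := r_y *)

Variant test :=
  | ILt (x y : nat)
  | IEq (x y : nat)
  | RLt (x y : nat)
  | REq (x y : nat).

Inductive program :=
  | Skip
  | Do (c : instr)
  | Seq (p q : program)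
  | If (b : test) (p q : program)
  | While (b : test) (p : program).

Record state (R : realType) := State {
  ireg : nat -> nat;
  iarr : nat -> nat -> nat;
  rreg : nat -> R;
  rarr : nat -> nat -> R }.

Definition upd (T : Type) (f : nat -> T) (i : nat) (v : T) : nat -> T :=
  fun j => if j == i then v else f j.

Definition set_ireg (R : realType) (m : state R) (d v : nat) : state R :=
  State (upd (ireg m) d v) (iarr m) (rreg m) (rarr m).
Definition set_rreg (R : realType) (m : state R) (d : nat) (v : R) : state R :=
  State (ireg m) (iarr m) (upd (rreg m) d v) (rarr m).
Definition set_iarr (R : realType) (m : state R) (a i v : nat) : state R :=
  State (ireg m) (upd (iarr m) a (upd (iarr m a) i v)) (rreg m) (rarr m).
Definition set_rarr (R : realType) (m : state R) (a i : nat) (v : R) : state R :=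
  State (ireg m) (iarr m) (rreg m) (upd (rarr m) a (upd (rarr m a) i v)).

Definition exec_instr (R : realType) (c : instr) (m : state R) : state R :=
  match c with
  | IConst d k => set_ireg m d k
  | IMove d x => set_ireg m d (ireg m x)
  | IAdd d x y => set_ireg m d (ireg m x + ireg m y)%N
  | ISub d x y => set_ireg m d (ireg m x - ireg m y)%N
  | IMul d x y => set_ireg m d (ireg m x * ireg m y)%N
  | ILoad d a x => set_ireg m d (iarr m a (ireg m x))
  | IStore a x y => set_iarr m a (ireg m x) (ireg m y)
  | RConst d k => set_rreg m d k%:R
  | RMove d x => set_rreg m d (rreg m x)
  | RAdd d x y => set_rreg m d (rreg m x + rreg m y)
  | RSub d x y => set_rreg m d (rreg m x - rreg m y)
  | RMul d x y => set_rreg m d (rreg m x * rreg m y)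
  | RDiv d x y =>
      set_rreg m d (if rreg m y == 0 then 0 else rreg m x / rreg m y)
  | RLoad d a x => set_rreg m d (rarr m a (ireg m x))
  | RStore a x y => set_rarr m a (ireg m x) (rreg m y)
  end.

Definition eval_test (R : realType) (b : test) (m : state R) : bool :=
  match b with
  | ILt x y => (ireg m x < ireg m y)%N
  | IEq x y => ireg m x == ireg m y
  | RLt x y => rreg m x < rreg m y
  | REq x y => rreg m x == rreg m y
  end.

(* [runs p m t m'] : from memory [m], [p] halts with memory [m'] after exactly [t]
   unit-cost operations (instructions and tests). *)
Inductive runs (R : realType) : program -> state R -> nat -> state R -> Prop :=
  | runs_skip m : runs Skip m 1 m
  | runs_do c m : runs (Do c) m 1 (exec_instr c m)
  | runs_seq p q m1 m2 m3 t u :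
      runs p m1 t m2 -> runs q m2 u m3 -> runs (Seq p q) m1 (t + u) m3
  | runs_if b p q m t m' :
      runs (if eval_test b m then p else q) m t m' ->
      runs (If b p q) m t.+1 m'
  | runs_while_false b p m :
      ~~ eval_test b m -> runs (While b p) m 1 m
  | runs_while_true b p m1 m2 m3 t u :
      eval_test b m1 -> runs p m1 t m2 -> runs (While b p) m2 u m3 ->
      runs (While b p) m1 (t + u).+1 m3.

Lemma runs_deterministic (R : realType) p (m m1 m2 : state R) t1 t2 :
  runs p m t1 m1 -> runs p m t2 m2 -> t1 = t2 /\ m1 = m2.
Proof.
move=> r1; elim: r1 t2 m2 => {p m t1 m1}
  [m|c m|p q m1 m2 m3 t u _ IHp _ IHq|b p q m t m' _ IH|b p m nb
  |b p m1 m2 m3 t u hb _ IHp _ IHw] s n r.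
- by inversion r.
- by inversion r.
- inversion r as [| |? ? ? m2' ? t' u' rp rq| | |]; subst.
  have [? ?] := IHp _ _ rp; subst m2' t'.
  by have [? ?] := IHq _ _ rq; subst.
- inversion r as [| | |? ? ? ? t' ? rb| |]; subst.
  by have [? ?] := IH _ _ rb; subst.
- inversion r as [| | | |? ? ? nb'|? ? ? ? ? ? ? hb']; subst => //.
  by rewrite hb' in nb.
- inversion r as [| | | |? ? ? nb'|? ? ? m2' ? t' u' hb' rp rw]; subst.
    by rewrite hb in nb'.
  have [? ?] := IHp _ _ rp; subst m2' t'.
  by have [? ?] := IHw _ _ rw; subst.
Qed.

(* The input a_i x + b_i y <= c_i (i < n) is given as i_0 = n, B_0[i] = a_i,
   B_1[i] = b_i, B_2[i] = c_i; the rest of the memory is zero. *)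
Definition input_state (R : realType) (s : seq (R * R * R)) : state R :=
  State (fun d => if d == 0%N then size s else 0%N)
        (fun _ _ => 0%N)
        (fun _ => 0)
        (fun a i => let l := nth (0, 0, 0) s i in
           match a with 0%N => l.1.1 | 1%N => l.1.2 | 2%N => l.2 | _ => 0 end).

(* The color of the i-th half-plane of the input is read off A_0[i]. *)
Definition outputs (R : realType) (m : state R) (s : seq (R * R * R))
    (H : set (set (R * R))) (k : nat) (chi : set_type H -> 'I_k) : Prop :=
  forall (i : nat) (h : set_type H), (i < size s)%N ->
    val h = half_plane (nth (0, 0, 0) s i) -> iarr m 0 i = chi h.

(* [p] solves the problem: on every listing [s] of a finite set of half-planes it
   halts with a good 2-coloring within [time (size s)] steps. *)
Definition computes_good_2coloring_in_time (R : realType) (p : program)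
    (time : nat -> nat) : Prop :=
  forall (H : set (set (R * R))) (s : seq (R * R * R)), lists s H ->
    exists (t : nat) (m : state R)
           (chi : set_type (vertices (half_plane_hypergraph H)) -> 'I_2),
      [/\ runs p (input_state s) t m,
          (t <= time (size s))%N,
          outputs m s chi
        & good_coloring chi].

(* Main.v *)
Require Import Defs.
From mathcomp Require Import all_boot all_order all_algebra.
From mathcomp Require Import all_classical all_reals all_analysis.
From mathcomp Require Import zify ring lra.
Import Order.TTheory GRing.Theory Num.Theory.
Import numFieldNormedType.Exports.

Set Implicit Arguments.
Unset Strict Implicit.
Unset Printing Implicit Defensive.

(** Why every finite set of half-planes has such a colouring, and why it is found
    quickly.

    After a shear no boundary is vertical, so every half-plane lies above or below
    a line [y = a x + b]. The colours are red (1) and blue (0).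

    Suppose first that some point is in none of the half-planes. By polar duality
    about it, half-planes become nonzero vectors, and the half-planes that contain
    a given point become the vectors in a half-plane off the origin. A half-plane
    off the origin that meets the convex hull of the vectors and the origin
    contains a hull vertex, and the hull vertices it contains are consecutive.
    Everything inside the hull is blue. The hull vertices are red, except for a
    maximal set of pairwise non-adjacent ones whose ear, cut off by the two
    neighbours, contains no other vector. Then two vectors in a half-plane off the
    origin force a red one into it ([red_of_two]): of two consecutive vertices one
    is red, and a vector that is not a vertex brings along a vertex and, if that
    one is blue, a neighbour of it, because its ear is empty. Three vectors
    include a blue one ([blue_of_three]): if all three are vertices, the middle
    one is blue, or has a blue neighbour, or has a vector in its ear. As two
    half-planes suffice for red, one more half-plane may be added and coloured
    blue ([good_hull]); this settles every family in which the removal of one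
    half-plane uncovers a point.

    Suppose next that the plane is covered. Comparing the lower envelope of the
    half-planes above a line with the upper envelope of the others yields a cover
    by two parallel half-planes or by three ([walk_cover]). Colour such a cover red
    and the rest blue: every point is in a red half-plane, and a point of depth at
    least three that is in no blue one is exact, that is, exactly the three members
    of the cover contain it ([good_cover]). If the cover has two members without
    each of which the plane is still covered, an exact point can be moved into the
    interiors of all three ([exact_interior]), and so it exists iff complementing
    the three members leaves a point uncovered ([flip_covered]). Now let [E] be a
    cover by three, with [e1], [e2] of the same type, let [F] be one that avoids
    [e1], and [G] one that avoids [e2]. Not all of [E], [F], [G] have exact points
    ([three_covers]): two covers with exact points share two members, because
    moving from one exact point away from the other leaves one of the covers; this
    forces [F] and [G] to contain [e2], [e3] and [e1], [e3] with a common third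
    member, and the slopes then contradict each other. If [F] or [G] does not
    exist, the first case applies with [e1] or [e2] blue.

    The algorithm follows these steps: at most five searches for an uncovered point
    or a small cover, and at most one colouring of a hull. Each search sorts the
    half-planes by angle, and everything else is linear: Graham's scan gives the
    envelopes and the hull, two pointers walk along the envelopes, and the ears are
    scanned one after the other, every position being in at most two of them.

    The program is written in a small language with expressions. Its compiler to
    machine code preserves the number of steps ([compile_ok]), and correctness and
    running time are proved together with triples ([triple_while], [triple_for])
    whose conclusion is a bound on the number of steps, a postcondition, and the
    registers and arrays that are left unchanged. *)

Local Open Scope ring_scope.

(** * Vectors and triangles at the origin *)

Section PlaneVectors.
Variable R : realFieldType.
Implicit Types a b v : R * R.

Definition cross a b : R := a.1 * b.2 - a.2 * b.1.
Definition dot a b : R := a.1 * b.1 + a.2 * b.2.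
Definition comb (c : R) a (d : R) b : R * R := (c * a.1 + d * b.1, c * a.2 + d * b.2).

(** [v] lies in the triangle with vertices the origin, [a] and [b]. *)
Definition dominated a v b : Prop :=
  exists c d, [/\ 0 <= c, 0 <= d, c + d <= 1 & v = comb c a d b].

Lemma crossC a b : cross a b = - cross b a.
Proof. by rewrite /cross; ring. Qed.

Lemma crossvv a : cross a a = 0.
Proof. by rewrite /cross; ring. Qed.

Lemma cramer a b v : cross a b != 0 ->
  v = comb (cross v b / cross a b) a (cross a v / cross a b) b.
Proof.
move=> h; rewrite /comb; case: a b v h => [a1 a2] [b1 b2] [v1 v2]; rewrite /cross /=.
by move=> h; congr pair; field.
Qed.

Lemma dominated_l a b c : 0 <= c <= 1 -> dominated a (c * a.1, c * a.2) b.
Proof.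
move=> /andP[c0 c1]; exists c, 0; split; rewrite ?addr0 //.
by rewrite /comb !mul0r !addr0.
Qed.

Lemma dominated_trl a v b u : dominated a v b -> dominated a u v -> dominated a u b.
Proof.
move=> [c [d [c0 d0 cd ->]]] [e [f [e0 f0 ef ->]]].
exists (e + f * c), (f * d); split; rewrite ?addr_ge0 ?mulr_ge0 //.
  have : f * (c + d) <= f by rewrite ler_piMr.
  lra.
by rewrite /comb /=; congr pair; ring.
Qed.

Lemma dominated_trr a v b u : dominated a v b -> dominated v u b -> dominated a u b.
Proof.
move=> [c [d [c0 d0 cd ->]]] [e [f [e0 f0 ef ->]]].
exists (e * c), (e * d + f); split; rewrite ?addr_ge0 ?mulr_ge0 //.
  have : e * (c + d) <= e by rewrite ler_piMr.
  lra.
by rewrite /comb /=; congr pair; ring.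
Qed.

Lemma dot_comb c a d b q : dot (comb c a d b) q = c * dot a q + d * dot b q.
Proof. by rewrite /dot /comb /=; ring. Qed.

(** As [0] is outside the half-plane, a point of the triangle can be inside only
    together with another vertex. *)
Lemma dominated_dot a v b q : dominated a v b -> 1 <= dot v q ->
  1 <= dot a q \/ 1 <= dot b q.
Proof.
move=> [c [d [c0 d0 cd ->]]]; rewrite dot_comb => h.
have [|ha] := leP 1 (dot a q); first by left.
have [|hb] := leP 1 (dot b q); first by right.
exfalso.
have := ler_wpM2l c0 (ltW ha); have := ler_wpM2l d0 (ltW hb); rewrite !mulr1 => h1 h2.
have e : c + d = 1 by lra.
have [c00|cn0] := eqVneq c 0.
  have d1 : d = 1 by lra.
  by move: h; rewrite c00 d1 mul0r mul1r; lra.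
have cp : 0 < c by rewrite lt_neqAle eq_sym cn0.
have : c * dot a q < c by rewrite gtr_pMr.
lra.
Qed.

(** By Cramer's rule the three inequalities are the signs and the sum of the
    coefficients of [v]. *)
Lemma dominated_cross a v b : 0 < cross a b -> 0 <= cross a v -> 0 <= cross v b ->
  cross v b + cross a v <= cross a b -> dominated a v b.
Proof.
move=> D av vb le; exists (cross v b / cross a b), (cross a v / cross a b).
split; rewrite ?divr_ge0 ?(ltW D) //; last by rewrite -cramer // gt_eqF.
by rewrite -mulrDl ler_pdivrMr // mul1r.
Qed.

End PlaneVectors.

(** * Cyclic sequences of vectors sorted by angle, and their hulls *)

(** [th] is any increasing measure of the angle for which a half turn is 2. The
    sequence goes round and round: position [p + N] is position [p] again, one
    full turn further. Among parallel vectors the longest comes first. *)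
Record angular (R : realFieldType) (N : nat) (w : nat -> R * R) (th : nat -> R) : Prop :=
  Angular {
    ang_N : (0 < N)%N;
    ang_wN : forall p, w (p + N)%N = w p;
    ang_thN : forall p, th (p + N)%N = th p + 4;
    ang_le : forall p q, (p <= q)%N -> th p <= th q;
    ang_turn : forall p, (p < N)%N -> th p < th 0 + 4;
    ang_cross : forall p q, 0 < th q - th p -> th q - th p < 2 ->
      0 < cross (w p) (w q);
    ang_opp : forall p q, th q = th p + 2 ->
      exists2 c, 0 < c & w q = (- c * (w p).1, - c * (w p).2);
    ang_par : forall p q, (p <= q)%N -> th q = th p ->
      exists2 c, 0 < c <= 1 & w q = (c * (w p).1, c * (w p).2);
    ang_neq0 : forall p, 0 < dot (w p) (w p) }.

Section Angular.
Variables (R : realFieldType) (N : nat) (w : nat -> R * R) (th : nat -> R).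
Hypothesis ang : angular N w th.

Lemma cross_lt0 p q : 2 < th q - th p -> th q - th p < 4 -> cross (w p) (w q) < 0.
Proof.
move=> h1 h2; rewrite crossC oppr_lt0 -(ang_wN ang p).
by apply: (ang_cross ang); rewrite (ang_thN ang); lra.
Qed.

Lemma cross_opp p q : th q = th p + 2 -> cross (w p) (w q) = 0.
Proof. by move=> /(ang_opp ang)[c _ ->]; rewrite /cross /=; ring. Qed.

Lemma cross_full p q : th q = th p + 4 -> cross (w p) (w q) = 0.
Proof.
move=> e; rewrite crossC -(ang_wN ang p).
have eq : th q = th (p + N)%N by rewrite (ang_thN ang).
have [le|le] := leqP q (p + N).
  by have [c _ ->] := ang_par ang le (esym eq); rewrite /cross /=; ring.
by have [c _ ->] := ang_par ang (ltnW le) eq; rewrite /cross /=; ring.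
Qed.

Lemma cross_gt0 p q : 0 < th q - th p -> th q - th p <= 4 ->
  (0 < cross (w p) (w q)) = (th q - th p < 2).
Proof.
move=> h0 h4; have [l2|g2|e2] := ltgtP (th q - th p) 2.
- exact: (ang_cross ang).
- have [l4|e4] : th q - th p < 4 \/ th q - th p = 4.
    by move: h4; rewrite le_eqVlt => /orP[/eqP|]; [right|left].
    by apply/negbTE; rewrite -leNgt ltW // cross_lt0.
  by rewrite cross_full ?ltxx //; lra.
- by rewrite cross_opp ?ltxx //; lra.
Qed.

Lemma cross_le0 p q : 2 <= th q - th p -> th q - th p <= 4 -> cross (w p) (w q) <= 0.
Proof.
by move=> h1 h2; rewrite leNgt cross_gt0 //; lra.
Qed.

(** * Graham's scan *)

(** The stack [st 0 < ... < st (sz - 1)] is locally convex, every position between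
    two neighbours on the stack is dominated by them, and the positions after the
    top are dominated by the top and the next position [j]. *)
Record graham (st : nat -> nat) (sz j : nat) : Prop := GrahamScan {
  gr_sz : (0 < sz)%N;
  gr_0 : st 0 = 0%N;
  gr_lt : forall i, (i.+1 < sz)%N -> (st i < st i.+1)%N;
  gr_top : (st sz.-1 < j)%N;
  gr_j : (j <= N.+1)%N;
  gr_th : forall i, (i.+1 < sz)%N -> th (st i) < th (st i.+1);
  gr_dom : forall i p, (i.+1 < sz)%N -> (st i <= p <= st i.+1)%N ->
    dominated (w (st i)) (w p) (w (st i.+1));
  gr_conv : forall i, (i.+2 < sz)%N -> th (st i.+2) - th (st i) < 2 ->
    cross (w (st i)) (w (st i.+2)) <
    cross (w (st i.+1)) (w (st i.+2)) + cross (w (st i)) (w (st i.+1));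
  gr_end : j = N.+1 -> st sz.-1 = N;
  gr_tail : (j <= N)%N ->
    (forall p, (st sz.-1 <= p < j)%N -> th p = th (st sz.-1)) \/
    (0 < cross (w (st sz.-1)) (w j) /\
     forall p, (st sz.-1 <= p < j)%N -> dominated (w (st sz.-1)) (w p) (w j)) }.

Lemma graham_init st : st 0 = 0%N -> graham st 1 1.
Proof.
move=> e; split=> //=; rewrite ?e //.
- by move=> [<-].
- by move=> _; left=> p; rewrite ltnS leqn0 => /eqP ->.
Qed.

Lemma graham_top_lt st sz j : graham st sz j -> (j <= N)%N ->
  th (st sz.-1) <= th j /\ th j - th (st sz.-1) <= 4.
Proof.
move=> g jN; have lt := gr_top g; split; first by rewrite (ang_le ang) // ltnW.
have h1 : th j <= th 0 + 4 by rewrite -(ang_thN ang) (ang_le ang).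
have := ang_le ang (leq0n (st sz.-1)); lra.
Qed.

Lemma graham_dom st sz j p : graham st sz j -> (j <= N)%N ->
  (st sz.-1 <= p < j)%N -> dominated (w (st sz.-1)) (w p) (w j).
Proof.
move=> g jN hp; have [h|[_ h]] := gr_tail g jN; last exact: h.
have /andP[h1 _] := hp.
by have [c /andP[c0 c1] ->] := ang_par ang h1 (h p hp); apply: dominated_l; rewrite ltW.
Qed.

(** A vector in the direction of the top is shorter than the top. *)
Lemma graham_skip st sz j : graham st sz j -> (j < N)%N ->
  cross (w (st sz.-1)) (w j) = 0 -> 0 < dot (w (st sz.-1)) (w j) ->
  graham st sz j.+1.
Proof.
move=> g jN c0 d0; have lt := gr_top g; have [h1 h2] := graham_top_lt g (ltnW jN).
have h3 : th j - th (st sz.-1) < 4.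
  have := ang_turn ang jN; have := ang_le ang (leq0n (st sz.-1)); lra.
have e : th j = th (st sz.-1).
  have [//|ne] := eqVneq (th j) (th (st sz.-1)); exfalso.
  have gt : 0 < th j - th (st sz.-1).
    by rewrite subr_gt0 lt_neqAle eq_sym ne.
  have [l2|g2|e2] := ltgtP (th j - th (st sz.-1)) 2.
  - by have := ang_cross ang gt l2; rewrite c0 ltxx.
  - by have := cross_lt0 g2 h3; rewrite c0 ltxx.
  - have [|c cp ej] := @ang_opp _ _ _ _ ang (st sz.-1) j; first lra.
    have := ang_neq0 ang (st sz.-1); move: d0; rewrite ej /dot /=.
    set x := (w _).1; set y := (w _).2 => q1 q2.
    have : 0 < c * (x * x + y * y) by rewrite mulr_gt0.
    have -> : c * (x * x + y * y) = - (x * (- c * x) + y * (- c * y)) by ring.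
    lra.
case: (g) => gsz0 g00 gr_lt0 gtop0 gj0 gr_th0 gr_dom0 gr_conv0 gend0 gr_tail0; split=> //; try lia.
move=> _; left=> p /andP[p1 p2]; have [pj|/negbTE pj] := eqVneq p j; first by rewrite pj.
have [h|[]] := gr_tail0 (ltnW jN); first by apply: h; lia.
by rewrite c0 ltxx.
Qed.

(** The top is in the triangle of its predecessor and the next position, and what
    it dominates together with one of them is dominated by both. *)
Lemma graham_pop st sz j : graham st sz.+2 j -> (j <= N)%N ->
  0 < cross (w (st sz)) (w j) ->
  cross (w (st sz.+1)) (w j) + cross (w (st sz)) (w (st sz.+1)) <=
    cross (w (st sz)) (w j) ->
  graham st sz.+1 j.
Proof.
move=> g jN cg dom; have gt := gr_top g; have lt := gr_lt g (ltnSn sz.+1).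
have [h1 h2] := graham_top_lt g jN; rewrite /= in gt h1 h2.
have tht := gr_th g (ltnSn sz.+1).
have j4 : th j - th (st sz) <= 4.
  have : th j <= th 0 + 4 by rewrite -(ang_thN ang) (ang_le ang).
  have := ang_le ang (leq0n (st sz)); lra.
have j2 : th j - th (st sz) < 2 by rewrite -cross_gt0 //; lra.
have dt : dominated (w (st sz)) (w (st sz.+1)) (w j).
  apply: dominated_cross => //.
    by apply: ltW; apply: (ang_cross ang); lra.
  have [e|ne] := eqVneq (th j) (th (st sz.+1)).
    have [c _ ->] := ang_par ang (ltnW gt) e; rewrite /cross /=.
    by have -> : forall x y : R, x * (c * y) - y * (c * x) = 0 by move=> x y; ring.
  apply: ltW; apply: (ang_cross ang); last lra.
  by rewrite subr_gt0 lt_neqAle eq_sym ne.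
case: (g) => gsz0 g00 gr_lt0 gtop0 gj0 gr_th0 gr_dom0 gr_conv0 gend0 gr_tail0; split=> //=.
- by move=> i hi; apply: gr_lt0; lia.
- lia.
- by move=> i hi; apply: gr_th0; lia.
- by move=> i p hi; apply: gr_dom0; lia.
- by move=> i hi; apply: gr_conv0; lia.
- lia.
- move=> _; right; split=> // p /andP[p1 p2].
  have [le|le] := leqP p (st sz.+1).
    by apply: dominated_trl dt _; apply: (gr_dom g) => //; rewrite p1.
  by apply: dominated_trr dt _; apply: (graham_dom g) => //=; lia.
Qed.

(** That the top is not popped is the strict convexity of its new triple. The last
    position [N], where the start comes back, has to be pushed in any case. *)
Lemma graham_push st sz j : graham st sz.+1 j -> (j <= N)%N ->
  (j = N \/ ~ (cross (w (st sz)) (w j) = 0 /\ 0 < dot (w (st sz)) (w j))) ->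
  (forall s, sz = s.+1 -> ~ (0 < cross (w (st s)) (w j) /\
     cross (w (st sz)) (w j) + cross (w (st s)) (w (st sz)) <=
       cross (w (st s)) (w j))) ->
  forall st', (forall i, (i <= sz)%N -> st' i = st i) -> st' sz.+1 = j ->
  graham st' sz.+2 j.+1.
Proof.
move=> g jN npar npop st' e1 e2; have gt := gr_top g; rewrite /= in gt.
have [h1 h2] := graham_top_lt g jN; rewrite /= in h1 h2.
have jlt : th (st sz) < th j.
  rewrite lt_neqAle h1 andbT; apply/eqP => e.
  have [c cc ej] := ang_par ang (ltnW gt) (esym e).
  case: npar => [jN'|]; last first.
    case; rewrite ej /cross /dot /=; split; first ring.
    have := ang_neq0 ang (st sz); rewrite /dot.
    set x := (w _).1; set y := (w _).2 => q2.
    have -> : x * (c * x) + y * (c * y) = c * (x * x + y * y) by ring.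
    by case/andP: cc => c0 _; rewrite mulr_gt0.
  have stN : (st sz < N)%N by rewrite -jN'.
  have := ang_turn ang stN; rewrite e jN'.
  have -> : th N = th 0 + 4 by rewrite -(ang_thN ang).
  by rewrite ltxx.
case: (g) => gsz0 g00 gr_lt0 gtop0 gj0 gr_th0 gr_dom0 gr_conv0 gend0 gr_tail0; split=> //=.
- by rewrite e1.
- move=> i hi; have [lt|ge] := ltnP i.+1 sz.+1.
    by rewrite !e1; try lia; apply: gr_lt0.
  have -> : i = sz by lia.
  by rewrite e1 // e2.
- by rewrite e2.
- move=> i hi; have [lt|ge] := ltnP i.+1 sz.+1.
    by rewrite !e1; try lia; apply: gr_th0.
  have -> : i = sz by lia.
  by rewrite e1 // e2.
- move=> i p hi; have [lt|ge] := ltnP i.+1 sz.+1.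
    by rewrite !e1; try lia; apply: gr_dom0.
  have -> : i = sz by lia.
  rewrite e1 // e2 => /andP[p1 p2].
  have [pj|pj] := eqVneq p j.
    rewrite pj; exists 0, 1; split; rewrite ?ler01 ?add0r //.
    by rewrite /comb !mul0r !mul1r !add0r; case: (w j).
  by apply: (graham_dom g) => //=; lia.
- move=> i hi; have [lt|ge] := ltnP i.+2 sz.+1.
    by rewrite !e1; try lia; apply: gr_conv0.
  have ei : sz = i.+1 by lia.
  have -> : st' i.+2 = j by rewrite -e2 ei.
  rewrite !e1; try lia; rewrite -ei => l2.
  have lti := gr_th g (i := i); rewrite -ei in lti.
  have c0 : 0 < cross (w (st i)) (w j).
    by apply: (ang_cross ang) => //; have := lti (ltnSn _); lra.
  by rewrite ltNge; apply/negP => le; apply: (npop i ei).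
- lia.
- rewrite e2 => _; left=> p; rewrite ltnS => hp; congr th; lia.
Qed.

End Angular.

(** * The cyclic hull *)

Section Hull.
Variables (R : realFieldType) (N : nat) (w : nat -> R * R) (th : nat -> R).
Hypothesis ang : angular N w th.

(** [h] enumerates the positions of the hull, going round with period [k]. *)
Record chull (k : nat) (h : nat -> nat) : Prop := Chull {
  ch_k : (0 < k)%N;
  ch_0 : h 0 = 0%N;
  ch_per : forall i, h (i + k)%N = (h i + N)%N;
  ch_lt : forall i, (h i < h i.+1)%N;
  ch_th : forall i, th (h i) < th (h i.+1);
  ch_dom : forall i p, (h i <= p <= h i.+1)%N ->
    dominated (w (h i)) (w p) (w (h i.+1));
  ch_conv : forall i, th (h i.+2) - th (h i) < 2 ->
    cross (w (h i)) (w (h i.+2)) <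
    cross (w (h i.+1)) (w (h i.+2)) + cross (w (h i)) (w (h i.+1)) }.

Lemma w_turn p q : w (p + N * q)%N = w p.
Proof.
by elim: q => [|q IH]; rewrite ?muln0 ?addn0 // mulnSr addnA (ang_wN ang).
Qed.

Lemma th_turn p q : th (p + N * q)%N = th p + 4 * q%:R.
Proof.
elim: q => [|q IH]; first by rewrite muln0 addn0 mulr0 addr0.
by rewrite mulnSr addnA (ang_thN ang) IH -natr1; ring.
Qed.

(** Beyond its last entry [N], the stack repeats one full turn further. *)
Definition closed_up (st : nat -> nat) (k i : nat) : nat := (st (i %% k) + N * (i %/ k))%N.

Lemma closed_upE st k q r : (0 < k)%N -> st 0 = 0%N -> st k = N -> (r <= k)%N ->
  closed_up st k (q * k + r) = (st r + N * q)%N.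
Proof.
move=> k0 e0 ek; rewrite /closed_up leq_eqVlt => /orP[/eqP ->|lt].
  by rewrite -mulSnr modnMl mulnK // e0 ek mulnS.
by rewrite modnMDl modn_small // divnMDl // divn_small // addn0.
Qed.

(** Every triple of consecutive vertices is one of the stack, apart from the one
    around the start, which the second hypothesis is about. *)
Lemma chull_graham st k : (0 < k)%N -> graham N w th st k.+1 N.+1 ->
  (th (st 1) + 4 - th (st k.-1) < 2 ->
   cross (w (st k.-1)) (w (st 1)) <
   cross (w 0) (w (st 1)) + cross (w (st k.-1)) (w 0)) ->
  chull k (closed_up st k).
Proof.
move=> k0 g wrap; have e0 := gr_0 g; have /= ek := gr_end g erefl.
have E := closed_upE _ k0 e0 ek.
have E1 q r : (r < k)%N -> closed_up st k (q * k + r) = (st r + N * q)%N.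
  by move=> /ltnW; apply: E.
have E2 q r : (r < k)%N -> closed_up st k (q * k + r.+1) = (st r.+1 + N * q)%N.
  exact: E.
have dec i : exists q r, (r < k)%N /\ i = (q * k + r)%N.
  by exists (i %/ k)%N, (i %% k)%N; rewrite ltn_mod k0 -divn_eq.
split=> //.
- by rewrite /closed_up mod0n div0n e0 muln0.
- move=> i; have [q [r [rk ->]]] := dec i.
  by rewrite addnAC -mulSnr !E1 // mulnS addnCA addnC.
- move=> i; have [q [r [rk ->]]] := dec i; rewrite -addnS (E1 _ _ rk) (E2 _ _ rk).
  by rewrite ltn_add2r (gr_lt g).
- move=> i; have [q [r [rk ->]]] := dec i; rewrite -addnS (E1 _ _ rk) (E2 _ _ rk).
  by rewrite !th_turn ltrD2r (gr_th g).
- move=> i p; have [q [r [rk ->]]] := dec i; rewrite -addnS (E1 _ _ rk) (E2 _ _ rk).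
  move=> /andP[p1 p2]; have ep : p = ((p - N * q) + N * q)%N by lia.
  by rewrite ep !w_turn; apply: (gr_dom g) => //; lia.
- move=> i; have [q [r [rk ->]]] := dec i; rewrite -!addnS.
  have [lt|ge] := ltnP r.+1 k.
    rewrite (E1 _ _ rk) (E2 _ _ rk) (E2 _ _ lt) !th_turn !w_turn => h.
    by apply: (gr_conv g) => //; lra.
  have er : r = k.-1 by lia.
  have -> : (q * k + r.+2 = q.+1 * k + 1)%N by rewrite mulSn; lia.
  rewrite (E1 _ _ rk) (E2 _ _ rk) E // !th_turn !w_turn er prednK // ek -[N]add0n (ang_wN ang) => h.
  by apply: wrap; move: h; rewrite -natr1; lra.
Qed.

Section Closed.
Variables (k : nat) (h : nat -> nat).
Hypothesis hull : chull k h.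

Let v i := w (h i).
Let t i := th (h i).

Lemma v_per i : v (i + k) = v i.
Proof. by rewrite /v (ch_per hull) (ang_wN ang). Qed.

Lemma t_per i : t (i + k) = t i + 4.
Proof. by rewrite /t (ch_per hull) (ang_thN ang). Qed.

Lemma h_mono i j : (i <= j)%N -> (h i <= h j)%N.
Proof.
elim: j => [|j IH]; first by rewrite leqn0 => /eqP ->.
rewrite leq_eqVlt ltnS => /orP[/eqP -> //|/IH le].
exact: leq_trans le (ltnW (ch_lt hull j)).
Qed.

Lemma t_lt i j : (i < j)%N -> t i < t j.
Proof.
elim: j => // j IH; rewrite ltnS leq_eqVlt => /orP[/eqP ->|/IH le].
  exact: (ch_th hull).
exact: lt_trans le (ch_th hull j).
Qed.

Lemma t_le i j : (i <= j)%N -> t i <= t j.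
Proof. by rewrite leq_eqVlt => /orP[/eqP -> //|/t_lt/ltW]. Qed.

Lemma cross_v i j : (i < j)%N -> t j - t i < 2 -> 0 < cross (v i) (v j).
Proof. by move=> ij h2; apply: (ang_cross ang) => //; rewrite subr_gt0 t_lt. Qed.

Let arcs (a b c d e : R) : e - a < 2 -> a <= b -> b < c -> c < d -> d <= e ->
  [/\ e - c < 2, c - a < 2, d - b < 2 & d - c < 2 /\ c - b < 2].
Proof. by move=> *; split; [| | |split]; lra. Qed.

(** Local convexity implies that a hull vertex is never inside the triangle of
    the origin and two others: of the vertices from [i] to [j], consider the one
    closest to the origin in the direction normal to the chord. *)
Lemma chord i m j : (i <= m <= j)%N -> (i < j)%N -> t j - t i < 2 ->
  cross (v i) (v j) <= cross (v m) (v j) + cross (v i) (v m).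
Proof.
move=> imj ij t2.
pose F n := cross (v n) (v j) + cross (v i) (v n).
have Fi : F i = cross (v i) (v j) by rewrite /F crossvv addr0.
have Fj : F j = cross (v i) (v j) by rewrite /F crossvv add0r.
have D0 := cross_v ij t2.
pose G (n : 'I_(j - i).+1) := F (i + n)%N.
case: (Order.TotalTheory.arg_minP G (erefl (xpredT (ord0 : 'I_(j - i).+1)))) => n0 _ min0.
have min m' : (i <= m' <= j)%N -> F (i + n0)%N <= F m'.
  move=> /andP[h1 h2]; have lt : (m' - i < (j - i).+1)%N by lia.
  have := min0 (Ordinal lt) isT; rewrite /G /=.
  by have -> : (i + (m' - i) = m')%N by lia.
set n := (i + n0)%N in min; have nj : (i <= n <= j)%N by have := ltn_ord n0; lia.
suff : cross (v i) (v j) <= F n by move=> le; apply: le_trans le (min m imj).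
have [->|ni] := eqVneq n i; first by rewrite Fi.
have [->|nnj] := eqVneq n j; first by rewrite Fj.
rewrite leNgt; apply/negP => Fn.
have [n1 en] : exists n1, n = n1.+1 by exists n.-1; lia.
have [in1 nj1 in2 nj2] : [/\ (i <= n1)%N, (n1 <= j)%N, (i <= n1.+2)%N & (n1.+2 <= j)%N].
  move: nj ni nnj => /andP[a1 a2] /eqP a3 /eqP a4; rewrite en in a1 a2 a3 a4.
  by clear - a1 a2 a3 a4; split; lia.
have [lti ltj] : (i < n1.+1)%N /\ (n1.+1 < j)%N by [].
have tn1 : t i <= t n1 by apply: t_le.
have tn2 : t n1.+2 <= t j by apply: t_le.
have tn : t n1 < t n1.+1 by apply: t_lt.
have tnn : t n1.+1 < t n1.+2 by apply: t_lt.
have [d1 d2 d3 [d4 d5]] := arcs t2 tn1 tn tnn tn2.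
have F0 : 0 < F n.
  by rewrite en /F addr_gt0 // cross_v.
have C0 : 0 < cross (v n1) (v n1.+2) by apply: cross_v.
have A0 : 0 < cross (v n1.+1) (v n1.+2) by apply: cross_v.
have B0 : 0 < cross (v n1) (v n1.+1) by apply: cross_v.
have cv : cross (v n1) (v n1.+2) < cross (v n1.+1) (v n1.+2) + cross (v n1) (v n1.+1).
  exact: (ch_conv hull d3).
have eF : cross (v n1) (v n1.+2) * F n =
    cross (v n1.+1) (v n1.+2) * F n1 + cross (v n1) (v n1.+1) * F n1.+2.
  by rewrite en /F /cross; ring.
have m1 : F n <= F n1 by apply: min; rewrite in1.
have m2 : F n <= F n1.+2 by apply: min; rewrite in2.
have q1 := ler_wpM2l (ltW A0) m1; have q2 := ler_wpM2l (ltW B0) m2.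
have q3 : cross (v n1) (v n1.+2) * F n <
   (cross (v n1.+1) (v n1.+2) + cross (v n1) (v n1.+1)) * F n by rewrite ltr_pM2r.
by have := lerD q1 q2; rewrite -mulrDl -eF leNgt q3.
Qed.

Lemma pos_between p : exists i, (h i <= p < h i.+1)%N.
Proof.
have unb i : (i <= h i)%N.
  by elim: i => // i IH; apply: leq_ltn_trans IH (ch_lt hull i).
have ex : exists i, (p < h i)%N by exists p.+1; apply: unb.
case: (ex_minnP ex) => -[|i] lt min; first by move: lt; rewrite (ch_0 hull).
exists i; rewrite lt andbT leqNgt; apply/negP => /min; lia.
Qed.

Lemma v_window i m : exists m', (i < m' <= i + k)%N /\ v m' = v m.
Proof.
have k0 := ch_k hull.
have vk n q : v (q * k + n) = v n.
  by elim: q => [//|q IH]; rewrite mulSn -addnA addnC v_per.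
have vmod n : v (n %% k) = v n by rewrite [in RHS](divn_eq n k) vk.
exists (i.+1 + (m + (k - i.+1 %% k)) %% k)%N; split.
  by have := ltn_pmod (m + (k - i.+1 %% k)) k0; lia.
rewrite -vmod -[RHS]vmod modnDmr {1}(divn_eq i.+1 k).
have lt := ltn_pmod i.+1 k0.
have -> : (i.+1 %/ k * k + i.+1 %% k + (m + (k - i.+1 %% k)) =
          (i.+1 %/ k).+1 * k + m)%N.
  rewrite mulSn; move: lt; set a := (_ * k)%N; lia.
by rewrite modnMDl.
Qed.

(** No hull vertex is beyond the line through two consecutive ones, by [chord]
    applied to the arcs that end there, and every other vector is dominated by hull
    vertices. *)
Lemma support i p : t i.+1 - t i < 2 ->
  cross (w p) (v i.+1) + cross (v i) (w p) <= cross (v i) (v i.+1).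
Proof.
move=> t2; have D0 := cross_v (ltnSn i) t2.
have hullcase m : cross (v m) (v i.+1) + cross (v i) (v m) <= cross (v i) (v i.+1).
  have [m' [/andP[im mk] <-]] := v_window i m.
  have d4 : t m' - t i <= 4 by have := t_le mk; rewrite t_per; lra.
  have d0 : t i < t m' by apply: t_lt.
  have [l2|g2] := ltP (t m' - t i) 2.
    have := @chord i i.+1 m'; rewrite leqnSn im => /(_ isT isT l2).
    by rewrite (crossC (v m')); lra.
  have [l2'|g2'] := ltP (t (i.+1 + k) - t m') 2.
    have := @chord m' (i + k) (i.+1 + k); rewrite mk leq_add2r leqnSn !v_per.
    have lt : (m' < i.+1 + k)%N by lia.
    by move=> /(_ isT lt l2'); rewrite (crossC (v i) (v m')); lra.
  have c1 : cross (v i) (v m') <= 0 by apply: (cross_le0 ang).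
  have c2 : cross (v m') (v i.+1) <= 0.
    have lt : (m' <= i.+1 + k)%N by lia.
    rewrite -(v_per i.+1); apply: (cross_le0 ang) => //.
    by have := t_lt (ltnSn i); rewrite -/(t _) t_per -/(t _); lra.
  lra.
have [m /andP[m1 m2]] := pos_between p.
have [c [d [c0 d0 cd ->]]] := ch_dom hull (i := m) (p := p) (introT andP (conj m1 (ltnW m2))).
have h1 := ler_wpM2l c0 (hullcase m); have h2 := ler_wpM2l d0 (hullcase m.+1).
have h3 := ler_wpM2r (ltW D0) cd; rewrite mul1r in h3.
move: h1 h2 h3; rewrite -/(v m) -/(v m.+1).
have -> : cross (comb c (v m) d (v m.+1)) (v i.+1) + cross (v i) (comb c (v m) d (v m.+1)) =
  c * (cross (v m) (v i.+1) + cross (v i) (v m)) +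
  d * (cross (v m.+1) (v i.+1) + cross (v i) (v m.+1)) by rewrite /cross /comb /=; ring.
lra.
Qed.

End Closed.
End Hull.

(** * Colouring the hull *)

Section Ear.
Variable R : realFieldType.

(** Beyond the segment [P X], and in a triangle with the vertex [V] of the convex
    chain [P V X], the vector [W] is a convex combination of [P], [V] and [X]. *)
Lemma ear_in (P V X W q : R * R) :
  0 < cross P X -> 0 <= cross V X -> 0 <= cross P V ->
  cross P X < cross V X + cross P V ->
  dominated P W V \/ dominated V W X ->
  cross P X < cross W X + cross P W ->
  1 <= dot P q -> 1 <= dot V q -> 1 <= dot X q -> 1 <= dot W q.
Proof.
move=> D0 A0 B0 KD dom ear hP hV hX.
have DV : cross P X * dot V q = cross V X * dot P q + cross P V * dot X q.
  by rewrite /cross /dot; ring.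
have key e f p u x A B D : 0 < D -> 0 <= A -> 0 <= B -> D < A + B -> 0 <= e ->
    0 <= f -> e + f <= 1 -> D < e * D + f * (A + B) -> 1 <= p -> 1 <= u -> 1 <= x ->
    D * u = A * p + B * x -> 1 <= e * p + f * u :> R.
  move=> {}D0 {}A0 {}B0 {}KD e0 f0 ef er p1 u1 x1 Du.
  set a := (e * D + f * (A + B) - D) / (A + B - D).
  have kd : 0 < A + B - D by lra.
  have a0 : 0 <= a by rewrite divr_ge0 //; lra.
  have af : a <= f.
    rewrite ler_pdivrMr //.
    have : (e + f) * D <= D by rewrite ger_pMl.
    by rewrite mulrDl mulrBr mulrDr; lra.
  have ea : a * (A + B - D) = e * D + f * (A + B) - D by rewrite divfK // gt_eqF.
  rewrite -(ler_pM2l D0) mulr1.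
  have -> : D * (e * p + f * u) = e * D * p + a * D * u + (f - a) * (A * p + B * x).
    by rewrite -Du; ring.
  have i1 : e * D <= e * D * p by rewrite ler_peMr // mulr_ge0 // ltW.
  have i2 : a * D <= a * D * u by rewrite ler_peMr // mulr_ge0 // ltW.
  have i3 : (f - a) * (A + B) <= (f - a) * (A * p + B * x).
    rewrite ler_wpM2l ?subr_ge0 //.
    have : A <= A * p by rewrite ler_peMr.
    have : B <= B * x by rewrite ler_peMr.
    lra.
  have : (f - a) * (A + B) = f * (A + B) - (e * D + f * (A + B) - D) - a * D.
    by rewrite -ea; ring.
  lra.
case: dom => -[e [f [e0 f0 ef eW]]].
  have eE : cross W X + cross P W = e * cross P X + f * (cross V X + cross P V).
    by rewrite eW /cross /comb /=; ring.
  rewrite eW dot_comb; apply: (key _ _ _ _ (dot X q) _ _ _ D0 A0 B0) => //.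
  by rewrite -eE.
have eE : cross W X + cross P W = f * cross P X + e * (cross P V + cross V X).
  by rewrite eW /cross /comb /=; ring.
rewrite eW dot_comb addrC; apply: (key _ _ _ _ (dot P q) _ _ _ D0 B0 A0) => //.
- by rewrite addrC.
- by rewrite addrC.
- by rewrite -eE.
- by rewrite DV addrC.
Qed.
End Ear.

Section Greedy.
Variables (R : realFieldType) (N : nat) (w : nat -> R * R) (th : nat -> R).
Hypothesis ang : angular N w th.
Variables (k : nat) (h : nat -> nat).
Hypothesis hull : chull N w th k h.

Let v i := w (h i).
Let t i := th (h i).

Let crv i j : (i < j)%N -> t j - t i < 2 -> 0 < cross (v i) (v j) :=
  @cross_v _ _ _ _ ang _ _ hull i j.
Let vper i : v (i + k) = v i := v_per ang hull i.
Let tper i : t (i + k) = t i + 4 := t_per ang hull i.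
Let tlt i j : (i < j)%N -> t i < t j := @t_lt _ _ _ _ _ _ hull i j.
Let tle i j : (i <= j)%N -> t i <= t j := @t_le _ _ _ _ _ _ hull i j.

(** [p] is beyond the segment that joins the hull neighbours of [h i.+1]. *)
Definition ear i p : bool :=
  cross (v i) (v i.+2) < cross (w p) (v i.+2) + cross (v i) (w p).

Definition in_ear i p : bool :=
  [&& (h i < p)%N, (p < h i.+2)%N, p != h i.+1 & ear i p].

(** [b] selects a maximal set of pairwise non-adjacent hull vertices among those
    whose ear is empty. *)
Record hull_coloring (b : nat -> bool) : Prop := HullColoring {
  hc_per : forall i, b (i + k)%N = b i;
  hc_ear : forall i, b i.+1 -> 0 < cross (v i) (v i.+2) /\ forall p, ~~ in_ear i p;
  hc_adj : forall i, b i -> ~~ b i.+1;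
  hc_max : forall i, ~~ b i.+1 -> 0 < cross (v i) (v i.+2) ->
    (forall p, ~~ in_ear i p) -> b i || b i.+2 }.

Variable b : nat -> bool.
Hypothesis col : hull_coloring b.
Variable q : R * R.
Let E (u : R * R) : bool := 1 <= dot u q.

(** [v m] is beyond the chord from [v i] to [v j], by [chord]. *)
Lemma in_arc i m j : (i <= m <= j)%N -> (i < j)%N -> t j - t i < 2 ->
  E (v i) -> E (v j) -> E (v m).
Proof.
move=> imj ij t2 ei ej; have D0 := crv ij t2.
have ch := chord ang hull imj ij t2.
have [->//|mi] := eqVneq m i; have [->//|mj] := eqVneq m j.
have im : (i < m)%N by rewrite ltn_neqAle eq_sym mi; case/andP: imj.
have mj' : (m < j)%N by rewrite ltn_neqAle mj; case/andP: imj.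
have tm1 := tlt im; have tm2 := tlt mj'.
have A0 : 0 < cross (v m) (v j) by apply: crv => //; lra.
have B0 : 0 < cross (v i) (v m) by apply: crv => //; lra.
rewrite /E -(ler_pM2l D0) mulr1.
have -> : cross (v i) (v j) * dot (v m) q =
   cross (v m) (v j) * dot (v i) q + cross (v i) (v m) * dot (v j) q.
  by rewrite /cross /dot; ring.
apply: le_trans ch _; apply: lerD.
  by rewrite ler_peMr // ltW.
by rewrite ler_peMr // ltW.
Qed.

Lemma cross_ge0 p r : (p <= r)%N -> th r - th p < 2 -> 0 <= cross (w p) (w r).
Proof.
move=> pr l2; have [e|ne] := eqVneq (th r) (th p).
  have [c _ ->] := ang_par ang pr e.
  by have -> : cross (w p) (c * (w p).1, c * (w p).2) = 0 by rewrite /cross /=; ring.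
apply/ltW/(ang_cross ang) => //; rewrite subr_gt0 lt_neqAle eq_sym ne.
exact: (ang_le ang).
Qed.

Lemma cross2_lt2 i : 0 < cross (v i) (v i.+2) -> t i.+2 - t i < 2.
Proof.
have k0 := ch_k hull; have [k1|k2] := leqP k 1.
  have ek : k = 1%N by lia.
  have -> : v i.+2 = v i.
    have -> : i.+2 = (i + k + k)%N by lia.
    by rewrite !vper.
  by rewrite crossvv ltxx.
have d4 : t i.+2 - t i <= 4.
  have le : (i.+2 <= i + k)%N by lia.
  by have := tle le; rewrite tper; lra.
have d0 : 0 < t i.+2 - t i by rewrite subr_gt0; apply: tlt.
by rewrite (cross_gt0 ang).
Qed.

(** Outside the ear, [w p] is dominated by the neighbours of the vertex. *)
Lemma not_ear_in i p : (h i <= p <= h i.+2)%N -> 0 < cross (v i) (v i.+2) ->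
  ~~ ear i p -> E (w p) -> E (v i) || E (v i.+2).
Proof.
move=> /andP[p1 p2] c0; rewrite -leNgt => le ep.
have l2 := cross2_lt2 c0.
have q1 := ang_le ang p1; have q2 := ang_le ang p2.
have /dominated_dot/(_ ep) : dominated (v i) (w p) (v i.+2).
  by apply: dominated_cross => //; apply: cross_ge0 => //; rewrite /t in l2; lra.
by case=> hE; rewrite /E hE ?orbT.
Qed.

Lemma b_shift i : (0 < k)%N -> exists a, a.+1 = (i + k)%N.
Proof. by move=> k0; exists (i + k).-1; lia. Qed.

(** [w p] is dominated by two adjacent hull vertices. If the one in the half-plane
    is blue, then [w p] is not in its ear, so that the half-plane contains a
    neighbour of the blue vertex; neighbours of blue vertices are red. *)
Lemma red_near i p : (h i < p < h i.+1)%N -> E (w p) -> exists j, ~~ b j && E (v j).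
Proof.
move=> /andP[p1 p2] ep; have k0 := ch_k hull.
have [|] : E (v i) \/ E (v i.+1).
- apply: dominated_dot ep; apply: (ch_dom hull); lia.
- move=> ei; have [bi|nb] := boolP (b i); last by exists i; rewrite nb.
  have [a ea] := b_shift i k0.
  have ba : b a.+1 by rewrite ea (hc_per col).
  have [c0 ne] := hc_ear col ba.
  have ha : h a.+1 = (h i + N)%N by rewrite ea (ch_per hull).
  have ha2 : h a.+2 = (h i.+1 + N)%N by rewrite ea -addSn (ch_per hull).
  have lt := ch_lt hull a.
  have := ne (p + N)%N; rewrite /in_ear ha ha2.
  have -> : (h a < p + N)%N by lia.
  have -> : (p + N < h i.+1 + N)%N by lia.
  have -> : (p + N != h i + N)%N by lia.
  have le : (h a <= p + N <= h a.+2)%N by lia.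
  move=> ne'; have := not_ear_in le c0 ne'.
  rewrite (ang_wN ang) => /(_ ep) /orP[e1|e2].
    exists a; rewrite e1 andbT; by apply/negP => /(hc_adj col); rewrite ba.
  by exists a.+2; rewrite e2 andbT (hc_adj col).
- move=> ei; have [bi|nb] := boolP (b i.+1); last by exists i.+1; rewrite nb.
  have [c0 ne] := hc_ear col bi; have lt := ch_lt hull i.+1.
  have := ne p; rewrite /in_ear p1.
  have -> : (p < h i.+2)%N by lia.
  have -> : (p != h i.+1)%N by lia.
  have le : (h i <= p <= h i.+2)%N by lia.
  move=> ne'; have /orP[e1|e2] := not_ear_in le c0 ne' ep.
    exists i; rewrite e1 andbT; by apply/negP => /(hc_adj col); rewrite bi.
  by exists i.+2; rewrite e2 andbT (hc_adj col).
Qed.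

Lemma hull_pos p : (p < N)%N -> exists i, [/\ (i < k)%N, (h i <= p)%N & (p < h i.+1)%N].
Proof.
move=> pN; have [i /andP[p1 p2]] := pos_between hull p; exists i; split=> //.
rewrite ltnNge; apply/negP => ki; have := h_mono hull ki.
by have := ch_per hull 0; rewrite add0n (ch_0 hull) add0n => ->; lia.
Qed.

(** Opposite vectors cannot both be in a half-plane off the origin, so the sign of
    the cross product tells on which side the shorter arc is. *)
Lemma E_cross i j : (i < j < i + k)%N -> E (v i) -> E (v j) ->
  (0 < cross (v i) (v j)) = (t j - t i < 2) /\ cross (v i) (v j) != 0.
Proof.
move=> /andP[ij jk] ei ej; have d0 := tlt ij; have d4 := tlt jk.
rewrite tper in d4.
have d0' : 0 < t j - t i by rewrite subr_gt0.
have d4' : t j - t i < 4 by lra.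
split; first by apply: (cross_gt0 ang) => //; exact: ltW.
have [l2|g2|e2] := ltgtP (t j - t i) 2.
- by rewrite gt_eqF // (ang_cross ang).
- by rewrite lt_eqF // (cross_lt0 ang).
- have [|c cp ec] := @ang_opp _ _ _ _ ang (h i) (h j).
    by rewrite -/(t _) -/(t _); lra.
  exfalso; move: ei ej; rewrite /E /v ec /dot /=.
  set x := (w _).1; set y := (w _).2 => h1 h2.
  have : 0 < c * (x * q.1 + y * q.2) by rewrite mulr_gt0 //; lra.
  have -> : c * (x * q.1 + y * q.2) = - (- c * x * q.1 + - c * y * q.2) by ring.
  lra.
Qed.

(** Between two blue vertices, on the arc shorter than a half turn, there is a red
    one, which is in the half-plane by [in_arc]. *)
Theorem red_of_two p r : (p < N)%N -> (r < N)%N -> p != r -> E (w p) -> E (w r) ->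
  exists j, ~~ b j && E (v j).
Proof.
wlog pr : p r / (p < r)%N => [H pN rN pr ep er|].
  have [lt|gt|eq] := ltngtP p r; first exact: (H p r).
    by apply: (H r p) => //; rewrite eq_sym.
  by move: pr; rewrite eq eqxx.
move=> pN rN _ ep er; have [i [ik p1 p2]] := hull_pos pN.
have [j [jk r1 r2]] := hull_pos rN.
have [pi|pi] := eqVneq p (h i); last by apply: (@red_near i) ep; rewrite p2 ltn_neqAle eq_sym pi p1.
have [rj|rj] := eqVneq r (h j); last by apply: (@red_near j) er; rewrite r2 ltn_neqAle eq_sym rj r1.
rewrite pi in ep; rewrite rj in er; rewrite -/(v _) in ep; rewrite -/(v _) in er.
have ij : (i < j)%N.
  by rewrite ltnNge; apply/negP => /(h_mono hull); rewrite -pi -rj; lia.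
have ijk : (i < j < i + k)%N by lia.
have [cg c0] := E_cross ijk ep er.
have [bi|nb] := boolP (b i); last by exists i; rewrite nb.
have [bj|nb] := boolP (b j); last by exists j; rewrite nb.
have [l2|g2] := ltP (t j - t i) 2.
  exists i.+1; rewrite (hc_adj col bi) /=.
  by apply: (@in_arc i i.+1 j) => //; rewrite leqnSn.
exists j.+1; rewrite (hc_adj col bj) /=.
have jik : (j < i + k)%N by case/andP: ijk.
apply: (@in_arc j j.+1 (i + k)%N) => //; rewrite ?leqnSn ?vper //.
have gt2 : 2 < t j - t i.
  rewrite lt_neqAle g2 andbT; apply: contra c0 => /eqP e.
  by rewrite /v (cross_opp ang) // -/(t _) -/(t _); lra.
by rewrite tper; lra.
Qed.

(** The neighbours of [v m] are on the arc from [v a] to [v c]. By maximality, a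
    red vertex has a blue neighbour, or its ear contains a vector, which is in the
    half-plane because the three vertices around the ear are. *)
Lemma blue_of_red_triple a m c : (0 < m)%N -> (a < m)%N -> (m < c)%N -> t c - t a < 2 ->
  E (v a) -> E (v m) -> E (v c) -> ~~ b m ->
  (exists j, b j && E (v j)) \/
  exists i p, (h i < p < h i.+1)%N && E (w p).
Proof.
case: m => // m _ am mc l2 ea em ec nb.
have ep : E (v m) by apply: (@in_arc a m c) => //; lia.
have en : E (v m.+2) by apply: (@in_arc a m.+2 c) => //; lia.
have ta : t a <= t m by apply: tle.
have tc : t m.+2 <= t c by apply: tle.
have t01 : t m < t m.+1 by apply: tlt.
have t12 : t m.+1 < t m.+2 by apply: tlt.
have l2' : t m.+2 - t m < 2 by lra.
have D0 : 0 < cross (v m) (v m.+2) by apply: crv.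
have A0 : 0 < cross (v m.+1) (v m.+2) by apply: crv => //; lra.
have B0 : 0 < cross (v m) (v m.+1) by apply: crv => //; lra.
have ed p : in_ear m p -> exists i p', (h i < p' < h i.+1)%N && E (w p').
  move=> /and4P[p1 p2 p3 er].
  have [lt|ge] := ltnP p (h m.+1).
    exists m, p; rewrite p1 lt /=.
    apply: (ear_in D0 (ltW A0) (ltW B0) (ch_conv hull l2')) => //.
    by left; apply: (ch_dom hull); rewrite (ltnW p1) (ltnW lt).
  have gt : (h m.+1 < p)%N by rewrite ltn_neqAle eq_sym p3.
  exists m.+1, p; rewrite gt p2 /=.
  apply: (ear_in D0 (ltW A0) (ltW B0) (ch_conv hull l2')) => //.
  by right; apply: (ch_dom hull); rewrite ge (ltnW p2).
have [bp|nbp] := boolP (b m); first by left; exists m; rewrite bp.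
have [bn|nbn] := boolP (b m.+2); first by left; exists m.+2; rewrite bn.
right; have [/hasP[p _ /ed //]|none] := boolP (has (in_ear m) (iota 0 (h m.+2))).
exfalso; have ne p : ~~ in_ear m p.
  apply/negP => hp; move/hasPn: none => /(_ p); rewrite mem_iota hp add0n leq0n /=.
  by case/and4P: hp => _ -> _ _ /(_ isT).
by have := hc_max col nb D0 ne; rewrite (negbTE nbp) (negbTE nbn).
Qed.

(** The linear relation between [x], [y] and [z], whose coefficients are the cross
    products, excludes that these go round the origin. *)
Lemma middle (x y z : R * R) : E x -> E y -> E z ->
  cross x y != 0 -> cross y z != 0 -> cross x z != 0 ->
  exists a m c, [/\ 0 < cross a m, 0 < cross m c, 0 < cross a c &
    [\/ [/\ a = x, m = y & c = z], [/\ a = x, m = z & c = y],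
        [/\ a = y, m = x & c = z] | [\/ [/\ a = y, m = z & c = x],
        [/\ a = z, m = x & c = y] | [/\ a = z, m = y & c = x]]]].
Proof.
move=> ex ey ez.
have rel : cross y z * dot x q + cross z x * dot y q + cross x y * dot z q = 0.
  by rewrite /cross /dot; ring.
have p (c u : R) : 0 < c -> 1 <= u -> 0 < c * u by move=> *; rewrite mulr_gt0 //; lra.
have n (c u : R) : c < 0 -> 1 <= u -> c * u < 0 by move=> *; rewrite nmulr_rlt0 //; lra.
rewrite !neq_lt => /orP[xy|xy] /orP[yz|yz] /orP[xz|xz].
- exists z, y, x; rewrite (crossC z y) (crossC y x) (crossC z x) !oppr_gt0; split=> //.
  by apply: Or44; apply: Or33.
- by have := n _ _ yz ex; have := n _ _ xy ez; have := n _ _ _ ey;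
    move=> /(_ (cross z x)); rewrite (crossC z x) oppr_lt0 => /(_ xz); rewrite -(crossC z x); lra.
- exists y, z, x; rewrite (crossC y x) (crossC z x) !oppr_gt0; split=> //.
  by apply: Or44; apply: Or31.
- exists y, x, z; rewrite (crossC y x) !oppr_gt0; split=> //.
  by apply: Or43.
- exists z, x, y; rewrite (crossC z y) (crossC z x) !oppr_gt0; split=> //.
  by apply: Or44; apply: Or32.
- exists x, z, y; rewrite (crossC z y) !oppr_gt0; split=> //.
  by apply: Or42.
- by have := p _ _ yz ex; have := p _ _ xy ez; have := p _ _ _ ey;
    move=> /(_ (cross z x)); rewrite (crossC z x) oppr_gt0 => /(_ xz); rewrite -(crossC z x); lra.
- by exists x, y, z; split=> //; apply: Or41.
Qed.

Lemma v_below i m : (k < i)%N -> exists m', (i - k <= m' < i)%N /\ v m' = v m.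
Proof.
move=> ki; have [m' [lt e]] := v_window ang hull (i - k.+1) m.
by exists m'; split=> //; have := ch_k hull; lia.
Qed.

(** The second alternative gives a vector that is not a hull vertex, hence blue.
    If the three vectors are vertices, one is between the others on an arc shorter
    than a half turn, and [blue_of_red_triple] applies to it. *)
Theorem blue_of_three p r s : (p < N)%N -> (r < N)%N -> (s < N)%N ->
  p != r -> r != s -> p != s -> E (w p) -> E (w r) -> E (w s) ->
  (exists j, b j && E (v j)) \/
  exists i p, (h i < p < h i.+1)%N && E (w p).
Proof.
move=> pN rN sN pr rs ps ep er es.
have [i [ik p1 p2]] := hull_pos pN; have [j [jk r1 r2]] := hull_pos rN.
have [l [lk s1 s2]] := hull_pos sN.
have [pi|pi] := eqVneq p (h i); last first.
  by right; exists i, p; rewrite ep p2 andbT ltn_neqAle eq_sym pi p1.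
have [rj|rj] := eqVneq r (h j); last first.
  by right; exists j, r; rewrite er r2 andbT ltn_neqAle eq_sym rj r1.
have [sl|sl] := eqVneq s (h l); last first.
  by right; exists l, s; rewrite es s2 andbT ltn_neqAle eq_sym sl s1.
have E_ne x y : (x < k)%N -> (y < k)%N -> x != y -> E (v x) -> E (v y) ->
    cross (v x) (v y) != 0.
  move=> xk yk; rewrite neq_ltn => /orP[xy|xy] ex ey.
    by have [|_] := @E_cross x y _ ex ey; first lia.
  by have [|_] := @E_cross y x _ ey ex; [lia|rewrite crossC oppr_eq0].
rewrite pi in ep pr ps; rewrite rj in er pr rs; rewrite sl in es rs ps.
have ij : i != j by apply: contraNneq pr => ->.
have jl : j != l by apply: contraNneq rs => ->.
have il : i != l by apply: contraNneq ps => ->.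
have [a [m [c [am mc ac perm]]]] := middle ep er es (E_ne _ _ ik jk ij ep er)
  (E_ne _ _ jk lk jl er es) (E_ne _ _ ik lk il ep es).
have idx : exists a' m' c', [/\ a = v a', m = v m', c = v c' & [/\ E a, E m & E c]].
  by case: perm => [[-> -> ->]|[-> -> ->]|[-> -> ->]|[[-> -> ->]|[-> -> ->]|[-> -> ->]]];
    do 3!eexists; split.
have [a' [m' [c' [ea em ec [Ea Em Ec]]]]] := idx.
pose M := (m' + k + k)%N.
have vM : v M = v m' by rewrite /M !vper.
have k0 := ch_k hull.
have [a2 [/andP[a2l a2u] ea2]] : exists m0, (M - k <= m0 < M)%N /\ v m0 = v a'.
  by apply: v_below; rewrite /M -addnA ltn_addl // -{1}[k]addn0 ltn_add2l.
have [c2 [/andP[c2l c2u] ec2]] := v_window ang hull M c'.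
have {}ec2 : v c2 = v c' := ec2.
have ta : t a2 < t M by apply: tlt.
have tc : t M < t c2 by apply: tlt.
have ta4 : t M <= t a2 + 4 by rewrite -tper; apply: tle; rewrite addnC -leq_subLR.
have tc4 : t c2 <= t M + 4 by rewrite -tper; apply: tle.
have cgt i0 j0 : t i0 < t j0 -> t j0 <= t i0 + 4 -> 0 < cross (v i0) (v j0) ->
    t j0 - t i0 < 2.
  by move=> h1 h2; rewrite (cross_gt0 ang) // -/(t _) -/(t _); lra.
have la : t M - t a2 < 2 by apply: cgt => //; rewrite ea2 vM -ea -em.
have lc : t c2 - t M < 2 by apply: cgt => //; rewrite vM ec2 -em -ec.
have lac : t c2 - t a2 < 2.
  by apply: cgt; [apply: lt_trans ta tc|lra|rewrite ea2 ec2 -ea -ec].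
have [bM|nbM] := boolP (b M); first by left; exists M; rewrite bM vM -em.
apply: (@blue_of_red_triple a2 M c2) => //; first exact: leq_ltn_trans a2u.
- by rewrite ea2 -ea.
- by rewrite vM -em.
- by rewrite ec2 -ec.
Qed.

End Greedy.

(** * Covers of the plane by half-planes with non-vertical boundaries *)

Section Covers.
Variable R : realFieldType.

(** The point [(x, y)] is in the half-plane above (if [u]) or below the line
    [y = a x + b] when this is nonnegative. *)
Definition side (u : bool) (a b x y : R) : R :=
  if u then y - (a * x + b) else a * x + b - y.

(** The rate of change of [side] in the direction [(dx, dy)]. *)
Definition slide (u : bool) (a dx dy : R) : R :=
  if u then dy - a * dx else a * dx - dy.

Lemma side_move u a b x y e dx dy :
  side u a b (x + e * dx) (y + e * dy) = side u a b x y + e * slide u a dx dy.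
Proof. by case: u; rewrite /side /slide; ring. Qed.

Lemma side_flip u a b x y : side (~~ u) a b x y = - side u a b x y.
Proof. by case: u; rewrite /side /=; ring. Qed.

Lemma slide_solve u1 a1 u2 a2 t1 t2 : a1 != a2 ->
  exists dx dy, slide u1 a1 dx dy = t1 /\ slide u2 a2 dx dy = t2.
Proof.
move=> ne; pose s (u : bool) : R := if u then 1 else -1.
have ss u : s u * s u = 1 by case: u; rewrite /s ?mul1r // mulrNN mul1r.
have E u a dx dy : slide u a dx dy = s u * (dy - a * dx).
  by case: u; rewrite /slide /s; ring.
have d0 : a1 - a2 != 0 by rewrite subr_eq0.
pose dx := (s u2 * t2 - s u1 * t1) / (a1 - a2).
exists dx, (s u1 * t1 + a1 * dx); rewrite !E addrK mulrA ss mul1r; split=> //.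
have -> : s u1 * t1 + a1 * dx - a2 * dx = s u2 * t2.
  by rewrite -addrA -mulrBl /dx mulrCA divff // mulr1 addrC subrK.
by rewrite mulrA ss mul1r.
Qed.

Lemma eventually_neg (T : eqType) (s : seq T) (c d : T -> R) :
  {in s, forall i, d i < 0} ->
  exists2 l0, 0 <= l0 & forall l, l0 <= l -> {in s, forall i, c i + l * d i < 0}.
Proof.
elim: s => [|i s IH] hd; first by exists 0.
have [|l0 l00 h0] := IH; first by move=> j js; apply: hd; rewrite inE js orbT.
have di : d i < 0 by apply: hd; rewrite inE eqxx.
exists (l0 + (`|c i| + 1) / - d i).
  by rewrite addr_ge0 // divr_ge0 ?oppr_ge0 ?(ltW di) // addr_ge0.
move=> l ll j; rewrite inE => /orP[/eqP ->|]; last first.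
  apply: h0; apply: le_trans ll.
  by rewrite lerDl divr_ge0 ?oppr_ge0 ?(ltW di) ?addr_ge0.
have : (`|c i| + 1) / - d i <= l by apply: le_trans ll; rewrite lerDr.
rewrite ler_pdivrMr ?oppr_gt0 // mulrN => h; have := ler_norm (c i); lra.
Qed.

Lemma shortly_neg (T : eqType) (s : seq T) (c d : T -> R) :
  {in s, forall i, c i < 0} ->
  exists2 l0, 0 < l0 & forall l, 0 <= l -> l <= l0 -> {in s, forall i, c i + l * d i < 0}.
Proof.
elim: s => [|i s IH] hc; first by exists 1.
have [|l0 l00 h0] := IH; first by move=> j js; apply: hc; rewrite inE js orbT.
have ci : c i < 0 by apply: hc; rewrite inE eqxx.
have dp : 0 < `|d i| + 1 by rewrite ltr_wpDl.
have lp : 0 < - c i / (`|d i| + 1) by rewrite divr_gt0 ?oppr_gt0.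
exists (Num.min l0 (- c i / (`|d i| + 1))); first by rewrite lt_min l00.
move=> l l0' ; rewrite le_min => /andP[l1 l2] j; rewrite inE => /orP[/eqP ->|].
  2: exact: h0.
move: l2; rewrite ler_pdivlMr // => l2.
have h : l * d i <= l * `|d i| by rewrite ler_wpM2l // ler_norm.
have [l00'|lp'] := eqVneq l 0; first by rewrite l00' mul0r addr0.
have : 0 < l by rewrite lt_neqAle eq_sym lp'.
by rewrite mulrDr mulr1 in l2; lra.
Qed.

Variables (u : nat -> bool) (a b : nat -> R).
Let S i x y := side (u i) (a i) (b i) x y.
Let D i dx dy := slide (u i) (a i) dx dy.
Implicit Types (s t H : seq nat).

Definition covers s : Prop := forall x y, exists2 i, i \in s & 0 <= S i x y.

(** [(x, y)] is in the half-planes [s] and in no other half-plane of [H]. *)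
Definition exact_at H s x y : Prop :=
  {in s, forall i, 0 <= S i x y} /\ {in H, forall i, i \notin s -> S i x y < 0}.

(** Far away in the direction from [q] to [p], and after a fixed step out of [c],
    one is outside all members of [t]: the others grow negative, and [c] does not
    increase. *)
Let half_unexact t c px py qx qy : covers t ->
  {in t, forall i, i != c -> S i px py < 0 /\ 0 <= S i qx qy} ->
  S c px py <= S c qx qy -> False.
Proof.
move=> ct h le.
pose dx := px - qx; pose dy := py - qy.
have eD i : S i px py = S i qx qy + D i dx dy.
  have := side_move (u i) (a i) (b i) qx qy 1 dx dy.
  by rewrite !mul1r /dx /dy !subrKC.
pose ey : R := if u c then -1 else 1.
have ec : D c 0 ey = -1 by rewrite /D /slide /ey; case: (u c); ring.
pose mu := `|S c px py| + 1.
have neg : {in [seq i <- t | i != c], forall i, D i dx dy < 0}.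
  move=> i; rewrite mem_filter => /andP[ic it].
  by have := eD i; have [] := h i it ic; lra.
have [l0 l00 hl] := eventually_neg (fun i => S i px py + mu * D i 0 ey) neg.
have [i it si] := ct (px + mu * 0 + l0 * dx) (py + mu * ey + l0 * dy).
move: si; rewrite /S !side_move -/(S _ _ _) -/(D _ _ _) -/(D _ _ _).
have [->|ic] := eqVneq i c; last first.
  by rewrite leNgt (hl l0) // mem_filter ic.
have := eD c; rewrite ec => e.
have : l0 * D c dx dy <= 0 by rewrite mulr_ge0_le0 //; lra.
by rewrite mulrN1 /mu; have := ler_norm (S c px py); lra.
Qed.

(** Two covers that share at most one half-plane cannot both have a point that
    is in all their members and in nothing else: from one of these two points,
    moving away from the other one leaves the corresponding cover. *)
Lemma exact_share H s t c px py qx qy : covers s -> covers t ->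
  {subset s <= H} -> {subset t <= H} ->
  exact_at H s px py -> exact_at H t qx qy ->
  (forall i, i \in s -> i \in t -> i = c) -> False.
Proof.
move=> cs ct sH tH [ps pH] [qt qH] sh.
have [le|/ltW le] := leP (S c px py) (S c qx qy).
  apply: (half_unexact ct _ le) => i it ic; split; last exact: qt.
  by apply: pH (tH _ it) _; apply: contraNN ic => is_; rewrite (sh i).
apply: (half_unexact cs _ le) => i is_ ic; split; last exact: ps.
by apply: qH (sH _ is_) _; apply: contraNN ic => it; rewrite (sh i).
Qed.

(** At the exact point, two of the three cannot both be on their boundaries if the
    third is not needed to cover the plane: otherwise a small step out of both of
    them leaves that smaller cover. Hence one of the three
    contains the point in its interior, and a small step into the other two stays
    there. *)
Lemma exact_interior H i j k x y :
  a i != a j -> a j != a k -> a i != a k ->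
  exact_at H [:: i; j; k] x y ->
  covers [seq l <- H | l != i] -> covers [seq l <- H | l != j] ->
  exists x' y', {in [:: i; j; k], forall l, 0 < S l x' y'} /\
    {in H, forall l, l \notin [:: i; j; k] -> S l x' y' < 0}.
Proof.
move=> aij ajk aik [pin pout] ci cj.
have [pi pj pk] : [/\ 0 <= S i x y, 0 <= S j x y & 0 <= S k x y].
  by split; apply: pin; rewrite !inE eqxx ?orbT.
pose O := [seq l <- H | l \notin [:: i; j; k]].
have On : {in O, forall l, S l x y < 0}.
  by move=> l; rewrite mem_filter => /andP[h1 h2]; apply: pout.
have leave l m l' : a l != a m -> [:: i; j; k] =i [:: l'; l; m] ->
    covers [seq z <- H | z != l'] -> 0 <= S l x y -> 0 <= S m x y ->
    0 < S l x y \/ 0 < S m x y.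
  move=> ne perm cl; rewrite !le_eqVlt => /orP[/eqP el|]; last by left.
  move=> /orP[/eqP em|]; last by right.
  have [dx [dy [e1 e2]]] := slide_solve (u l) (u m) (-1) (-1) ne.
  have [e ep he] := @shortly_neg _ O (fun z => S z x y) (fun z => D z dx dy) On.
  have [z] := cl (x + e * dx) (y + e * dy).
  rewrite mem_filter => /andP[zl zH]; rewrite /S side_move -/(S _ _ _) -/(D _ _ _).
  have [zin|zout] := boolP (z \in [:: i; j; k]); last first.
    by rewrite leNgt (he e) ?(ltW ep) // mem_filter zout.
  move: zin; rewrite perm !inE (negbTE zl) /= => /orP[/eqP ->|/eqP ->].
    by rewrite /D e1 -el; lra.
  by rewrite /D e2 -em; lra.
have go (l1 l2 l3 : nat) : a l1 != a l2 -> [:: i; j; k] =i [:: l1; l2; l3] ->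
    0 <= S l1 x y -> 0 <= S l2 x y -> 0 < S l3 x y ->
    exists x' y', {in [:: i; j; k], forall l, 0 < S l x' y'} /\
    {in H, forall l, l \notin [:: i; j; k] -> S l x' y' < 0}.
  move=> ne perm p1 p2 p3.
  have [dx [dy [e1 e2]]] := slide_solve (u l1) (u l2) 1 1 ne.
  have [e ep he] := @shortly_neg _ O (fun z => S z x y) (fun z => D z dx dy) On.
  have [|f fp hf] := @shortly_neg _ [:: l3] (fun z => - S z x y) (fun z => - D z dx dy).
    by move=> z; rewrite inE => /eqP ->; rewrite oppr_lt0.
  pose m := Num.min e f; have mp : 0 < m by rewrite lt_min ep fp.
  exists (x + m * dx), (y + m * dy); split=> z.
    rewrite perm /S side_move -/(S _ _ _) -/(D _ _ _) !inE => /or3P[] /eqP ->.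
    - by rewrite /D e1; lra.
    - by rewrite /D e2; lra.
    - have := hf m (ltW mp); rewrite ge_min lexx orbT => /(_ isT l3).
      by rewrite mem_head => /(_ isT); lra.
  move=> zH zout; rewrite /S side_move -/(S _ _ _) -/(D _ _ _).
  by apply: he; rewrite ?(ltW mp) // ?ge_min ?lexx // mem_filter zout.
have pm1 : [:: i; j; k] =i [:: j; i; k] by move=> z; rewrite !inE orbCA.
have pm2 : [:: i; j; k] =i [:: i; j; k] by [].
have pm3 : [:: i; j; k] =i [:: i; k; j] by move=> z; rewrite !inE (orbC (z == k)).
have [kp|k0] := ltP 0 (S k x y); first exact: (go i j k).
have [jp|//] := leave _ _ _ ajk pm2 ci pj pk; last by move=> kp; lra.
have [ip|//] := leave _ _ _ aik pm1 cj pi pk; last by move=> kp; lra.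
by apply: (go i k j) => //; exact: pm3.
Qed.

(** The boundaries of the half-planes form a triangle, or meet in a point, and the
    odd one out among them is the third. *)
Definition strict3 i j k : Prop := [/\ u i = u j, u k = ~~ u i & a i < a k < a j].

(** In terms of the types only, whatever the order of the three. *)
Lemma strict3_between i j k l m z : strict3 i j k ->
  l \in [:: i; j; k] -> m \in [:: i; j; k] -> z \in [:: i; j; k] ->
  l != m -> m != z -> l != z -> u m = ~~ u l ->
  if u z == u l then (a l < a m < a z) || (a z < a m < a l)
  else (a m < a l < a z) || (a z < a l < a m).
Proof.
move=> [uij uk /andP[ik kj]]; rewrite !inE.
move=> /or3P[] /eqP -> /or3P[] /eqP -> /or3P[] /eqP ->; rewrite ?eqxx //=;
  move=> _ _ _; rewrite ?uk -?uij ?eqxx ?ik ?kj ?orbT //; case: (u i) => //=;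
  by rewrite ?ik ?kj ?orbT.
Qed.

(** By [exact_share], any two of the three covers share two members, whichever
    single half-plane is disregarded. So [s] contains [e2] and [e3], [t] contains
    [e1] and [e3], and both contain some further [z]. The slopes in [s] order [z]
    with respect to [e2] and [e3], those in [t] with respect to [e1] and [e3]; as
    [e1 < e3 < e2] in slope, the two orders exclude each other. *)
Theorem three_covers H e1 e2 e3 s t x y x1 y1 x2 y2 :
  strict3 e1 e2 e3 ->
  (exists f1 f2 f3, s = [:: f1; f2; f3] /\ strict3 f1 f2 f3) ->
  (exists f1 f2 f3, t = [:: f1; f2; f3] /\ strict3 f1 f2 f3) ->
  covers [:: e1; e2; e3] -> covers s -> covers t ->
  {subset [:: e1; e2; e3] <= H} -> {subset s <= H} -> {subset t <= H} ->
  e1 \notin s -> e2 \notin t ->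
  exact_at H [:: e1; e2; e3] x y -> exact_at H s x1 y1 -> exact_at H t x2 y2 -> False.
Proof.
move=> st0 [f1 [f2 [f3 [es st1]]]] [g1 [g2 [g3 [et st2]]]] c0 c1 c2 h0 h1 h2 n1 n2 x0 xs xt.
have ud : u e3 = ~~ u e1 /\ u e3 = ~~ u e2 by case: st0 => ->.
have [lt1 lt2] : a e1 < a e3 /\ a e3 < a e2 by case: st0 => _ _ /andP.
have ne13 : e1 != e3 by apply: contraTneq lt1 => ->; rewrite ltxx.
have ne23 : e3 != e2 by apply: contraTneq lt2 => ->; rewrite ltxx.
have share (r : seq nat) xr yr : covers r -> {subset r <= H} -> exact_at H r xr yr ->
    forall c (q : seq nat) xq yq, covers q -> {subset q <= H} -> exact_at H q xq yq ->
    exists i, [/\ i \in q, i \in r & i != c].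
  move=> cr hr er c q xq yq cq hq eq.
  have [/hasP[i iq /andP[ir ic]]|/hasPn no] := boolP (has (fun i => (i \in r) && (i != c)) q).
    by exists i.
  exfalso; apply: (exact_share (c := c) cq cr hq hr eq er) => i iq ir.
  by apply/eqP; have := no i iq; rewrite ir /= negbK.
have e3s : e3 \in s.
  have [i [i0 is_ ic]] := share _ _ _ c1 h1 xs e2 _ _ _ c0 h0 x0.
  by move: i0 is_; rewrite !inE (negbTE ic) /= => /orP[/eqP -> /(negP n1) //|/eqP ->].
have e2s : e2 \in s.
  have [i [i0 is_ ic]] := share _ _ _ c1 h1 xs e3 _ _ _ c0 h0 x0.
  by move: i0 is_; rewrite !inE (negbTE ic) orbF => /orP[/eqP -> /(negP n1) //|/eqP ->].
have e3t : e3 \in t.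
  have [i [i0 it ic]] := share _ _ _ c2 h2 xt e1 _ _ _ c0 h0 x0.
  by move: i0 it; rewrite !inE (negbTE ic) /= => /orP[/eqP -> /(negP n2) //|/eqP ->].
have e1t : e1 \in t.
  have [i [i0 it ic]] := share _ _ _ c2 h2 xt e3 _ _ _ c0 h0 x0.
  by move: i0 it; rewrite !inE (negbTE ic) orbF => /orP[/eqP ->|/eqP -> /(negP n2) //].
have [z [zs zt z3]] := share _ _ _ c2 h2 xt e3 _ _ _ c1 h1 xs.
have z1 : z != e1 by apply: contraNneq n1 => <-.
have z2 : z != e2 by apply: contraNneq n2 => <-.
rewrite es in e3s e2s zs; rewrite et in e3t e1t zt.
have := strict3_between st1 e2s e3s zs.
rewrite !(eq_sym e2) ne23 (eq_sym e3) z3 z2 => /(_ isT isT isT (proj2 ud)).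
have := strict3_between st2 e1t e3t zt.
rewrite ne13 !(eq_sym _ z) z3 z1 => /(_ isT isT isT (proj1 ud)).
have -> : u e1 = u e2 by case: st0.
clear - lt1 lt2.
by case: ifP => _ /orP[] /andP[q1 q2] /orP[] /andP[q3 q4]; lra.
Qed.

End Covers.

(** * Duality about a point outside all half-planes *)

Section Theta.
Variable R : realFieldType.

(** An increasing function of the angle of the inner normal for which a half turn
    adds 2. Unlike the angle itself it is a rational expression in each quadrant. *)
Definition theta (u : bool) (a : R) : R := a / (1 + `|a|) + (if u then 0 else 2).

Let gE (a : R) : a / (1 + `|a|) = if a < 0 then a / (1 - a) else a / (1 + a).
Proof. by case: ltP => h; rewrite ?(ltr0_norm h) ?(ger0_norm h). Qed.

Lemma theta_lt u (a1 a2 : R) : (theta u a1 < theta u a2) = (a1 < a2).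
Proof.
have mono : {mono (fun a : R => a / (1 + `|a|)) : x y / x < y}.
  apply: leW_mono; apply: le_mono => x y xy; rewrite !gE.
  have [x0|x0] := ltP x 0; have [y0|y0] := ltP y 0; try lra.
  - by rewrite ltr_pdivrMr ?subr_gt0; [rewrite mulrAC ltr_pdivlMr; lra|lra].
  - apply: (@lt_le_trans _ _ 0); last by rewrite divr_ge0 // addr_ge0.
    by rewrite pmulr_llt0 ?invr_gt0 //; lra.
  - by rewrite ltr_pdivrMr; [rewrite mulrAC ltr_pdivlMr; lra|lra].
by rewrite /theta ltrD2r mono.
Qed.

Lemma theta_inj u (a1 a2 : R) : theta u a1 = theta u a2 -> a1 = a2.
Proof.
move=> e; have := theta_lt u a1 a2; have := theta_lt u a2 a1.
by rewrite e ltxx => h1 h2; apply/eqP; rewrite eq_le !leNgt -h1 -h2.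
Qed.

Lemma theta_bound u (a : R) :
  (if u then -1 else 1) < theta u a < (if u then 1 else 3).
Proof.
suff /andP[h1 h2] : -1 < a / (1 + `|a|) < 1 by case: u; rewrite /theta; lra.
have p : 0 < 1 + `|a| by rewrite ltr_pwDl.
rewrite ltr_pdivlMr // ltr_pdivrMr //.
by have := ler_norm a; have := ler_norm (- a); rewrite normrN; lra.
Qed.

(** Half-planes of different types are less than a half turn apart, exactly a half
    turn apart, or more, according to the order of their slopes. *)
Lemma theta_ul (a1 a2 : R) :
  [/\ (theta false a2 - theta true a1 < 2) = (a2 < a1),
      (2 < theta false a2 - theta true a1) = (a1 < a2) &
      theta false a2 - theta true a1 = 2 -> a1 = a2].
Proof.
have e : theta false a2 = theta true a2 + 2 by rewrite /theta addr0.
split; rewrite ?e; first by rewrite -(theta_lt true); apply/idP/idP; lra.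
  by rewrite -(theta_lt true a1); apply/idP/idP; lra.
by move=> h; apply: (@theta_inj true); lra.
Qed.
End Theta.

Section Dual.
Variables (R : realFieldType) (u : nat -> bool) (a b : nat -> R) (cx cy : R).

(** How far above the center the boundary passes. *)
Definition height i : R := b i + a i * cx - cy.
(** The vector [d] for which the half-plane is [1 <= dot d (q - center)]. *)
Definition dual i : R * R := (- a i / height i, 1 / height i).

Lemma height_gt0 i : u i -> side (u i) (a i) (b i) cx cy < 0 -> 0 < height i.
Proof. by rewrite /side /height => ->; lra. Qed.

Lemma height_lt0 i : ~~ u i -> side (u i) (a i) (b i) cx cy < 0 -> height i < 0.
Proof. by rewrite /side /height => /negbTE ->; lra. Qed.

Lemma height_neq0 i : side (u i) (a i) (b i) cx cy < 0 -> height i != 0.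
Proof.
move=> h; have [ui|nu] := boolP (u i).
  by rewrite gt_eqF // height_gt0.
by rewrite lt_eqF // height_lt0.
Qed.

Lemma dual_side i x y : side (u i) (a i) (b i) cx cy < 0 ->
  (1 <= dot (dual i) (x - cx, y - cy)) = (0 <= side (u i) (a i) (b i) x y).
Proof.
move=> h; have e : dot (dual i) (x - cx, y - cy) =
    ((y - cy) - a i * (x - cx)) / height i by rewrite /dot /dual /=; ring.
rewrite e; have [ui|nu] := boolP (u i).
  rewrite ler_pdivlMr ?height_gt0 // mul1r /height /side.
  by apply/idP/idP; lra.
rewrite ler_ndivlMr ?height_lt0 // mul1r /height /side.
by apply/idP/idP; lra.
Qed.

Lemma cross_dual i j : height i != 0 -> height j != 0 ->
  cross (dual i) (dual j) = (a j - a i) / (height i * height j).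
Proof. by move=> hi hj; rewrite /cross /dual /=; field; rewrite hi hj. Qed.

Lemma dual_scale i j : a i = a j -> height i != 0 -> height j != 0 ->
  dual j = (height i / height j * (dual i).1, height i / height j * (dual i).2).
Proof.
by move=> e hi hj; rewrite /dual /= e; congr pair; field; rewrite hi hj.
Qed.

End Dual.

(** Increases as parallel half-planes of one type shrink. *)
Definition strength (R : realFieldType) (u : bool) (b : R) : R := if u then b else - b.

Section Sorted.
Variables (R : realFieldType) (u : nat -> bool) (a b : nat -> R) (cx cy : R).
Variables (N r : nat) (ids : nat -> nat).
Let t i := theta (u i) (a i).
Let hgt := height a b cx cy.

Hypothesis rN : (r < N)%N.
Hypothesis out : forall p, (p < N)%N ->
  side (u (ids p)) (a (ids p)) (b (ids p)) cx cy < 0.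
Hypothesis sorted : forall p q, (p < q)%N -> (q < N)%N ->
  t (ids p) < t (ids q) \/
  (t (ids p) = t (ids q) /\
   strength (u (ids p)) (b (ids p)) <= strength (u (ids q)) (b (ids q))).
Hypothesis first : forall p, (p < r)%N -> t (ids p) < t (ids r).

Definition rot p : nat := ids ((r + p) %% N).
Definition rotv p : R * R := dual a b cx cy (rot p).
Definition rott p : R := t (rot p) + 4 * ((r + p) %/ N)%:R.

Let N0 : (0 < N)%N. Proof. exact: leq_ltn_trans rN. Qed.
Let rot_out p : side (u (rot p)) (a (rot p)) (b (rot p)) cx cy < 0.
Proof. by apply: out; rewrite ltn_mod. Qed.
Let hn p : hgt (rot p) != 0.
Proof. exact: height_neq0 (rot_out p). Qed.

Let tb i : -1 < t i /\ t i < 3.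
Proof. by have := theta_bound (u i) (a i); rewrite /t; case: (u i) => /andP[]; lra. Qed.

(** Less than a full turn apart, [p] and [q] are in the same round, or [q] is in
    the next one. *)
Let cyc_diff p q (d : R) : rott q - rott p = d -> 0 <= d -> d <= 2 ->
  (t (rot q) - t (rot p) = d /\ ((r + q) %/ N = (r + p) %/ N)%N) \/
  t (rot q) - t (rot p) = d - 4.
Proof.
rewrite /rott => e d0 d2; set x := ((r + q) %/ N)%N in e *; set y := ((r + p) %/ N)%N in e *.
have [b1 b2] := tb (rot p); have [b3 b4] := tb (rot q).
have [xy|xy|xy] := ltngtP x y.
- have : x%:R + 1 <= y%:R :> R by rewrite natr1 ler_nat.
  lra.
- have [xy1|xy1] := eqVneq x y.+1.
    by right; rewrite xy1 -natr1 in e; lra.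
  have : y%:R + 2 <= x%:R :> R.
    by rewrite -natrD ler_nat addn2 ltn_neqAle eq_sym xy1.
  lra.
- by left; split=> //; rewrite xy in e; lra.
Qed.

Let tl p : ~~ u p -> t p = theta false (a p). Proof. by rewrite /t => /negbTE ->. Qed.

Let sgn p : (if u (rot p) then 0 < hgt (rot p) else hgt (rot p) < 0).
Proof.
have h := rot_out p; case: ifP => hu; first exact: height_gt0 h.
by apply: height_lt0 h; rewrite hu.
Qed.

Let zero_diff p q : t (rot q) - t (rot p) = 0 ->
  u (rot p) = u (rot q) /\ a (rot p) = a (rot q).
Proof.
move=> e; have b1 := theta_bound (u (rot p)) (a (rot p)).
have b2 := theta_bound (u (rot q)) (a (rot q)).
have eu : u (rot p) = u (rot q).
  move: e b1 b2; rewrite /t; case: (u (rot p)); case: (u (rot q)) => // e /andP[x1 x2] /andP[x3 x4]; lra.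
split=> //; apply: (@theta_inj _ (u (rot p))).
by rewrite [in RHS]eu; move: e; rewrite /t; lra.
Qed.

(** The sign of the cross product of two dual vectors depends on the slopes and on
    the signs of the heights, that is, on the types; the angles are compared in
    the same terms. *)
Lemma rot_angular : angular N rotv rott.
Proof.
have per p : rot (p + N) = rot p by rewrite /rot addnA modnDr.
have cont p q : (p <= q)%N -> rott p <= rott q.
  move=> pq; rewrite /rott.
  have lm : ((r + p) %/ N <= (r + q) %/ N)%N by rewrite leq_div2r // leq_add2l.
  have [b1 b2] := tb (rot p); have [b3 b4] := tb (rot q).
  have [e|ne] := eqVneq ((r + p) %/ N)%N ((r + q) %/ N)%N.
    rewrite e lerD2r /rot.
    have lt : ((r + p) %% N <= (r + q) %% N)%N.
      have := divn_eq (r + p) N; have := divn_eq (r + q) N; rewrite e.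
      by move: ((r + q) %/ N * N)%N ((r + p) %% N)%N ((r + q) %% N)%N pq; clear; lia.
    move: lt; rewrite leq_eqVlt => /orP[/eqP -> //|lt].
    by case: (sorted lt (ltn_pmod _ N0)) => [/ltW|[->]].
  have lt : ((r + p) %/ N < (r + q) %/ N)%N by rewrite ltn_neqAle ne.
  have : ((r + p) %/ N)%:R + 1 <= ((r + q) %/ N)%:R :> R by rewrite natr1 ler_nat.
  lra.
split=> //.
- by move=> p; rewrite /rotv per.
- by move=> p; rewrite /rott per addnA divnDr // divnn N0 natrD mulrDr mulr1 addrA.
- move=> p pN; rewrite /rott /rot addn0 (modn_small rN) (divn_small rN) mulr0 addr0.
  have [lt|ge] := ltnP (r + p) N.
    rewrite (modn_small lt) (divn_small lt) mulr0 addr0.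
    by have := tb (ids r); have := tb (ids (r + p)%N); lra.
  have lt2 : (r + p - N < N)%N by lia.
  have e1 : ((r + p) %/ N = 1)%N.
    by rewrite -(subnK ge) divnDr // divnn N0 (divn_small lt2).
  have e2 : ((r + p) %% N = r + p - N)%N.
    by rewrite -[in LHS](subnK ge) modnDr modn_small.
  have lt3 : (r + p - N < r)%N by lia.
  by rewrite e1 e2 mulr1; have := first lt3; lra.
- move=> p q d0 d2; rewrite /rotv cross_dual //.
  have := sgn p; have := sgn q; rewrite /hgt.
  case: (cyc_diff (erefl _) (ltW d0) (ltW d2)) => [[e _]|e];
    move: e; rewrite /t; have := theta_bound (u (rot p)) (a (rot p));
    have := theta_bound (u (rot q)) (a (rot q));
    case: (u (rot p)); case: (u (rot q)) => /andP[x1 x2] /andP[x3 x4] e hq hp; try lra.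
  + have lt : a (rot p) < a (rot q) by rewrite -(theta_lt true); lra.
    by rewrite divr_gt0 ?subr_gt0 // mulr_gt0.
  + have [h1 _ _] := theta_ul (a (rot p)) (a (rot q)).
    have lt : a (rot q) < a (rot p) by rewrite -h1; lra.
    by rewrite ltr_ndivlMr ?mul0r ?subr_lt0 // pmulr_rlt0.
  + have lt : a (rot p) < a (rot q) by rewrite -(theta_lt false); lra.
    by rewrite divr_gt0 ?subr_gt0 // nmulr_rgt0.
  + have [_ h1 _] := theta_ul (a (rot q)) (a (rot p)).
    have lt : a (rot q) < a (rot p) by rewrite -h1; lra.
    by rewrite ltr_ndivlMr ?mul0r ?subr_lt0 // nmulr_rlt0.
- move=> p q d2; have e2 : rott q - rott p = 2 by lra.
  have ea : a (rot p) = a (rot q) /\ u (rot p) != u (rot q).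
    have l0 : 0 <= 2 :> R by []. 
    case: (cyc_diff e2 l0 (lexx _)) => [[e _]|e];
    move: e; rewrite /t; have := theta_bound (u (rot p)) (a (rot p));
    have := theta_bound (u (rot q)) (a (rot q));
    case: (u (rot p)); case: (u (rot q)) => /andP[x1 x2] /andP[x3 x4] e; try lra.
      by split=> //; have [_ _ ->] := theta_ul (a (rot p)) (a (rot q)).
    split=> //; have [_ _ ->] := theta_ul (a (rot q)) (a (rot p)) => //; lra.
  exists (- (hgt (rot p) / hgt (rot q))).
    case: ea => _; have := sgn p; have := sgn q; rewrite oppr_gt0.
    case: (u (rot p)); case: (u (rot q)) => // hq hp _.
      by rewrite pmulr_rlt0 // invr_lt0.
    by rewrite pmulr_llt0 // invr_gt0.
  by rewrite /rotv (dual_scale (proj1 ea)) // !opprK.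
- move=> p q pq e; have e0 : rott q - rott p = 0 by rewrite e subrr.
  have l0 : (0 : R) <= 2 by [].
  have [b1 b2] := tb (rot p); have [b3 b4] := tb (rot q).
  case: (cyc_diff e0 (lexx _) l0) => [[ed em]|ed]; last lra.
  have [eu ea] := zero_diff ed.
  exists (hgt (rot p) / hgt (rot q)); last by rewrite /rotv (dual_scale ea).
  have lt : ((r + p) %% N <= (r + q) %% N)%N.
    have := divn_eq (r + p) N; have := divn_eq (r + q) N; rewrite em.
    by move: ((r + p) %/ N * N)%N ((r + p) %% N)%N ((r + q) %% N)%N pq; clear; lia.
  move: lt; rewrite leq_eqVlt => /orP[/eqP eqm|lt].
    have -> : rot p = rot q by rewrite /rot eqm.
    by rewrite divff // ltr01 lexx.
  case: (sorted lt (ltn_pmod _ N0)); first by rewrite -/(rot _) -/(rot _); lra.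
  move=> [_]; rewrite -/(rot _) -/(rot _) /strength -eu.
  have := sgn p; have := sgn q; rewrite -eu /hgt /height -ea.
  case: (u (rot p)) => hq hp le.
    by rewrite divr_gt0 // ler_pdivrMr // mul1r; lra.
  by rewrite nmulr_rgt0 ?invr_lt0 // hq /= ler_ndivrMr // mul1r; lra.
- move=> p; rewrite /rotv /dot /dual /=.
  by rewrite -!expr2 ltr_wpDl ?sqr_ge0 // div1r exprn_even_gt0 //= invr_eq0; exact: hn.
Qed.

Lemma rotv_side p x y :
  (1 <= dot (rotv p) (x - cx, y - cy)) = (0 <= side (u (rot p)) (a (rot p)) (b (rot p)) x y).
Proof. exact: dual_side. Qed.

End Sorted.

(** * Envelopes of lines *)

Section Envelope.
Variables (R : realFieldType) (a b : nat -> R).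

Definition line i x : R := a i * x + b i.
Definition meet i j : R := (b j - b i) / (a i - a j).

Lemma line_meet i j : a i != a j -> line i (meet i j) = line j (meet i j).
Proof.
move=> ne; have d : a i - a j != 0 by rewrite subr_eq0.
by rewrite /line /meet; field.
Qed.

(** The line [i] is at [x] on the lower (if [c]) or upper envelope of [F]. *)
Definition active (c : bool) (F : seq nat) i x : Prop :=
  {in F, forall z, strength c (line i x) <= strength c (line z x)}.

(** The lines of an envelope, by increasing slopes. [cn_sup] is in polynomial form
    what it means that no line [z] passes beyond the point where two consecutive
    ones meet. *)
Record chain (c : bool) (F : seq nat) (k : nat) (ci : nat -> nat) : Prop := Chain {
  cn_k : (0 < k)%N;
  cn_F : forall i, (i < k)%N -> ci i \in F;
  cn_lt : forall i, (i.+1 < k)%N -> a (ci i) < a (ci i.+1);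
  cn_sup : forall i, (i.+1 < k)%N -> {in F, forall z,
    strength c ((a (ci i.+1) - a z) * b (ci i) + (a z - a (ci i)) * b (ci i.+1)) <=
    strength c ((a (ci i.+1) - a (ci i)) * b z)};
  cn_min : {in F, forall z, a (ci 0) <= a z};
  cn_max : {in F, forall z, a z <= a (ci k.-1)};
  cn_one : k = 1%N -> {in F, forall z, strength c (b (ci 0)) <= strength c (b z)} }.

Let sg (c : bool) : R := if c then 1 else -1.
Let strE c x : strength c x = sg c * x.
Proof. by case: c; rewrite /strength /sg ?mul1r ?mulN1r. Qed.

(** The difference of two lines has the same sign on a segment if it has it at both
    ends. *)
Lemma active_between c F i x1 x x2 : x1 <= x -> x <= x2 ->
  active c F i x1 -> active c F i x2 -> active c F i x.
Proof.
move=> l1 l2 h1 h2 z zF; have := h1 z zF; have := h2 z zF; rewrite /line !strE.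
have [e|ne] := eqVneq x1 x2.
  by have -> : x = x1 by lra.
have d : 0 < x2 - x1 by rewrite subr_gt0 lt_neqAle ne; lra.
set s := sg c => q2 q1.
have w1 : 0 <= x2 - x by lra. have w2 : 0 <= x - x1 by lra.
have p1 := ler_wpM2l w1 q1; have p2 := ler_wpM2l w2 q2.
rewrite -(ler_pM2l d).
have -> : (x2 - x1) * (s * (a i * x + b i)) =
  (x2 - x) * (s * (a i * x1 + b i)) + (x - x1) * (s * (a i * x2 + b i)) by ring.
have -> : (x2 - x1) * (s * (a z * x + b z)) =
  (x2 - x) * (s * (a z * x1 + b z)) + (x - x1) * (s * (a z * x2 + b z)) by ring.
exact: lerD.
Qed.

Lemma active_line c F i j x : line i x = line j x -> active c F i x -> active c F j x.
Proof. by move=> e h z zF; rewrite -e; apply: h. Qed.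

(** Moving in a direction in which no line of the family bends away faster. *)
Lemma active_ray c F i x y : active c F i x ->
  {in F, forall z, strength c (a i * (y - x)) <= strength c (a z * (y - x))} ->
  active c F i y.
Proof.
move=> h sl z zF; have := h z zF; have := sl z zF; rewrite /line !strE.
have e : forall p q : R, p * y + q = (p * x + q) + p * (y - x) by move=> p q; ring.
by rewrite (e (a i)) (e (a z)) !mulrDr; lra.
Qed.

Section Chain.
Variables (c : bool) (F : seq nat) (k : nat) (ci : nat -> nat).
Hypothesis ch : chain c F k ci.

Lemma active_meet i : (i.+1 < k)%N ->
  active c F (ci i) (meet (ci i) (ci i.+1)) /\ active c F (ci i.+1) (meet (ci i) (ci i.+1)).
Proof.
move=> ik; have lt := cn_lt ch ik.
have ne : a (ci i) != a (ci i.+1) by rewrite lt_eqF.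
suff h : active c F (ci i) (meet (ci i) (ci i.+1)).
  by split=> //; apply: active_line h; apply: line_meet.
move=> z zF; have := cn_sup ch ik zF; rewrite !strE /line /meet.
set s := sg c; set p := a (ci i) in ne lt *; set q := a (ci i.+1) in ne lt *.
set bi := b (ci i); set bj := b (ci i.+1) => h.
have d : 0 < q - p by lra.
rewrite -(ler_pM2l d); have d' : p - q != 0 by rewrite subr_eq0.
have -> : (q - p) * (s * (p * ((bj - bi) / (p - q)) + bi)) = s * (q * bi - p * bj).
  by field.
have -> : (q - p) * (s * (a z * ((bj - bi) / (p - q)) + b z)) =
   s * ((q - p) * b z) - s * (a z * (bj - bi)) by field.
rewrite -subr_ge0 in h; rewrite -subr_ge0; congr (0 <= _): h; ring.
Qed.

Lemma chain_one : k = 1%N -> {in F, forall z, a z = a (ci 0)}.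
Proof.
move=> k1 z zF; apply/eqP; rewrite eq_le (cn_min ch zF) andbT.
by have := cn_max ch zF; rewrite k1.
Qed.

Lemma active_only x : k = 1%N -> active c F (ci 0) x.
Proof.
move=> k1 z zF; have := cn_one ch k1 zF; rewrite /line (chain_one k1 zF) !strE.
by rewrite !mulrDr; lra.
Qed.

End Chain.

(** The line of least slope is the lowest far to the right, down to the point where
    it meets the next one. *)
Lemma lower_start F k ci x : chain true F k ci ->
  ((1 < k)%N -> meet (ci 0) (ci 1) <= x) -> active true F (ci 0) x.
Proof.
move=> ch hx; have k0 := cn_k ch; have [k1|k1] := ltnP 1 k.
  have [h _] := active_meet ch k1; apply: active_ray h _ => z zF /=.
  by rewrite ler_wpM2r ?(cn_min ch) // subr_ge0; apply: hx.
by apply: (active_only ch); lia.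
Qed.

Lemma upper_start F k ci x : chain false F k ci ->
  ((1 < k)%N -> meet (ci k.-2) (ci k.-1) <= x) -> active false F (ci k.-1) x.
Proof.
move=> ch hx; have k0 := cn_k ch; have [k1|k1] := ltnP 1 k.
  have e : k.-1 = k.-2.+1 by lia.
  have lt : (k.-2.+1 < k)%N by lia.
  have [_ h] := active_meet ch lt; rewrite e; apply: active_ray h _ => z zF /=.
  rewrite lerN2 ler_wpM2r // -?e ?(cn_max ch) // subr_ge0.
  by apply: hx.
have e : k = 1%N by lia.
by rewrite e; apply: (active_only ch).
Qed.

Lemma lower_end F k ci x y : chain true F k ci -> active true F (ci k.-1) x ->
  y <= x -> active true F (ci k.-1) y.
Proof.
move=> ch h le; apply: active_ray h _ => z zF /=.
by rewrite ler_wnM2r ?(cn_max ch) // subr_le0.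
Qed.

Lemma upper_end F k ci x y : chain false F k ci -> active false F (ci 0) x ->
  y <= x -> active false F (ci 0) y.
Proof.
move=> ch h le; apply: active_ray h _ => z zF /=.
by rewrite lerN2 ler_wnM2r ?(cn_min ch) // subr_le0.
Qed.

(** Two lines compared at two abscissas: the steeper one is higher to the right. *)
Lemma meet_le i j x : a i < a j -> line i x <= line j x -> meet i j <= x.
Proof.
move=> lt; rewrite /line /meet => le; rewrite ler_ndivrMr; last by rewrite subr_lt0.
by rewrite mulrBr; lra.
Qed.

Lemma meet_ge i j x : a i < a j -> line j x <= line i x -> x <= meet i j.
Proof.
move=> lt; rewrite /line /meet => le; rewrite ler_ndivlMr; last by rewrite subr_lt0.
by rewrite mulrBr; lra.
Qed.

(** The lines of an envelope leave it in the order of their slopes. *)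
Lemma lower_meets F k ci i : chain true F k ci -> (i.+2 < k)%N ->
  meet (ci i.+1) (ci i.+2) <= meet (ci i) (ci i.+1).
Proof.
move=> ch ik; have ik1 := ltnW ik; have [_ h] := active_meet ch ik1.
by apply: meet_le; [exact: (cn_lt ch ik)|apply: h; apply: (cn_F ch)].
Qed.

Lemma upper_meets F k ci i : chain false F k ci -> (i.+2 < k)%N ->
  meet (ci i) (ci i.+1) <= meet (ci i.+1) (ci i.+2).
Proof.
move=> ch ik; have ik1 := ltnW ik; have [_ h] := active_meet ch ik1.
have /= := h _ (cn_F ch ik); rewrite lerN2 => le.
exact: (meet_ge (cn_lt ch ik) le).
Qed.

(** * Walking along both envelopes *)

Variables (FU FL : seq nat) (kU kL : nat) (cu cl : nat -> nat).
Hypothesis chU : chain true FU kU cu.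
Hypothesis chL : chain false FL kL cl.

(** State of the walk from right to left: [cu i] and [cl j] are on the envelopes
    at [x], and [pv] is the line of one of the envelopes that was left at [x]. *)
Record walk (i j : nat) (x : R) (started isU : bool) (pv : nat) : Prop := WalkState {
  wk_i : (i < kU)%N;
  wk_j : (j < kL)%N;
  wk_U : active true FU (cu i) x;
  wk_L : active false FL (cl j) x;
  wk_nU : (i.+1 < kU)%N -> meet (cu i) (cu i.+1) <= x;
  wk_nL : (0 < j)%N -> meet (cl j.-1) (cl j) <= x;
  wk_0 : ~~ started -> a (cl j) < a (cu i) -> line (cl j) x < line (cu i) x;
  wk_pv : started -> if isU then
      [/\ pv \in FU, line pv x = line (cu i) x & a pv < a (cl j)]
    else [/\ pv \in FL, line pv x = line (cl j) x & a (cu i) < a pv] }.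

(** To the right of all these meeting points both envelopes have reached their
    extreme lines, and the line of the lower envelope is above that of the upper one
    if it is the steeper one. *)
Lemma walk_init x : meet (cu 0) (cu 1) < x \/ kU = 1%N ->
  meet (cl kL.-2) (cl kL.-1) < x \/ kL = 1%N -> meet (cu 0) (cl kL.-1) < x ->
  walk 0 kL.-1 x false false 0.
Proof.
move=> hU hL hUL; have k0 := cn_k chU; have l0 := cn_k chL; split=> //.
- by rewrite prednK.
- by apply: (lower_start chU); case: hU => [/ltW //|->].
- by apply: (upper_start chL); case: hL => [/ltW //|->].
- by case: hU => [/ltW //|->].
- by case: hL => [/ltW //|->].
- move=> _ lt; rewrite /line; move: hUL; rewrite /meet ltr_pdivrMr ?subr_gt0 //.
  by rewrite mulrBr; lra.
Qed.

(** Stepping to the next line of the lower envelope: [pv] becomes the line that is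
    left, whose slope is still the smaller one. *)
Lemma walk_U i j x st isU pv : walk i j x st isU pv -> a (cu i) < a (cl j) ->
  (i.+1 < kU)%N -> ((0 < j)%N -> meet (cl j.-1) (cl j) <= meet (cu i) (cu i.+1)) ->
  walk i.+1 j (meet (cu i) (cu i.+1)) true true (cu i).
Proof.
move=> w lt ik hj; have [hi1 hi2] := active_meet chU ik.
have le := wk_nU w ik; have jL := wk_j w.
split=> //.
- have [j0|j0] := posnP j.
    by rewrite j0; apply: (upper_end chL _ le); have := wk_L w; rewrite j0.
  have ej : j = j.-1.+1 by rewrite prednK.
  have jl : (j.-1.+1 < kL)%N by rewrite -ej.
  have [_ h] := active_meet chL jl; rewrite -ej in h.
  exact: active_between (hj j0) le h (wk_L w).
- by move=> ik2; apply: (lower_meets chU ik2).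
- split=> //; first exact: (cn_F chU (ltnW ik)).
  by apply: line_meet; rewrite lt_eqF // (cn_lt chU).
Qed.

Lemma walk_L i j x st isU pv : walk i j.+1 x st isU pv -> a (cu i) < a (cl j.+1) ->
  ((i.+1 < kU)%N -> meet (cu i) (cu i.+1) <= meet (cl j) (cl j.+1)) ->
  walk i j (meet (cl j) (cl j.+1)) true false (cl j.+1).
Proof.
move=> w lt hi; have jL := wk_j w; have [hj1 hj2] := active_meet chL jL.
have le : meet (cl j) (cl j.+1) <= x := wk_nL w isT.
split=> //; first exact: wk_i w.
- exact: ltnW.
- have [ik|ik] := ltnP i.+1 kU.
    by have [h _] := active_meet chU ik; apply: active_between (hi ik) le h (wk_U w).
  have ei : i = kU.-1 by have := wk_i w; lia.
  by rewrite ei; apply: (lower_end chU _ le); have := wk_U w; rewrite ei.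
- move=> j0; have ej : j = j.-1.+1 by rewrite prednK.
  by have := @upper_meets FL kL cl j.-1 chL; rewrite -ej; apply.
- split=> //; first exact: (cn_F chL jL).
  by apply/esym/line_meet; rewrite lt_eqF // (cn_lt chL).
Qed.

(** Where the lower envelope is above the upper one, the points between them are
    not covered. *)
Lemma gap i j x : active true FU i x -> active false FL j x -> line j x < line i x ->
  {in FU, forall z, side true (a z) (b z) x ((line i x + line j x) / 2) < 0} /\
  {in FL, forall z, side false (a z) (b z) x ((line i x + line j x) / 2) < 0}.
Proof.
move=> hi hj lt; split=> z zF; rewrite /side.
  by have := hi z zF; rewrite /= {2}/line; lra.
by have := hj z zF; rewrite /= {2}/line lerN2; lra.
Qed.

(** If the last line of the lower envelope still has the smaller slope, then far to
    the left the upper envelope is below it. *)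
Lemma walk_left i j x y st isU pv : walk i j x st isU pv -> a (cu i) < a (cl j) ->
  ~ (i.+1 < kU)%N -> j = 0%N -> y <= x -> y < meet (cu i) (cl j) ->
  [/\ active true FU (cu i) y, active false FL (cl j) y & line (cl j) y < line (cu i) y].
Proof.
move=> w lt ni j0 yx ym; split.
- have ei : i = kU.-1 by have := wk_i w; lia.
  by rewrite ei; apply: (lower_end chU _ yx); have := wk_U w; rewrite ei.
- by rewrite j0; apply: (upper_end chL _ yx); have := wk_L w; rewrite j0.
- move: ym; rewrite /meet ltr_ndivlMr ?subr_lt0 // /line mulrBr; lra.
Qed.

Variable u : nat -> bool.
Hypothesis uU : {in FU, forall z, u z}.
Hypothesis uL : {in FL, forall z, ~~ u z}.

(** A vertical line is covered once an upper half-plane starts below the end of a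
    lower one. *)
Lemma covers_above (s : seq nat) :
  (forall x, exists i j, [/\ i \in s, j \in s, u i, ~~ u j & line i x <= line j x]) ->
  covers u a b s.
Proof.
move=> h x y; have [i [j [is_ js ui uj le]]] := h x.
have [yi|yi] := leP (line i x) y.
  by exists i => //; rewrite /side ui; move: yi; rewrite /line; lra.
by exists j => //; rewrite /side (negbTE uj); move: yi le; rewrite /line; lra.
Qed.

Lemma pair_cover i j x : u i -> ~~ u j -> a i = a j -> line i x <= line j x ->
  covers u a b [:: i; j].
Proof.
move=> ui uj e le; apply: covers_above => x'; exists i, j.
rewrite !inE !eqxx orbT ui uj; split=> //.
by move: le; rewrite /line e; lra.
Qed.

(** At [x] the lower envelope is not above the upper one. To the right of [x] the
    pair with [pv] overlaps, whose slopes are still ordered the other way, and to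
    the left of [x] the pair [cu i], [cl j]. *)
Lemma walk_cover i j x st isU pv : walk i j x st isU pv -> a (cl j) < a (cu i) ->
  line (cu i) x <= line (cl j) x ->
  let s := if isU then [:: pv; cu i; cl j] else [:: cl j; pv; cu i] in
  [/\ covers u a b s, strict3 u a (nth 0 s 0) (nth 0 s 1) (nth 0 s 2) &
      {subset s <= FU ++ FL}]%N.
Proof.
move=> w lt le.
have stt : st by apply/negPn/negP => ns; have := wk_0 w ns lt; rewrite ltNge le.
have iF := cn_F chU (wk_i w); have jF := cn_F chL (wk_j w).
have ui := uU iF; have uj := uL jF.
have := wk_pv w stt; case: isU {w} => -[pF el lp] /=.
- have up := uU pF; split.
  + apply: covers_above => x'; have [xx|xx] := leP x x'.
      exists pv, (cl j); rewrite !inE !eqxx !orbT up uj; split=> //.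
      have : (a (cl j) - a pv) * (x' - x) >= 0 by rewrite mulr_ge0 //; lra.
      by move: le el; rewrite /line mulrBl !mulrBr; lra.
    exists (cu i), (cl j); rewrite !inE !eqxx !orbT ui uj; split=> //.
    have : (a (cu i) - a (cl j)) * (x - x') >= 0 by rewrite mulr_ge0 //; lra.
    by move: le; rewrite /line mulrBl !mulrBr; lra.
  + by split; rewrite ?up ?ui ?(negbTE uj) ?lp ?lt.
  + move=> z; rewrite !inE mem_cat => /or3P[] /eqP ->; rewrite ?pF ?iF ?jF ?orbT //.
- have up := uL pF; split.
  + apply: covers_above => x'; have [xx|xx] := leP x x'.
      exists (cu i), pv; rewrite !inE !eqxx !orbT ui up; split=> //.
      have : (a pv - a (cu i)) * (x' - x) >= 0 by rewrite mulr_ge0 //; lra.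
      by move: le el; rewrite /line mulrBl !mulrBr; lra.
    exists (cu i), (cl j); rewrite !inE !eqxx !orbT ui uj; split=> //.
    have : (a (cu i) - a (cl j)) * (x - x') >= 0 by rewrite mulr_ge0 //; lra.
    by move: le; rewrite /line mulrBl !mulrBr; lra.
  + by split; rewrite ?ui ?(negbTE up) ?(negbTE uj) ?lp ?lt.
  + move=> z; rewrite !inE mem_cat => /or3P[] /eqP ->; rewrite ?pF ?iF ?jF ?orbT //.
Qed.

End Envelope.

(** * Hulls of families of half-planes *)

Section HullLines.
Variables (R : realFieldType) (u : nat -> bool) (a b : nat -> R) (cx cy : R).
Variables (N r : nat) (ids : nat -> nat).
Let t i := theta (u i) (a i).

(** The listing [ids] goes round by increasing angle, the largest half-plane first
    among parallel ones of a type, and the center is in none of the half-planes. *)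
Record listing : Prop := Listing {
  ls_r : (r < N)%N;
  ls_out : forall p, (p < N)%N -> side (u (ids p)) (a (ids p)) (b (ids p)) cx cy < 0;
  ls_sorted : forall p q, (p < q)%N -> (q < N)%N ->
    t (ids p) < t (ids q) \/ (t (ids p) = t (ids q) /\
      strength (u (ids p)) (b (ids p)) <= strength (u (ids q)) (b (ids q)));
  ls_first : forall p, (p < r)%N -> t (ids p) < t (ids r) }.

Hypothesis L : listing.
Let w := rotv a b cx cy N r ids.
Let th := rott u a N r ids.
Let id := rot N r ids.

Lemma listing_angular : angular N w th.
Proof. by case: L => *; apply: rot_angular. Qed.

Let ang := listing_angular.

Lemma listing_side p x y :
  (1 <= dot (w p) (x - cx, y - cy)) = (0 <= side (u (id p)) (a (id p)) (b (id p)) x y).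
Proof. by case: L => *; apply: rotv_side. Qed.

Lemma rot_per p q : id (p + N * q)%N = id p.
Proof. by rewrite /id /rot addnA [(N * q)%N]mulnC addnC modnMDl. Qed.

Lemma rot_onto q : (q < N)%N -> exists2 p, (p < N)%N & id p = ids q.
Proof.
move=> qN; have rN := ls_r L; exists ((q + (N - r)) %% N)%N.
  by rewrite ltn_mod; apply: leq_ltn_trans rN.
by rewrite /id /rot modnDmr addnCA subnKC ?(ltnW rN) // modnDr modn_small.
Qed.

Section Colouring.
Hypothesis inj : forall p q, (p < N)%N -> (q < N)%N -> ids p = ids q -> p = q.
Variables (k : nat) (h : nat -> nat).
Hypothesis hull : chull N w th k h.
Variable bl : nat -> bool.
Hypothesis col : hull_coloring w k h bl.

Definition red i : Prop := exists2 j, ~~ bl j & i = id (h j).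

Lemma hull_turn j m : h (j + k * m)%N = (h j + N * m)%N.
Proof.
elim: m => [|m IH]; first by rewrite !muln0 !addn0.
by rewrite !mulnSr !addnA (ch_per hull) IH.
Qed.

Let mod_turn x y : (x %% N = y %% N)%N -> (x + N * (y %/ N) = y + N * (x %/ N))%N.
Proof.
move=> e; rewrite {1}(divn_eq x N) {2}(divn_eq y N) e !(mulnC N).
by rewrite addnAC [RHS]addnAC [X in (X + _)%N]addnC.
Qed.

(** Hull positions increase, also from one turn to the next. *)
Lemma hull_strict i j p : (h i < p < h i.+1)%N -> id p <> id (h j).
Proof.
move=> /andP[p1 p2] /inj; have N0 : (0 < N)%N := ang_N ang.
rewrite !ltn_mod N0 => /(_ isT isT) e.
have em : (h j %% N = p %% N)%N by apply/esym/eqP; rewrite -(eqn_modDl r) e.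
set q1 := (p %/ N)%N; set q2 := (h j %/ N)%N.
have e2 : h (j + k * q1)%N = (p + N * q2)%N by rewrite hull_turn mod_turn.
have l1 : (h (i + k * q2) < h (j + k * q1))%N by rewrite e2 hull_turn ltn_add2r.
have l2 : (h (j + k * q1) < h (i + k * q2).+1)%N.
  by rewrite e2 -[(i + k * q2).+1%N]/((i.+1 + k * q2)%N) hull_turn ltn_add2r.
have [le|gt] := leqP (j + k * q1)%N (i + k * q2)%N.
  by have := h_mono hull le; rewrite leqNgt l1.
by have := h_mono hull gt; rewrite leqNgt l2.
Qed.

Let inn x y i := 0 <= side (u i) (a i) (b i) x y.

Lemma two_red x y p q : (p < N)%N -> (q < N)%N -> p != q ->
  inn x y (id p) -> inn x y (id q) -> exists2 i, red i & inn x y i.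
Proof.
rewrite /inn -!listing_side => pN qN pq hp hq.
have [j /andP[nb hj]] := red_of_two ang hull col pN qN pq hp hq.
by exists (id (h j)); [exists j|rewrite -listing_side].
Qed.

Lemma hull_idx j : exists2 p, (p < N)%N & id (h j) = ids p.
Proof.
exists ((r + h j) %% N)%N => //; rewrite ltn_mod; exact: ang_N ang.
Qed.

Lemma three_blue x y p q s : (p < N)%N -> (q < N)%N -> (s < N)%N ->
  p != q -> q != s -> p != s -> inn x y (id p) -> inn x y (id q) -> inn x y (id s) ->
  exists p', [/\ (p' < N)%N, ~ red (ids p') & inn x y (ids p')].
Proof.
rewrite /inn -!listing_side => pN qN sN pq qs ps hp hq hs.
have N0 : (0 < N)%N := ang_N ang.
have fin m : ~ red (id m) -> inn x y (id m) ->
  exists p', [/\ (p' < N)%N, ~ red (ids p') & inn x y (ids p')].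
  by move=> h1 h2; exists ((r + m) %% N)%N; rewrite ltn_mod.
have [[j /andP[bj hj]]|[i [m /andP[hm em]]]] :=
    blue_of_three ang hull col pN qN sN pq qs ps hp hq hs.
- apply: (fin (h j)); last by rewrite /inn -listing_side.
  move=> [j' nb /inj e]; have {e} := e _ _; rewrite !ltn_mod => /(_ N0 N0) e.
  have em : (h j %% N = h j' %% N)%N by apply/eqP; rewrite -(eqn_modDl r) e.
  set q1 := (h j %/ N)%N; set q2 := (h j' %/ N)%N.
  have e2 : h (j + k * q2)%N = h (j' + k * q1)%N by rewrite !hull_turn mod_turn.
  have e3 : (j + k * q2 = j' + k * q1)%N.
    have hl x1 x2 : (x1 < x2)%N -> (h x1 < h x2)%N.
      by move=> lt; apply: leq_trans (ch_lt hull x1) (h_mono hull lt).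
    have [lt|gt|//] := ltngtP (j + k * q2)%N (j' + k * q1)%N.
      by have := hl _ _ lt; rewrite e2 ltnn.
    by have := hl _ _ gt; rewrite e2 ltnn.
  have bk m z : bl (m + k * z)%N = bl m.
    by elim: z => [|z IH]; rewrite ?muln0 ?addn0 // mulnSr addnA (hc_per col).
  by move: nb; rewrite -(bk j' q1) -e3 bk bj.
- apply: (fin m); last by rewrite /inn -listing_side.
  by move=> [j' _]; apply: hull_strict hm.
Qed.

End Colouring.

Section OneType.
Variable c : bool.
Hypothesis r0 : r = 0%N.
Hypothesis uc : forall p, (p < N)%N -> u (ids p) = c.
Variables (k : nat) (h : nat -> nat).
Hypothesis hull : chull N w th k h.

Let idE p : (p < N)%N -> id p = ids p.
Proof. by move=> pN; rewrite /id /rot r0 add0n modn_small. Qed.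

Let thE p : (p < N)%N -> th p = theta c (a (ids p)).
Proof.
move=> pN; rewrite /th /rott -/id idE // r0 add0n divn_small // mulr0 addr0.
by rewrite (uc pN).
Qed.

Let hk : h k = N.
Proof. by have := ch_per hull 0; rewrite (ch_0 hull) !add0n. Qed.

Let hlt i : (i < k)%N -> (h i < N)%N.
Proof.
by move=> ik; rewrite -hk; apply: leq_trans (ch_lt hull i) (h_mono hull ik).
Qed.

Let N0 : (0 < N)%N := ang_N ang.

Let hgt p : (p < N)%N -> let z := height a b cx cy (ids p) in if c then 0 < z else z < 0.
Proof.
move=> pN; have o := ls_out L pN; have up := uc pN; case: c up => up /=.
  by apply: height_gt0 o; rewrite up.
by apply: height_lt0 o; rewrite up.
Qed.

Let crossE p q : (p < N)%N -> (q < N)%N -> cross (w p) (w q) =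
  (a (ids q) - a (ids p)) / (height a b cx cy (ids p) * height a b cx cy (ids q)).
Proof.
move=> pN qN; rewrite /w /rotv -/id !idE // cross_dual //.
  exact: height_neq0 (ls_out L pN).
exact: height_neq0 (ls_out L qN).
Qed.

Let amono p q : (p <= q)%N -> (q < N)%N -> a (ids p) <= a (ids q).
Proof.
move=> pq qN; have pN := leq_ltn_trans pq qN.
by rewrite leNgt -(theta_lt c) -!thE // -leNgt (ang_le ang).
Qed.

(** If the center is below all upper half-planes (or above all lower ones), the hull
    of the dual vectors is the envelope of the lines: [support] at two consecutive
    vertices is [cn_sup] after clearing the heights, whose signs are known. The
    first and the last line have extreme slopes because hull and listing start at
    the same position. *)
Lemma chain_of_hull : chain a b c [seq ids p | p <- iota 0 N] k (fun i => id (h i)).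
Proof.
have k0 := ch_k hull; have h0 := ch_0 hull.
have ci i : (i < k)%N -> id (h i) = ids (h i) by move=> ik; rewrite idE // hlt.
have inF p : p \in iota 0 N -> (p < N)%N by rewrite mem_iota add0n.
have slope i : (i.+1 < k)%N -> a (ids (h i)) < a (ids (h i.+1)).
  move=> ik; rewrite -(theta_lt c) -!thE ?hlt //; last exact: ltnW.
  exact: (ch_th hull).
split=> //.
- by move=> i ik; rewrite ci //; apply: map_f; rewrite mem_iota add0n hlt.
- by move=> i ik; rewrite !ci ?(ltnW ik) // slope.
- move=> i ik z /mapP[p /inF pN ->]; have ik0 := ltnW ik; rewrite !ci //.
  have lt := slope i ik.
  have t2 : th (h i.+1) - th (h i) < 2.
    rewrite !thE ?hlt //.
    have := theta_bound c (a (ids (h i))); have := theta_bound c (a (ids (h i.+1))).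
    by case: (c) => /andP[x1 x2] /andP[x3 x4]; lra.
  have := support ang hull p t2; rewrite !crossE ?hlt //.
  have := hgt pN; have := hgt (hlt ik0); have := hgt (hlt ik).
  rewrite /height /strength /=.
  set A := a (ids (h i)) in lt *; set B := a (ids (h i.+1)) in lt *; set P := a (ids p).
  set bi := b (ids (h i)); set bj := b (ids (h i.+1)); set bp := b (ids p).
  have key (X Y Z : R) : 0 < X * Y * Z -> X != 0 -> Y != 0 -> Z != 0 ->
      (B - P) / (Z * Y) + (P - A) / (X * Z) <= (B - A) / (X * Y) ->
      (B - P) * X + (P - A) * Y <= (B - A) * Z.
    move=> pos x0 y0 z0; rewrite -(ler_pM2l pos).
    have -> : X * Y * Z * ((B - P) / (Z * Y) + (P - A) / (X * Z)) =
      (B - P) * X + (P - A) * Y by field; rewrite x0 y0 z0.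
    by have -> : X * Y * Z * ((B - A) / (X * Y)) = (B - A) * Z by field; rewrite x0 y0.
  have key2 (X Y Z : R) : X * Y * Z < 0 -> X != 0 -> Y != 0 -> Z != 0 ->
      (B - P) / (Z * Y) + (P - A) / (X * Z) <= (B - A) / (X * Y) ->
      (B - A) * Z <= (B - P) * X + (P - A) * Y.
    move=> pos x0 y0 z0; rewrite -(ler_nM2l pos).
    have -> : X * Y * Z * ((B - P) / (Z * Y) + (P - A) / (X * Z)) =
      (B - P) * X + (P - A) * Y by field; rewrite x0 y0 z0.
    by have -> : X * Y * Z * ((B - A) / (X * Y)) = (B - A) * Z by field; rewrite x0 y0.
  case: (c) => hj hi hp le.
    have := key _ _ _ _ _ _ _ le.
    rewrite !mulr_gt0 // !gt_eqF // => /(_ isT isT isT isT) {}le.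
    rewrite -subr_ge0 in le; rewrite -subr_ge0; congr (0 <= _): le; ring.
  have := key2 _ _ _ _ _ _ _ le; rewrite !lt_eqF //.
  rewrite nmulr_llt0 // nmulr_rgt0 // => /(_ hj isT isT isT) {}le.
  rewrite -subr_ge0 in le; rewrite -subr_ge0; congr (0 <= _): le; ring.
- by move=> z /mapP[p /inF pN ->]; rewrite ci // h0; apply: amono.
- move=> z /mapP[p /inF pN ->]; rewrite ci; last by rewrite prednK.
  have [le|gt] := leqP p (h k.-1); first by apply: amono le (hlt _); rewrite prednK.
  have [|x [y [x0 y0 xy e]]] := @ch_dom _ _ _ _ _ _ hull k.-1 p.
    by rewrite (ltnW gt) prednK // hk (ltnW pN).
  rewrite leNgt; apply/negP => lt.
  have c0 : 0 < cross (w (h k.-1)) (w p).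
    apply: (ang_cross ang); rewrite !thE ?hlt ?prednK //.
      by rewrite subr_gt0 theta_lt.
    have := theta_bound c (a (ids (h k.-1))); have := theta_bound c (a (ids p)).
    by case: (c) => /andP[x1 x2] /andP[x3 x4]; lra.
  have le0 : cross (w (h k.-1)) (w (h k)) <= 0.
    have -> : w (h k) = w 0 by rewrite hk -[N]add0n (ang_wN ang).
    rewrite crossE ?hlt ?prednK //.
    have m0 : a (ids 0) <= a (ids (h k.-1)) by apply: amono (hlt _); rewrite ?prednK.
    have := hgt N0; have := @hgt (h k.-1); rewrite hlt ?prednK // => /(_ isT).
    case: (c) => /= q1 q2; rewrite mulr_le0_ge0 ?subr_le0 // invr_ge0.
      by apply: mulr_ge0; apply: ltW.
    by rewrite -mulrNN; apply: mulr_ge0; rewrite oppr_ge0; apply: ltW.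
  move: c0; rewrite e prednK //.
  have -> : cross (w (h k.-1)) (comb x (w (h k.-1)) y (w (h k))) =
     y * cross (w (h k.-1)) (w (h k)) by rewrite /cross /comb /=; ring.
  by apply/negP; rewrite -leNgt; apply: mulr_ge0_le0.
- move=> k1 z /mapP[p /inF pN ->]; rewrite ci // h0.
  have [->//|p0] := posnP p.
  have [|x [y [x0 y0 xy e]]] := @ch_dom _ _ _ _ _ _ hull 0 p.
    by rewrite h0 -k1 hk leq0n (ltnW pN).
  have ew : w (h 1) = w (h 0) by rewrite -k1 hk h0 -[N]add0n (ang_wN ang).
  have ea : a (ids 0) = a (ids p).
    have : cross (w 0) (w p) = 0 by rewrite e ew h0 /cross /comb /=; ring.
    rewrite crossE // => /eqP; rewrite mulf_eq0 invr_eq0 mulf_eq0.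
    rewrite !(negbTE (height_neq0 (ls_out L _))) // !orbF subr_eq0 => /eqP ->//.
  have := ls_sorted L p0 pN; rewrite /t !uc // -ea ltxx.
  by case=> // -[].
Qed.

End OneType.

End HullLines.

(** * Choosing the blue hull vertices greedily *)

Section Picking.
Variables (R : realFieldType) (u : nat -> bool) (a b : nat -> R) (cx cy : R).
Variables (N r : nat) (ids : nat -> nat).
Hypothesis L : listing u a b cx cy N r ids.
Hypothesis inj : forall p q, (p < N)%N -> (q < N)%N -> ids p = ids q -> p = q.
Let w := rotv a b cx cy N r ids.
Let th := rott u a N r ids.
Let id := rot N r ids.
Let ang : angular N w th := listing_angular L.
Variables (k : nat) (h : nat -> nat).
Hypothesis hull : chull N w th k h.

Lemma idh_turn j x : id (h (j + k * x)%N) = id (h j).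
Proof. by rewrite (hull_turn hull) /id rot_per. Qed.

(** An index occurs once per turn of the hull. *)
Lemma idh_same i j : id (h i) = id (h j) -> exists x y, (i + k * x = j + k * y)%N.
Proof.
have N0 : (0 < N)%N := ang_N ang.
move=> /inj; rewrite !ltn_mod N0 => /(_ isT isT) e.
have em : (h i %% N = h j %% N)%N by apply/eqP; rewrite -(eqn_modDl r) e.
exists (h j %/ N)%N, (h i %/ N)%N.
have e2 : h (i + k * (h j %/ N))%N = h (j + k * (h i %/ N))%N.
  rewrite !(hull_turn hull) {1}(divn_eq (h i) N) {2}(divn_eq (h j) N) em !(mulnC N).
  by rewrite addnAC [RHS]addnAC [X in (X + _)%N]addnC.
have hl x1 x2 : (x1 < x2)%N -> (h x1 < h x2)%N.
  by move=> lt; apply: leq_trans (ch_lt hull x1) (h_mono hull lt).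
set X := (i + _)%N in e2 *; set Y := (j + _)%N in e2 *.
by have [lt|gt|//] := ltngtP X Y; [have := hl _ _ lt|have := hl _ _ gt]; rewrite e2 ltnn.
Qed.

(** The condition under which a hull vertex may be blue while its neighbours are
    red. *)
Definition ripe j : Prop :=
  0 < cross (w (h j)) (w (h j.+2)) /\ forall p, ~~ in_ear w h j p.

Lemma ripe_turn j x : ripe (j + k * x) <-> ripe j.
Proof.
have ht i : h (i + k * x)%N = (h i + N * x)%N := hull_turn hull i x.
have wt p : w (p + N * x)%N = w p := w_turn ang p x.
have h2 : h (j + k * x).+2 = (h j.+2 + N * x)%N := ht j.+2.
have h1 : h (j + k * x).+1 = (h j.+1 + N * x)%N := ht j.+1.
have earE p : in_ear w h (j + k * x)%N (p + N * x)%N = in_ear w h j p.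
  by rewrite /in_ear /ear h1 h2 ht !wt !ltn_add2r eqn_add2r.
rewrite /ripe h2 ht !wt; split=> -[c e]; split=> // p; first by rewrite -earE.
apply/negP => ep; move: (ep); rewrite /in_ear ht => /andP[hp _].
have Np : (N * x <= p)%N by apply: leq_trans (leq_addl _ _) (ltnW hp).
by move: ep; rewrite -(subnK Np) earE (negbTE (e _)).
Qed.

Definition blue (col : nat -> nat) j : bool := col (id (h j)) == 0%N.

Lemma blue_turn col j x : blue col (j + k * x) = blue col j.
Proof. by rewrite /blue idh_turn. Qed.

(** The colouring when the hull vertices from 1 on but before [i] have been
    considered: [pk_max] is maximality for these only. Red is 1, and blue is 0. *)
Record picked (col : nat -> nat) (i : nat) : Prop := Picked {
  pk_col : forall x, col x = 0%N \/ (col x = 1%N /\ exists j, x = id (h j));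
  pk_adj : forall j, blue col j -> ~~ blue col j.+1;
  pk_ripe : forall j, blue col j.+1 -> ripe j;
  pk_max : forall j, (j.+1 < i)%N -> ~~ blue col j.+1 -> ripe j ->
    blue col j || blue col j.+2 }.

Lemma picked_init col :
  (forall x, col x = 0%N \/ (col x = 1%N /\ exists j, x = id (h j))) ->
  (forall j, (j < k)%N -> col (id (h j)) = 1%N) -> picked col 1.
Proof.
move=> c1 c2; have nb j : ~~ blue col j.
  by rewrite (divn_eq j k) addnC mulnC blue_turn /blue c2 // ltn_mod (ch_k hull).
by split=> // j; rewrite ?nb // (negbTE (nb _)).
Qed.

Lemma picked_skip col i : picked col i.+1 -> (ripe i -> blue col i || blue col i.+2) ->
  picked col i.+2.
Proof.
move=> [c1 adj rp mx] h1; split=> // j; rewrite !ltnS leq_eqVlt => /predU1P[->|lt] nb; first exact: h1.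
exact: mx.
Qed.

(** That the ripe vertex is not its own neighbour follows from the positive cross
    product; so its neighbours, which are red, stay red. Turning a vertex blue
    preserves maximality where it holds already. *)
Lemma picked_take col col' i : picked col i.+1 -> ripe i -> ~~ blue col i ->
  ~~ blue col i.+2 ->
  (forall x, col' x = if x == id (h i.+1) then 0%N else col x) -> picked col' i.+2.
Proof.
move=> [c1 adj rp mx] ri b0 b2 c'.
have b'E j : blue col' j = (id (h j) == id (h i.+1)) || blue col j.
  by rewrite /blue c'; case: (id (h j) == _).
have same j d e : id (h (j + d)%N) = id (h (e + d)%N) -> forall d', id (h (j + d')%N) = id (h (e + d')%N).
  move=> /idh_same[x [y exy]] d'; rewrite -(idh_turn _ x) -[RHS](idh_turn _ y).
  have {}exy : (j + k * x = e + k * y)%N.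
    by apply: (@addIn d); rewrite addnAC exy addnAC.
  by rewrite addnAC exy addnAC.
split.
- by move=> x; rewrite c'; case: eqP => _; [left|apply: c1].
- move=> j; rewrite !b'E => /orP[/eqP e|bj]; apply/norP; split.
  + apply/negP => /eqP e2.
    have /idh_same[x [y exy]] : id (h i.+2) = id (h i.+1).
      rewrite -e2 -(addn1 i.+1) -(addn1 j); apply/esym; apply: (same _ 0%N).
      by rewrite !addn0.
    have k1 : k = 1%N.
      apply/eqP; rewrite -dvdn1 -(@dvdn_addl (k * x)%N) ?dvdn_mulr //.
      have -> : (1 + k * x = k * y)%N by apply: (@addnI i.+1); rewrite addnA addn1 exy.
      by rewrite dvdn_mulr.
    case: ri; have -> : w (h i.+2) = w (h i).
      by rewrite -addn2 -[2%N]mul1n -k1 (hull_turn hull) (w_turn ang).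
    by rewrite crossvv ltxx.
  + have e2 : id (h j.+1) = id (h i.+2).
      by rewrite -(addn1 j) -(addn1 i.+1); apply: (same _ 0%N); rewrite !addn0.
    by move: b2; rewrite /blue e2.
  + apply/negP => /eqP e; have e2 : id (h j) = id (h i).
      by rewrite -(addn0 j) -(addn0 i); apply: (same _ 1%N); rewrite !addn1.
    by move: b0 bj; rewrite /blue e2 => /negbTE ->.
  + exact: adj.
- move=> j; rewrite b'E => /orP[/eqP|]; last exact: rp.
  move/idh_same=> [x [y exy]]; apply/(ripe_turn j x).
  have -> : (j + k * x = i + k * y)%N by move: exy; rewrite !addSn => -[].
  by apply/ripe_turn.
- move=> j; rewrite !ltnS leq_eqVlt => /predU1P[->|lt]; first by rewrite b'E eqxx.
  rewrite !b'E => /norP[_ nb] rj.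
  by have /orP[->|->] := mx j lt nb rj; rewrite ?orbT.
Qed.

Lemma picked_all col : picked col k.+1 -> hull_coloring w k h (blue col).
Proof.
case=> c1 adj rp mx; have k0 := ch_k hull; split=> //.
- by move=> i; have := blue_turn col i 1; rewrite muln1.
- move=> j nb c e; pose j' := (j %% k)%N; pose q := (j %/ k)%N.
  have ej : j = (j' + k * q)%N by rewrite addnC mulnC -divn_eq.
  have := mx j'; rewrite !ltnS ltn_mod k0 => /(_ isT).
  rewrite -(blue_turn _ j'.+1 q) -(blue_turn _ j' q) -(blue_turn _ j'.+2 q) !addSn -ej.
  by apply=> //; apply/(ripe_turn j' q); rewrite -ej.
Qed.

End Picking.

(** * Good colourings of indexed half-planes *)

Section GoodLines.
Variables (R : realFieldType) (n : nat) (u : nat -> bool) (a b : nat -> R).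
Let inn x y i := 0 <= side (u i) (a i) (b i) x y.
Let H := iota 0 n.
Implicit Types (s t : seq nat).

(** The combinatorial content of a good 2-colouring, for half-planes indexed by
    numbers below [n]. *)
Definition good_lines (red : nat -> bool) : Prop := forall x y i j l,
  (i < n)%N -> (j < n)%N -> (l < n)%N -> i != j -> j != l -> i != l ->
  0 <= side (u i) (a i) (b i) x y -> 0 <= side (u j) (a j) (b j) x y ->
  0 <= side (u l) (a l) (b l) x y ->
  forall c, exists2 p, (p < n)%N && (red p == c) & 0 <= side (u p) (a p) (b p) x y.

Let inH i : (i \in H) = (i < n)%N.
Proof. by rewrite mem_iota add0n. Qed.

Lemma covers_sub (v : nat -> bool) s t : {subset s <= t} -> covers v a b s -> covers v a b t.
Proof. by move=> st c x y; have [i /st ? ?] := c x y; exists i. Qed.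

(** A point in three half-planes is in a red one, as the red ones cover. If it is in
    no blue one, the three are all members of the cover. *)
Lemma good_cover s : {subset s <= H} -> (size s <= 3)%N -> covers u a b s ->
  ((2 < size s)%N -> forall x y, ~ exact_at u a b H s x y) -> good_lines [in s].
Proof.
move=> sH sz cov nex x y i j l iN jN lN ij jl il hi hj hl c.
case: c.
  by have [p ps hp] := cov x y; exists p => //; rewrite -inH sH //= ps.
have [/hasP[p pH /andP[ps hp]]|no] := boolP (has (fun p => (p \notin s) && inn x y p) H).
  by exists p => //; rewrite -inH pH /= (negbTE ps).
have ins p : (p < n)%N -> inn x y p -> p \in s.
  move=> pn hp; apply: contraNT no => ps.
  by apply/hasP; exists p; rewrite ?inH // ps.
have un : uniq [:: i; j; l] by rewrite /= !inE negb_or ij il jl.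
have sub : {subset [:: i; j; l] <= s}.
  by move=> z; rewrite !inE => /or3P[] /eqP ->; apply: ins.
have s3 := uniq_leq_size un sub.
have [_ eq] := uniq_min_size un sub sz.
case: (nex s3 x y); split=> z zs.
  by move: zs; rewrite -eq !inE => /or3P[] /eqP ->.
by rewrite inH in zs; move=> zn; rewrite ltNge; apply: contra zn; apply: ins.
Qed.

(** The types after complementing the members of [s], up to boundaries. *)
Definition flip s (i : nat) : bool := u i (+) (i \in s).

Lemma flip_uncovered s x y :
  {in H, forall i, side (flip s i) (a i) (b i) x y < 0} -> {subset s <= H} ->
  exact_at u a b H s x y.
Proof.
move=> o sH; split=> i hi; last first.
  by move=> his; have := o i hi; rewrite /flip (negbTE his) addbF.
have := o i (sH i hi); rewrite /flip hi addbT side_flip => ?.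
by rewrite ltW // -oppr_lt0.
Qed.

(** An exact point could be moved into the interiors of the three half-planes by
    [exact_interior], where the flipped family does not cover it. *)
Lemma flip_covered i j k x y : strict3 u a i j k ->
  forall e f, e \in [:: i; j; k] -> f \in [:: i; j; k] -> e != f ->
  covers u a b [seq l <- H | l != e] -> covers u a b [seq l <- H | l != f] ->
  {subset [:: i; j; k] <= H} ->
  covers (flip [:: i; j; k]) a b H -> ~ exact_at u a b H [:: i; j; k] x y.
Proof.
move=> [uij uk /andP[ik kj]] e f es fs ef ce cf sH cov ex.
have ij := lt_trans ik kj.
have [g [ge gf eg]] : exists g, [/\ a g != a e, a g != a f & a e != a f /\
    [:: e; f; g] =i [:: i; j; k]].
  move: es fs ef; rewrite !inE.
  have d1 : a i != a j by rewrite lt_eqF.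
  have d2 : a i != a k by rewrite lt_eqF.
  have d3 : a k != a j by rewrite lt_eqF.
  move=> /or3P[] /eqP -> /or3P[] /eqP ->; rewrite ?eqxx // => _.
  - exists k; rewrite d3 [a k == _]eq_sym d2 d1; split=> //; split=> // z; rewrite !inE.
  - exists j; rewrite [a j == a k]eq_sym d3 [a j == _]eq_sym d1 d2; split=> //; split=> // z.
    by rewrite !inE; case: (z == i); case: (z == j); case: (z == k).
  - exists k; rewrite d3 [a k == a i]eq_sym d2 [a j == a i]eq_sym d1; split=> //; split=> // z.
    by rewrite !inE; case: (z == i); case: (z == j); case: (z == k).
  - exists i; rewrite d2 d1 [a j == a k]eq_sym d3; split=> //; split=> // z.
    by rewrite !inE; case: (z == i); case: (z == j); case: (z == k).
  - exists j; rewrite [a j == a k]eq_sym d3 [a j == a i]eq_sym d1 [a k == a i]eq_sym d2.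
    split=> //; split=> // z.
    by rewrite !inE; case: (z == i); case: (z == j); case: (z == k).
  - exists i; rewrite d2 d1 d3; split=> //; split=> // z.
    by rewrite !inE; case: (z == i); case: (z == j); case: (z == k).
case: eg => aef eg.
have ex' : exact_at u a b H [:: e; f; g] x y.
  by case: ex => e1 e2; split=> z; rewrite eg; [apply: e1|apply: e2].
have [||x' [y' [in' out']]] := exact_interior aef _ _ ex' ce cf.
- by rewrite eq_sym.
- by rewrite eq_sym.
have [z zH] := cov x' y'; rewrite /flip -eg.
have [zs|zs] := boolP (z \in [:: e; f; g]).
  by rewrite addbT side_flip oppr_ge0 leNgt in' .
by rewrite addbF leNgt out'.
Qed.

Lemma strict3_neq i j k : strict3 u a i j k -> [/\ i != j, j != k & i != k].
Proof.
move=> [_ _ /andP[h1 h2]]; have h3 := lt_trans h1 h2.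
by split; apply/eqP => e; move: h1 h2 h3; rewrite e ?ltxx.
Qed.

Let cover_without (s : seq nat) e : {subset s <= H} -> covers u a b s -> e \notin s ->
  covers u a b [seq l <- H | l != e].
Proof.
move=> sH c es; apply: covers_sub c => z zs; rewrite mem_filter sH // andbT.
by apply: contraNneq es => <-.
Qed.

Section Triples.
Variables e1 e2 e3 f1 f2 f3 g1 g2 g3 : nat.
Let E := [:: e1; e2; e3].
Let F := [:: f1; f2; f3].
Let G := [:: g1; g2; g3].
Hypotheses (sE : strict3 u a e1 e2 e3) (sF : strict3 u a f1 f2 f3)
  (sG : strict3 u a g1 g2 g3).
Hypotheses (cE : covers u a b E) (cF : covers u a b F) (cG : covers u a b G).
Hypotheses (hE : {subset E <= H}) (hF : {subset F <= H}) (hG : {subset G <= H}).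
Hypotheses (nF : e1 \notin F) (nG : e2 \notin G).

(** [F] and [G] show that [e1] and [e2] are not needed to cover the plane. *)
Lemma good_first : covers (flip E) a b H -> good_lines [in E].
Proof.
move=> cov; apply: good_cover => // _ x y; have [n12 _ _] := strict3_neq sE.
apply: (flip_covered sE (e := e1) (f := e2)); rewrite ?inE ?eqxx ?orbT //.
  exact: cover_without nF.
exact: cover_without nG.
Qed.

(** Every member of [F] other than [e3] can be spared: [e2] because of [G], and any
    half-plane not in [E] because of [E]. *)
Lemma good_second : covers (flip F) a b H -> good_lines [in F].
Proof.
move=> cov; apply: good_cover => // _ x y; have [n12 n23 n13] := strict3_neq sF.
have rest f : f \in F -> f != e3 -> covers u a b [seq l <- H | l != f].
  move=> fF fe; have [fE|fE] := boolP (f \in E); last exact: cover_without fE.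
  move: fE; rewrite !inE => /or3P[] /eqP e; move: fF fe; rewrite e ?eqxx //.
    by rewrite (negbTE nF).
  by move=> _ _; apply: cover_without nG.
have [x1|x1] := eqVneq f1 e3.
  apply: (flip_covered sF (e := f2) (f := f3)); rewrite ?inE ?eqxx ?orbT //; apply: rest.
  - by rewrite !inE eqxx orbT.
  - by rewrite -x1 eq_sym.
  - by rewrite !inE eqxx !orbT.
  - by rewrite -x1 eq_sym.
have [x2|x2] := eqVneq f2 e3.
  apply: (flip_covered sF (e := f1) (f := f3)); rewrite ?inE ?eqxx ?orbT //; apply: rest => //.
  - by rewrite !inE eqxx.
  - by rewrite !inE eqxx !orbT.
  - by rewrite -x2 eq_sym.
apply: (flip_covered sF (e := f1) (f := f2)); rewrite ?inE ?eqxx ?orbT //; apply: rest => //.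
  by rewrite !inE eqxx.
by rewrite !inE eqxx orbT.
Qed.

Lemma good_third x y x' y' :
  {in H, forall i, side (flip E i) (a i) (b i) x y < 0} ->
  {in H, forall i, side (flip F i) (a i) (b i) x' y' < 0} -> good_lines [in G].
Proof.
move=> /flip_uncovered/(_ hE) xE /flip_uncovered/(_ hF) xF.
apply: good_cover => // _ z t xG.
by apply: (three_covers sE _ _ cE cF cG hE hF hG nF nG xE xF xG);
  [exists f1, f2, f3|exists g1, g2, g3].
Qed.

End Triples.

(** One more half-plane can be blue: at a point of depth three it leaves two
    others, one of which is red. *)
Lemma good_hull cx cy N r ids k h bl (red : nat -> bool) e :
  listing u a b cx cy N r ids ->
  (forall p q, (p < N)%N -> (q < N)%N -> ids p = ids q -> p = q) ->
  (forall i, (i < n)%N -> i != e -> exists2 p, (p < N)%N & i = ids p) ->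
  (forall p, (p < N)%N -> (ids p < n)%N /\ ids p != e) ->
  let w := rotv a b cx cy N r ids in
  chull N w (rott u a N r ids) k h -> hull_coloring w k h bl ->
  (forall j, ~~ bl j -> red (rot N r ids (h j))) ->
  (forall i, red i -> exists2 j, ~~ bl j & i = rot N r ids (h j)) ->
  good_lines red.
Proof.
move=> L inj onto into w hull col red1 red2 x y i j l iN jN lN ij jl il hi hj hl c.
have get i' : (i' < n)%N -> i' != e -> exists2 p, (p < N)%N & rot N r ids p = i'.
  by move=> iN' ie; have [q qN ->] := onto _ iN' ie; apply: (rot_onto L).
have dif p q : rot N r ids p != rot N r ids q -> p != q by apply: contra => /eqP ->.
have two i' j' : (i' < n)%N -> (j' < n)%N -> i' != e -> j' != e -> i' != j' ->
    inn x y i' -> inn x y j' ->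
    exists2 p, (p < n)%N && (red p == true) & inn x y p.
  move=> iN' jN' ie je ij' hi' hj'.
  have [p pN ep] := get _ iN' ie; have [q qN eq] := get _ jN' je.
  have pq : p != q by apply: dif; rewrite ep eq.
  move: hi' hj'; rewrite -ep -eq => hi' hj'.
  have [z [m nb em] hz] := two_red L hull col pN qN pq hi' hj'.
  exists z => //; rewrite em red1 // andbT.
  have [q' qN' ->] := hull_idx L h m; by have [] := into _ qN'.
case: c.
  have [ie|ie] := eqVneq i e.
    by apply: (two j l) => //; rewrite -ie eq_sym.
  have [je|je] := eqVneq j e.
    by apply: (two i l) => //; rewrite -je eq_sym.
  exact: (two i j).
have esc z : ~~ red z -> (z < n)%N -> inn x y z ->
    exists2 p, (p < n)%N && (red p == false) & inn x y p.
  by move=> nz zn hz; exists z; rewrite ?zn ?(negbTE nz).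
have nre : ~~ red e.
  apply/negP => /red2[m _ em]; have [q qN eq] := hull_idx L h m.
  by have [_] := into _ qN; rewrite -eq -em eqxx.
have [ie|ie] := eqVneq i e; first by apply: (esc i); rewrite ?ie // -ie.
have [je|je] := eqVneq j e; first by apply: (esc j); rewrite ?je // -je.
have [le|le] := eqVneq l e; first by apply: (esc l); rewrite ?le // -le.
have [p pN ep] := get _ iN ie; have [q qN eq] := get _ jN je; have [s sN es] := get _ lN le.
move: ij jl il hi hj hl; rewrite -ep -eq -es => ij jl il hi hj hl.
have [z [zN nz hz]] := three_blue L inj hull col pN qN sN (dif _ _ ij) (dif _ _ jl) (dif _ _ il) hi hj hl.
apply: (esc (ids z)) => //; last by have [] := into _ zN.
by apply/negP => /red2.
Qed.

End GoodLines.

(** * Merging *)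

Section Merge.
Local Open Scope nat_scope.
Variable le : rel nat.
Hypothesis le_tr : transitive le.
Hypothesis le_tot : total le.
Variables (N W : nat).
Hypothesis W0 : 0 < W.
Implicit Types f g : nat -> nat.

Definition sorted_blocks D f : Prop := forall p q, p < q -> q < N ->
  p %/ D = q %/ D -> le (f p) (f q).

(** A pass that merges the blocks of length [W] of [f] two by two into [g]: the
    parts before [i] and between [mid] and [j] of the current pair of blocks,
    which starts at [lo], are merged already. *)
Record merging f g (k i j mid hi lo : nat) : Prop := Merging {
  mg_lo : exists c, lo = c * W.*2;
  mg_ij : [/\ lo <= i, i <= mid, mid <= j & j <= hi];
  mg_hi : [/\ hi <= N, hi <= lo + W.*2 & hi = N \/ exists c, hi = c * W.*2];
  mg_k : k + mid = i + j;
  mg_l : forall p q, lo <= p -> p < q -> q < mid -> le (f p) (f q);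
  mg_r : forall p q, mid <= p -> p < q -> q < hi -> le (f p) (f q);
  mg_perm : perm_eq [seq g p | p <- iota 0 k]
    ([seq f p | p <- iota 0 i] ++ [seq f p | p <- iota mid (j - mid)]);
  mg_out : forall p q, p < q -> q < k -> p %/ W.*2 = q %/ W.*2 -> le (g p) (g q);
  mg_le : forall p q, lo <= p < k -> (i <= q < mid) || (j <= q < hi) -> le (g p) (f q) }.

Lemma merging_init f g : merging f g 0 0 0 0 0 0.
Proof.
split=> //; try by exists 0.
by split=> //; right; exists 0.
Qed.

Let divW p c D : 0 < D -> (p %/ D == c) = (c * D <= p < c.+1 * D).
Proof. by move=> D0; rewrite eqn_leq andbC leq_divRL // -[p %/ D <= c]ltnS ltn_divLR. Qed.

(** When the current pair of blocks is exhausted, the next pair starts; its blocks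
    are cut off at [N]. *)
Lemma merging_next f g k i j mid hi lo : sorted_blocks W f -> k < N ->
  merging f g k i j mid hi lo -> k = hi ->
  let mid' := minn (hi + W) N in let hi' := minn (mid' + W) N in
  merging f g k hi mid' mid' hi' hi /\ k < hi'.
Proof.
move=> srt kN [_ [a1 a2 a3 a4] [b1 b2 b3] ek _ _ perm out _] kh mid' hi'.
have [c hc] : exists c, hi = c * W.*2 by case: b3 => // e; move: kN; rewrite kh e ltnn.
have [ei ej] : i = mid /\ j = hi by move: ek a2 a4; rewrite kh; clear; lia.
have hm : hi < mid' by rewrite /mid'; move: kN W0; rewrite kh; clear; lia.
have mh : mid' <= hi' by rewrite /hi' /mid'; clear; lia.
split; last by rewrite kh; apply: leq_trans mh.
have e2 : c.*2 * W = hi by rewrite hc -!muln2 mulnAC mulnA.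
have dd p : hi <= p -> p < hi + W -> p %/ W = c.*2.
  by move=> h1 h2; apply/eqP; rewrite divW // mulSn e2 h1 addnC.
have dd2 p : hi + W <= p -> p < hi + W + W -> p %/ W = c.*2.+1.
  move=> h1 h2; apply/eqP; rewrite divW // !mulSn e2; move: h1 h2; clear; lia.
split.
- by exists c.
- by split=> //; apply: ltnW.
- split; [exact: geq_minr|by rewrite /hi' /mid'; clear; lia|].
  rewrite /hi' /mid'; have [l1|l1] := leqP N (hi + W + W); [left; lia|right].
  by exists c.+1; rewrite mulSn -hc; move: l1; clear; lia.
- by rewrite kh.
- move=> p q p1 pq q1; have q2 : q < hi + W by apply: leq_trans q1 (geq_minl _ _).
  apply: srt => //; first by apply: leq_trans q1 (geq_minr _ _).
  by rewrite !dd // ?(ltn_trans pq) // (leq_trans p1) // ltnW.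
- move=> p q p1 pq q1; have qN : q < N by apply: leq_trans q1 (geq_minr _ _).
  have em : mid' = hi + W.
    by rewrite /mid' in p1 *; apply/minn_idPl; move: p1 pq qN; clear; lia.
  have q2 : q < hi + W + W by rewrite -em; apply: leq_trans q1 (geq_minl _ _).
  apply: srt => //; rewrite em in p1.
  by rewrite !dd2 // ?(ltn_trans pq) // (leq_trans p1) // ltnW.
- rewrite subnn cats0; move: perm; rewrite ei ej -map_cat -{2}[mid]add0n -iotaD.
  by rewrite subnKC // -ej.
- exact: out.
- by move=> p q; rewrite kh => /andP[h1 /(leq_ltn_trans h1)]; rewrite ltnn.
Qed.

(** The element taken is at most the rest of its own block, which is sorted, and at
    most the head of the other block, hence its rest. *)
Lemma merging_take f g g' k i j mid hi lo (left : bool) :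
  merging f g k i j mid hi lo -> k < hi ->
  (if left then i < mid else j < hi) ->
  (if left then j < hi -> le (f i) (f j) else i < mid -> le (f j) (f i)) ->
  (forall p, p < k -> g' p = g p) -> g' k = f (if left then i else j) ->
  merging f g' k.+1 (if left then i.+1 else i) (if left then j else j.+1) mid hi lo.
Proof.
move=> mg kh av cmp gk gk1; case: (mg) => [[c hc] [a1 a2 a3 a4] b ek ml mr perm out ge].
have lok : lo <= k by move: ek a1 a3; clear; lia.
have old p : p < k -> g' p = g p := gk p.
have mem : perm_eq [seq g' p | p <- iota 0 k.+1] (f (if left then i else j) ::
    [seq f p | p <- iota 0 i] ++ [seq f p | p <- iota mid (j - mid)]).
  rewrite -[k.+1]addn1 iotaD map_cat /= add0n gk1 cats1 perm_rcons perm_cons.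
  rewrite (_ : [seq g' p | p <- iota 0 k] = [seq g p | p <- iota 0 k]) //.
  by apply/eq_in_map => p; rewrite mem_iota add0n => /andP[_ /old].
have refl x : le x x by have := le_tot x x; rewrite orbb.
have newle q : (if left then i.+1 <= q < mid else i <= q < mid) ||
    (if left then j <= q < hi else j.+1 <= q < hi) -> le (g' k) (f q).
  rewrite gk1; case: left av cmp {gk1 mem} => av cmp.
    case/orP=> /andP[q1 q2]; first exact: ml.
    have jh := leq_ltn_trans q1 q2; apply: (le_tr (cmp jh)).
    by move: q1; rewrite leq_eqVlt => /predU1P[->//|q1]; apply: mr.
  case/orP=> /andP[q1 q2]; last exact: mr.
  have ih := leq_ltn_trans q1 q2; apply: (le_tr (cmp ih)).
  by move: q1; rewrite leq_eqVlt => /predU1P[->//|q1]; apply: ml.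
split=> //.
- by exists c.
- by case: left av {cmp gk1 mem newle} => av; split=> //; rewrite ltnW.
- by case: left {av cmp gk1 mem newle}; move: ek; clear; lia.
- case: left av mem {cmp gk1 newle} => av /permPl ->.
    rewrite -[i.+1]addn1 iotaD map_cat /= add0n -catA /= -cat1s perm_catCA.
    exact: perm_refl.
  rewrite subSn // -[(j - mid).+1]addn1 iotaD map_cat /= subnKC // catA cats1.
  rewrite perm_sym perm_rcons; exact: perm_refl.
- move=> p q pq; rewrite ltnS leq_eqVlt => /predU1P[eqk|qk] e; last first.
    by rewrite !old ?(ltn_trans pq) //; apply: out.
  rewrite eqk in pq e *; have pk : p < k by [].
  have D0 : 0 < W.*2 by rewrite double_gt0.
  have ck : k %/ W.*2 = c.
    apply/eqP; rewrite divW // -hc lok /= mulSn -hc addnC.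
    by case: b => _ + _; apply: leq_trans.
  have lop : lo <= p.
    by rewrite ck in e; move/eqP: e; rewrite divW // -hc => /andP[].
  rewrite old // gk1; apply: ge; first by rewrite lop.
  by case: left av {cmp gk1 mem newle} => av; rewrite ?av ?leqnn ?orbT.
- move=> p q; rewrite ltnS => /andP[p1]; rewrite leq_eqVlt => /predU1P[->|pk] h.
    by apply: newle; case: (left) h.
  rewrite old //; apply: ge; first by rewrite p1.
  case: (left) h => /orP[] /andP[q1 q2]; rewrite ?q2 ?q1 ?orbT //.
    by rewrite ltnW.
  by rewrite [j <= q]ltnW ?orbT.
Qed.

Lemma merging_done f g k i j mid hi lo : merging f g k i j mid hi lo -> N <= k ->
  perm_eq [seq g p | p <- iota 0 N] [seq f p | p <- iota 0 N] /\
  sorted_blocks W.*2 g.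
Proof.
case=> _ [a1 a2 a3 a4] [b1 _ _] ek _ _ perm out _ kN.
have [ei ej eh ekN] : [/\ i = mid, j = N, hi = N & k = N].
  by move: ek a2 a4 b1 kN; clear; split; lia.
split; last by move=> p q pq qN; apply: out; rewrite ?ekN.
move: perm; rewrite ekN ei -map_cat -{2}[mid]add0n -iotaD subnKC // ej //.
Qed.

Lemma sorted_blocks1 f : sorted_blocks 1 f.
Proof. by move=> p q pq _; rewrite !divn1 => e; rewrite e ltnn in pq. Qed.

Lemma sorted_blocksN D f : N <= D -> sorted_blocks D f ->
  forall p q, p < q -> q < N -> le (f p) (f q).
Proof.
move=> ND s p q pq qN; apply: s => //.
by rewrite !divn_small // ?(leq_trans _ ND) // (ltn_trans pq).
Qed.

End Merge.

(** * A language with expressions, compiled to the machine *)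

(** Expressions over registers ([IV], [RV]), constants ([IC], [RC]) and array
    cells ([IG], [RG]), for natural and for real numbers. *)
Inductive iexp := IV of nat | IC of nat | IP of iexp & iexp | IM of iexp & iexp
  | IG of nat & iexp.
Inductive rexp := RV of nat | RC of nat | RP of rexp & rexp | RM of rexp & rexp
  | RT of rexp & rexp | RQ of rexp & rexp | RG of nat & iexp.
Inductive bexp := BIlt of iexp & iexp | BIeq of iexp & iexp
  | BRlt of rexp & rexp | BReq of rexp & rexp
  | BAnd of bexp & bexp | BNot of bexp.
Inductive stm := SSkip | SI of nat & iexp | SR of nat & rexp
  | SAI of nat & iexp & iexp | SAR of nat & iexp & rexp
  | SSq of stm & stm | SIf of bexp & stm & stm | SWh of bexp & stm.

Section Semantics.
Variable R : realType.
Implicit Type m : state R.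

Fixpoint evI (e : iexp) m : nat :=
  match e with
  | IV r => ireg m r
  | IC k => k
  | IP a b => (evI a m + evI b m)%N
  | IM a b => (evI a m - evI b m)%N
  | IG a x => iarr m a (evI x m)
  end.
Fixpoint evR (e : rexp) m : R :=
  match e with
  | RV r => rreg m r
  | RC k => k%:R
  | RP a b => evR a m + evR b m
  | RM a b => evR a m - evR b m
  | RT a b => evR a m * evR b m
  | RQ a b => evR a m / evR b m
  | RG a x => rarr m a (evI x m)
  end.
Fixpoint evB (e : bexp) m : bool :=
  match e with
  | BIlt a b => (evI a m < evI b m)%N
  | BIeq a b => evI a m == evI b m
  | BRlt a b => evR a m < evR b m
  | BReq a b => evR a m == evR b m
  | BAnd a b => evB a m && evB b m
  | BNot a => ~~ evB a m
  end.
End Semantics.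

Fixpoint coI (e : iexp) : nat :=
  match e with
  | IV _ | IC _ => 1 | IP a b | IM a b => coI a + coI b + 1 | IG _ x => coI x + 1
  end%N.
Fixpoint coR (e : rexp) : nat :=
  match e with
  | RV _ | RC _ => 1
  | RP a b | RM a b | RT a b | RQ a b => coR a + coR b + 1
  | RG _ x => coI x + 1
  end%N.
Fixpoint coB (e : bexp) : nat :=
  match e with
  | BIlt a b | BIeq a b => coI a + coI b + 2
  | BRlt a b | BReq a b => coR a + coR b + 2
  | BAnd a b => coB a + coB b + 1
  | BNot a => coB a + 2
  end%N.

(** Big-step semantics with the number of machine steps that the compiled statement
    takes. *)
Inductive hruns (R : realType) : stm -> state R -> nat -> state R -> Prop :=
  | hr_skip m : hruns SSkip m 1 m
  | hr_i r e m : hruns (SI r e) m (coI e + 1) (set_ireg m r (evI e m))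
  | hr_r r e m : hruns (SR r e) m (coR e + 1) (set_rreg m r (evR e m))
  | hr_ai a x e m :
      hruns (SAI a x e) m (coI x + coI e + 1) (set_iarr m a (evI x m) (evI e m))
  | hr_ar a x e m :
      hruns (SAR a x e) m (coI x + coR e + 1) (set_rarr m a (evI x m) (evR e m))
  | hr_seq p q m1 m2 m3 t u :
      hruns p m1 t m2 -> hruns q m2 u m3 -> hruns (SSq p q) m1 (t + u) m3
  | hr_if b p q m t m' :
      hruns (if evB b m then p else q) m t m' ->
      hruns (SIf b p q) m (coB b + 1 + t.+1) m'
  | hr_whf b p m : ~~ evB b m -> hruns (SWh b p) m (coB b + 1 + 1) m
  | hr_wht b p m1 m2 m3 t u :
      evB b m1 -> hruns p m1 t m2 -> hruns (SWh b p) m2 u m3 ->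
      hruns (SWh b p) m1 (coB b + 1 + (t + u).+1) m3.

(** Programs use the registers below [tb]; the compiler evaluates expressions on a
    stack of registers from [tb] on. *)
Definition tb : nat := 64.

Fixpoint cI (d : nat) (e : iexp) : program :=
  match e with
  | IV r => Do (IMove (tb + d) r)
  | IC k => Do (IConst (tb + d) k)
  | IP a b => Seq (Seq (cI d a) (cI d.+1 b)) (Do (IAdd (tb + d) (tb + d) (tb + d.+1)))
  | IM a b => Seq (Seq (cI d a) (cI d.+1 b)) (Do (ISub (tb + d) (tb + d) (tb + d.+1)))
  | IG a x => Seq (cI d x) (Do (ILoad (tb + d) a (tb + d)))
  end%N.
Fixpoint cR (d : nat) (e : rexp) : program :=
  match e with
  | RV r => Do (RMove (tb + d) r)
  | RC k => Do (RConst (tb + d) k)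
  | RP a b => Seq (Seq (cR d a) (cR d.+1 b)) (Do (RAdd (tb + d) (tb + d) (tb + d.+1)))
  | RM a b => Seq (Seq (cR d a) (cR d.+1 b)) (Do (RSub (tb + d) (tb + d) (tb + d.+1)))
  | RT a b => Seq (Seq (cR d a) (cR d.+1 b)) (Do (RMul (tb + d) (tb + d) (tb + d.+1)))
  | RQ a b => Seq (Seq (cR d a) (cR d.+1 b)) (Do (RDiv (tb + d) (tb + d) (tb + d.+1)))
  | RG a x => Seq (cI d x) (Do (RLoad (tb + d) a (tb + d)))
  end%N.
Definition cT d (b : test) : program :=
  If b (Do (IConst (tb + d) 1)) (Do (IConst (tb + d) 0)).
Fixpoint cB (d : nat) (e : bexp) : program :=
  match e with
  | BIlt a b => Seq (Seq (cI d a) (cI d.+1 b)) (cT d (ILt (tb + d) (tb + d.+1)))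
  | BIeq a b => Seq (Seq (cI d a) (cI d.+1 b)) (cT d (IEq (tb + d) (tb + d.+1)))
  | BRlt a b => Seq (Seq (cR d a) (cR d.+1 b)) (cT d (RLt (tb + d) (tb + d.+1)))
  | BReq a b => Seq (Seq (cR d a) (cR d.+1 b)) (cT d (REq (tb + d) (tb + d.+1)))
  | BAnd a b => Seq (Seq (cB d a) (cB d.+1 b)) (Do (IMul (tb + d) (tb + d) (tb + d.+1)))
  | BNot a => Seq (Seq (cB d a) (Do (IConst (tb + d.+1) 1)))
                  (Do (ISub (tb + d) (tb + d.+1) (tb + d)))
  end%N.
(** Loops and conditionals test a truth value in register [tb] against the zero in
    register [tb + 1]. *)
Definition cF (b : bexp) : program := Seq (cB 0 b) (Do (IConst (tb + 1) 0)).
Fixpoint compile (s : stm) : program :=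
  match s with
  | SSkip => Skip
  | SI r e => Seq (cI 0 e) (Do (IMove r (tb + 0)))
  | SR r e => Seq (cR 0 e) (Do (RMove r (tb + 0)))
  | SAI a x e => Seq (Seq (cI 0 x) (cI 1 e)) (Do (IStore a (tb + 0) (tb + 1)))
  | SAR a x e => Seq (Seq (cI 0 x) (cR 1 e)) (Do (RStore a (tb + 0) (tb + 1)))
  | SSq p q => Seq (compile p) (compile q)
  | SIf b p q => Seq (cF b) (If (ILt (tb + 1) (tb + 0)) (compile p) (compile q))
  | SWh b p => Seq (cF b) (While (ILt (tb + 1) (tb + 0)) (Seq (compile p) (cF b)))
  end%N.

Fixpoint wI (e : iexp) : bool :=
  match e with
  | IV r => (r < tb)%N | IC _ => true | IP a b | IM a b => wI a && wI b
  | IG _ x => wI x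
  end.
Fixpoint wR (e : rexp) : bool :=
  match e with
  | RV r => (r < tb)%N | RC _ => true
  | RP a b | RM a b | RT a b | RQ a b => wR a && wR b
  | RG _ x => wI x
  end.
Fixpoint wB (e : bexp) : bool :=
  match e with
  | BIlt a b | BIeq a b => wI a && wI b
  | BRlt a b | BReq a b => wR a && wR b
  | BAnd a b => wB a && wB b
  | BNot a => wB a
  end.
(** Only registers below [tb] occur. *)
Fixpoint wf (s : stm) : bool :=
  match s with
  | SSkip => true
  | SI r e => (r < tb)%N && wI e
  | SR r e => (r < tb)%N && wR e
  | SAI _ x e => wI x && wI e
  | SAR _ x e => wI x && wR e
  | SSq p q => wf p && wf q
  | SIf b p q => [&& wB b, wf p & wf q]
  | SWh b p => wB b && wf p
  end.

Section Simulation.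
Variable R : realType.
Implicit Type m h : state R.

(** Agreement below [tb + d]: the registers from [tb + d] on are scratch. *)
Definition agr d m h : Prop :=
  [/\ forall r, (r < tb + d)%N -> ireg m r = ireg h r,
      forall r, (r < tb + d)%N -> rreg m r = rreg h r,
      iarr m = iarr h & rarr m = rarr h].

Lemma agr_refl d m : agr d m m. Proof. by []. Qed.

Lemma agr_trans d m2 m1 m3 : agr d m1 m2 -> agr d m2 m3 -> agr d m1 m3.
Proof.
move=> [a1 b1 c1 d1] [a2 b2 c2 d2]; split; rewrite ?c1 ?d1 // => r hr.
  by rewrite a1 ?a2.
by rewrite b1 ?b2.
Qed.

Lemma agr_le d d' m h : (d' <= d)%N -> agr d m h -> agr d' m h.
Proof. by move=> le [a b ? ?]; split=> // r hr; [apply: a|apply: b]; lia. Qed.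

Lemma evI_agr e m h : wI e -> agr 0 m h -> evI e m = evI e h.
Proof.
move=> + [hi _ ha _]; elim: e => //=.
- by move=> a IHa b IHb /andP[/IHa -> /IHb ->].
- by move=> a IHa b IHb /andP[/IHa -> /IHb ->].
- by move=> a x IHx /IHx ->; rewrite ha.
Qed.

Lemma evR_agr e m h : wR e -> agr 0 m h -> evR e m = evR e h.
Proof.
move=> + hag; have [_ hr _ hb] := hag; elim: e => //=.
- by move=> a IHa b IHb /andP[/IHa -> /IHb ->].
- by move=> a IHa b IHb /andP[/IHa -> /IHb ->].
- by move=> a IHa b IHb /andP[/IHa -> /IHb ->].
- by move=> a IHa b IHb /andP[/IHa -> /IHb ->].
- by move=> a x hx; rewrite hb (evI_agr hx hag).
Qed.

Lemma evB_agr e m h : wB e -> agr 0 m h -> evB e m = evB e h.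
Proof.
move=> + hag; elim: e => //=.
- by move=> a b /andP[wa wb]; rewrite !(evI_agr _ hag).
- by move=> a b /andP[wa wb]; rewrite !(evI_agr _ hag).
- by move=> a b /andP[wa wb]; rewrite !(evR_agr _ hag).
- by move=> a b /andP[wa wb]; rewrite !(evR_agr _ hag).
- by move=> a IHa b IHb /andP[/IHa -> /IHb ->].
- by move=> a IHa /IHa ->.
Qed.

Lemma agr_iset d m h v : agr d m h -> agr d (set_ireg m (tb + d) v) h.
Proof.
move=> [a b c e]; split=> //= r hr; rewrite /upd; case: eqP => [hh|_]; last exact: a.
by rewrite hh ltnn in hr.
Qed.
Lemma agr_iset1 d m h v : agr d m h -> agr d (set_ireg m (tb + d.+1) v) h.
Proof.
move=> [a b c e]; split=> //= r hr; rewrite /upd; case: eqP => [hh|_]; last exact: a.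
lia.
Qed.
Lemma agr_rset d m h v : agr d m h -> agr d (set_rreg m (tb + d) v) h.
Proof.
move=> [a b c e]; split=> //= r hr; rewrite /upd; case: eqP => [hh|_]; last exact: b.
by rewrite hh ltnn in hr.
Qed.

Lemma upd_eq (T : Type) (f : nat -> T) i v : upd f i v i = v.
Proof. by rewrite /upd eqxx. Qed.

Lemma cI_ok e d m : wI e -> exists m',
  [/\ runs (cI d e) m (coI e) m', agr d m' m & ireg m' (tb + d)%N = evI e m].
Proof.
elim: e d m => [r|k|a IHa b IHb|a IHa b IHb|a x IHx] d m /=.
- move=> _; eexists; split; first exact: runs_do.
    exact/agr_iset/agr_refl.
  by rewrite /= upd_eq.
- move=> _; eexists; split; first exact: runs_do.
    exact/agr_iset/agr_refl.
  by rewrite /= upd_eq.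
- move=> /andP[wa wb]; have [m1 [r1 a1 e1]] := IHa d m wa.
  have [m2 [r2 a2 e2]] := IHb d.+1 m1 wb.
  eexists; split.
  + by apply: runs_seq (runs_do _ _); apply: runs_seq r1 r2.
  + by apply: agr_iset; apply: agr_trans a1; apply: agr_le a2.
  + have [a2' _ _ _] := a2.
    rewrite /= upd_eq e2 (a2' (tb + d)%N) ?e1 ?addnS //.
    by rewrite (evI_agr wb (agr_le (leq0n _) a1)).
- move=> /andP[wa wb]; have [m1 [r1 a1 e1]] := IHa d m wa.
  have [m2 [r2 a2 e2]] := IHb d.+1 m1 wb.
  eexists; split.
  + by apply: runs_seq (runs_do _ _); apply: runs_seq r1 r2.
  + by apply: agr_iset; apply: agr_trans a1; apply: agr_le a2.
  + have [a2' _ _ _] := a2.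
    rewrite /= upd_eq e2 (a2' (tb + d)%N) ?e1 ?addnS //.
    by rewrite (evI_agr wb (agr_le (leq0n _) a1)).
- move=> wx; have [m1 [r1 a1 e1]] := IHx d m wx.
  eexists; split.
  + by apply: runs_seq r1 (runs_do _ _).
  + exact: agr_iset.
  + by have [_ _ ha _] := a1; rewrite /= upd_eq e1 ha.
Qed.

Lemma cR_ok e d m : wR e -> exists m',
  [/\ runs (cR d e) m (coR e) m', agr d m' m & rreg m' (tb + d)%N = evR e m].
Proof.
have bin c a b d' m' : wR a && wR b ->
    (forall d m, wR a -> exists m', [/\ runs (cR d a) m (coR a) m', agr d m' m
       & rreg m' (tb + d)%N = evR a m]) ->
    (forall d m, wR b -> exists m', [/\ runs (cR d b) m (coR b) m', agr d m' m
       & rreg m' (tb + d)%N = evR b m]) ->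
    (forall m, exec_instr (c d') m = set_rreg m (tb + d')%N
       (rreg (exec_instr (c d') m) (tb + d')%N)) ->
    exists m'' m2, [/\ runs (Seq (Seq (cR d' a) (cR d'.+1 b)) (Do (c d'))) m'
         (coR a + coR b + 1) m'', agr d' m'' m', m'' = exec_instr (c d') m2,
         rreg m2 (tb + d')%N = evR a m' & rreg m2 (tb + d'.+1)%N = evR b m'].
  move=> /andP[wa wb] IHa IHb hc; have [m1 [r1 a1 e1]] := IHa d' m' wa.
  have [m2 [r2 a2 e2]] := IHb d'.+1 m1 wb.
  exists (exec_instr (c d') m2), m2; split=> //.
  + by apply: runs_seq (runs_do _ _); apply: runs_seq r1 r2.
  + by rewrite hc; apply: agr_rset; apply: agr_trans a1; apply: agr_le a2.
  + by have [_ a2' _ _] := a2; rewrite (a2' (tb + d')%N) ?e1 ?addnS.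
  + by rewrite e2 (evR_agr wb (agr_le (leq0n _) a1)).
elim: e d m => [r|k|a IHa b IHb|a IHa b IHb|a IHa b IHb|a IHa b IHb|a x] d m /=.
- move=> _; eexists; split; first exact: runs_do.
    exact/agr_rset/agr_refl.
  by rewrite /= upd_eq.
- move=> _; eexists; split; first exact: runs_do.
    exact/agr_rset/agr_refl.
  by rewrite /= upd_eq.
- move=> w; have [|m2 [m1 [rr aa em ea eb]]] :=
    bin (fun d => RAdd (tb + d) (tb + d) (tb + d.+1)) a b d m w IHa IHb.
    by move=> ?; rewrite /= upd_eq.
  by exists m2; split=> //; rewrite em /= upd_eq ea eb.
- move=> w; have [|m2 [m1 [rr aa em ea eb]]] :=
    bin (fun d => RSub (tb + d) (tb + d) (tb + d.+1)) a b d m w IHa IHb.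
    by move=> ?; rewrite /= upd_eq.
  by exists m2; split=> //; rewrite em /= upd_eq ea eb.
- move=> w; have [|m2 [m1 [rr aa em ea eb]]] :=
    bin (fun d => RMul (tb + d) (tb + d) (tb + d.+1)) a b d m w IHa IHb.
    by move=> ?; rewrite /= upd_eq.
  by exists m2; split=> //; rewrite em /= upd_eq ea eb.
- move=> w; have [|m2 [m1 [rr aa em ea eb]]] :=
    bin (fun d => RDiv (tb + d) (tb + d) (tb + d.+1)) a b d m w IHa IHb.
    by move=> ?; rewrite /= upd_eq.
  exists m2; split=> //; rewrite em /= upd_eq ea eb.
  by case: eqP => [->|//]; rewrite invr0 mulr0.
- move=> wx; have [m1 [r1 a1 e1]] := cI_ok d m wx.
  eexists; split.
  + by apply: runs_seq r1 (runs_do _ _).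
  + exact: agr_rset.
  + by have [_ _ _ ha] := a1; rewrite /= upd_eq e1 ha.
Qed.

Lemma cT_ok d b m h : agr d m h -> exists m',
  [/\ runs (cT d b) m 2 m', agr d m' h & ireg m' (tb + d)%N = eval_test b m].
Proof.
move=> hag; eexists; split.
- apply: runs_if.
  have -> : (if eval_test b m then Do (IConst (tb + d) 1) else Do (IConst (tb + d) 0))
     = Do (IConst (tb + d) (eval_test b m)) by case: eval_test.
  exact: runs_do.
- exact: agr_iset.
- by rewrite /= upd_eq.
Qed.

Lemma cB_ok e d m : wB e -> exists m',
  [/\ runs (cB d e) m (coB e) m', agr d m' m & ireg m' (tb + d)%N = evB e m].
Proof.
elim: e d m => [a b|a b|a b|a b|a IHa b IHb|a IHa] d m /=.
- move=> /andP[wa wb]; have [m1 [r1 a1 e1]] := cI_ok d m wa.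
  have [m2 [r2 a2 e2]] := cI_ok d.+1 m1 wb.
  have a2m : agr d m2 m by apply: agr_trans a1; apply: agr_le a2.
  have [m3 [r3 a3 e3]] := cT_ok (ILt (tb + d) (tb + d.+1)) a2m.
  exists m3; split=> //; first by apply: runs_seq r3; apply: runs_seq r1 r2.
  have [a2' _ _ _] := a2; rewrite e3 /= e2 (a2' (tb + d)%N) ?e1 ?addnS //.
  by rewrite (evI_agr wb (agr_le (leq0n _) a1)).
- move=> /andP[wa wb]; have [m1 [r1 a1 e1]] := cI_ok d m wa.
  have [m2 [r2 a2 e2]] := cI_ok d.+1 m1 wb.
  have a2m : agr d m2 m by apply: agr_trans a1; apply: agr_le a2.
  have [m3 [r3 a3 e3]] := cT_ok (IEq (tb + d) (tb + d.+1)) a2m.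
  exists m3; split=> //; first by apply: runs_seq r3; apply: runs_seq r1 r2.
  have [a2' _ _ _] := a2; rewrite e3 /= e2 (a2' (tb + d)%N) ?e1 ?addnS //.
  by rewrite (evI_agr wb (agr_le (leq0n _) a1)).
- move=> /andP[wa wb]; have [m1 [r1 a1 e1]] := cR_ok d m wa.
  have [m2 [r2 a2 e2]] := cR_ok d.+1 m1 wb.
  have a2m : agr d m2 m by apply: agr_trans a1; apply: agr_le a2.
  have [m3 [r3 a3 e3]] := cT_ok (RLt (tb + d) (tb + d.+1)) a2m.
  exists m3; split=> //; first by apply: runs_seq r3; apply: runs_seq r1 r2.
  have [_ a2' _ _] := a2; rewrite e3 /= e2 (a2' (tb + d)%N) ?e1 ?addnS //.
  by rewrite (evR_agr wb (agr_le (leq0n _) a1)).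
- move=> /andP[wa wb]; have [m1 [r1 a1 e1]] := cR_ok d m wa.
  have [m2 [r2 a2 e2]] := cR_ok d.+1 m1 wb.
  have a2m : agr d m2 m by apply: agr_trans a1; apply: agr_le a2.
  have [m3 [r3 a3 e3]] := cT_ok (REq (tb + d) (tb + d.+1)) a2m.
  exists m3; split=> //; first by apply: runs_seq r3; apply: runs_seq r1 r2.
  have [_ a2' _ _] := a2; rewrite e3 /= e2 (a2' (tb + d)%N) ?e1 ?addnS //.
  by rewrite (evR_agr wb (agr_le (leq0n _) a1)).
- move=> /andP[wa wb]; have [m1 [r1 a1 e1]] := IHa d m wa.
  have [m2 [r2 a2 e2]] := IHb d.+1 m1 wb.
  eexists; split.
  + by apply: runs_seq (runs_do _ _); apply: runs_seq r1 r2.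
  + by apply: agr_iset; apply: agr_trans a1; apply: agr_le a2.
  + have [a2' _ _ _] := a2.
    rewrite /= upd_eq e2 (a2' (tb + d)%N) ?e1 ?addnS //.
    by rewrite (evB_agr wb (agr_le (leq0n _) a1)) mulnb.
- move=> wa; have [m1 [r1 a1 e1]] := IHa d m wa.
  eexists; split.
  + have -> : (coB a + 2 = coB a + 1 + 1)%N by lia.
    by apply: runs_seq (runs_do _ _); apply: runs_seq r1 (runs_do _ _).
  + exact/agr_iset/agr_iset1.
  + rewrite /= upd_eq /upd !eqxx eqn_add2l ltn_eqF // e1.
    by case: evB.
Qed.

Lemma cF_ok b m : wB b -> exists m',
  [/\ runs (cF b) m (coB b + 1) m', agr 0 m' m &
      eval_test (ILt (tb + 1) (tb + 0)) m' = evB b m].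
Proof.
move=> wb; have [m1 [r1 a1 e1]] := cB_ok 0 m wb.
eexists; split; first by apply: runs_seq r1 (runs_do _ _).
  exact: agr_iset1.
by rewrite /= upd_eq /upd eqn_add2l /= e1; case: evB.
Qed.

(** The compiled program performs exactly the steps that [hruns] charges. *)
Lemma compile_ok s h t h' m : hruns s h t h' -> wf s -> agr 0 m h ->
  exists2 m', runs (compile s) m t m' & agr 0 m' h'.
Proof.
move=> hr; elim: hr m => {s h t h'}
  [h|r e h|r e h|a x e h|a x e h|p q h1 h2 h3 t u _ IHp _ IHq|b p q h t h' _ IH
  |b p h nb|b p h1 h2 h3 t u hb _ IHp _ IHw] m /=.
- by move=> _ a; exists m => //; apply: runs_skip.
- move=> /andP[hr we] ag; have [m1 [r1 a1 e1]] := cI_ok 0 m we.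
  eexists; first by apply: runs_seq r1 (runs_do _ _).
  have [b1 b2 b3 b4] := agr_trans a1 ag; split=> //= r' hr'.
  by rewrite e1 (evI_agr we ag) /upd; case: eqP => // _; apply: b1.
- move=> /andP[hr we] ag; have [m1 [r1 a1 e1]] := cR_ok 0 m we.
  eexists; first by apply: runs_seq r1 (runs_do _ _).
  have [b1 b2 b3 b4] := agr_trans a1 ag; split=> //= r' hr'.
  by rewrite e1 (evR_agr we ag) /upd; case: eqP => // _; apply: b2.
- move=> /andP[wx we] ag; have [m1 [r1 a1 e1]] := cI_ok 0 m wx.
  have [m2 [r2 a2 e2]] := cI_ok 1 m1 we.
  eexists; first by apply: runs_seq (runs_do _ _); apply: runs_seq r1 r2.
  have a20 := agr_le (leq0n _) a2.
  have [b1 b2 b3 b4] := agr_trans a20 (agr_trans a1 ag); split=> //=.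
  have [a2' _ _ _] := a2; rewrite e2 (a2' (tb + 0)%N) // e1 (evI_agr we a1).
  by rewrite (evI_agr wx ag) (evI_agr we ag) b3.
- move=> /andP[wx we] ag; have [m1 [r1 a1 e1]] := cI_ok 0 m wx.
  have [m2 [r2 a2 e2]] := cR_ok 1 m1 we.
  eexists; first by apply: runs_seq (runs_do _ _); apply: runs_seq r1 r2.
  have a20 := agr_le (leq0n _) a2.
  have [b1 b2 b3 b4] := agr_trans a20 (agr_trans a1 ag); split=> //=.
  have [a2' _ _ _] := a2; rewrite e2 (a2' (tb + 0)%N) // e1 (evR_agr we a1).
  by rewrite (evI_agr wx ag) (evR_agr we ag) b4.
- move=> /andP[wp wq] ag; have [m1 r1 a1] := IHp m wp ag.
  by have [m2 r2 a2] := IHq m1 wq a1; exists m2 => //; apply: runs_seq r1 r2.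
- move=> /and3P[wb wp wq] ag; have [m1 [r1 a1 e1]] := cF_ok m wb.
  have [|m2 r2 a2] := IH m1 _ (agr_trans a1 ag); first by case: evB.
  exists m2 => //; apply: runs_seq r1 (runs_if _).
  rewrite e1 (evB_agr wb ag); by case: evB r2.
- move=> /andP[wb wp] ag; have [m1 [r1 a1 e1]] := cF_ok m wb.
  exists m1; last exact: agr_trans a1 ag.
  by apply: runs_seq r1 (runs_while_false _ _); rewrite e1 (evB_agr wb ag).
- move=> /andP[wb wp] ag; have [m1 [r1 a1 e1]] := cF_ok m wb.
  have [m2 r2 a2] := IHp m1 wp (agr_trans a1 ag).
  have [|m3 r3 a3] := IHw m2 _ a2; first by rewrite /= wb wp.
  exists m3 => //.
  have [mf [tf [tw [rf rw eu]]]] : exists mf tf tw, [/\ runs (cF b) m2 tf mf,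
      runs (While (ILt (tb + 1) (tb + 0)) (Seq (compile p) (cF b))) mf tw m3
      & u = (tf + tw)%N].
    by inversion r3 as [| |? ? ? mf ? tf tw rf rw| | |]; exists mf, tf, tw.
  rewrite eu addnA; apply: runs_seq r1 _; apply: runs_while_true rw.
    by rewrite e1 (evB_agr wb ag).
  exact: runs_seq r2 rf.
Qed.

End Simulation.

(** * Total correctness and running time *)

Fixpoint loopfree (s : stm) : bool :=
  match s with
  | SSq p q | SIf _ p q => loopfree p && loopfree q
  | SWh _ _ => false
  | _ => true
  end.
(** Loop-free statements compute a function of the memory, so that proofs about them
    are by simplification. *)
Fixpoint exec (R : realType) (s : stm) (m : state R) : state R :=
  match s with
  | SSkip | SWh _ _ => m
  | SI r e => set_ireg m r (evI e m)
  | SR r e => set_rreg m r (evR e m)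
  | SAI a x e => set_iarr m a (evI x m) (evI e m)
  | SAR a x e => set_rarr m a (evI x m) (evR e m)
  | SSq p q => exec q (exec p m)
  | SIf b p q => if evB b m then exec p m else exec q m
  end.
Fixpoint cost (s : stm) : nat :=
  match s with
  | SSkip | SWh _ _ => 1
  | SI r e => coI e + 1
  | SR r e => coR e + 1
  | SAI a x e => coI x + coI e + 1
  | SAR a x e => coI x + coR e + 1
  | SSq p q => cost p + cost q
  | SIf b p q => coB b + 2 + maxn (cost p) (cost q)
  end%N.

(** The registers (tags 0 and 2) and arrays (tags 1 and 3) a statement may
    change. *)
Fixpoint writes (s : stm) : seq (nat * nat) :=
  match s with
  | SSkip => [::]
  | SI r _ => [:: (0, r)]
  | SAI a _ _ => [:: (1, a)]
  | SR r _ => [:: (2, r)]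
  | SAR a _ _ => [:: (3, a)]
  | SSq p q | SIf _ p q => writes p ++ writes q
  | SWh _ p => writes p
  end%N.

Section Triples.
Variable R : realType.
Implicit Type m : state R.

Definition frame (ws : seq (nat * nat)) m m' : Prop :=
  [/\ forall r, (0, r)%N \notin ws -> ireg m' r = ireg m r,
      forall a, (1, a)%N \notin ws -> iarr m' a = iarr m a,
      forall r, (2, r)%N \notin ws -> rreg m' r = rreg m r &
      forall a, (3, a)%N \notin ws -> rarr m' a = rarr m a].

Lemma frI ws m m' r : frame ws m m' -> (0, r)%N \notin ws -> ireg m' r = ireg m r.
Proof. by case=> h _ _ _ /h. Qed.
Lemma frAI ws m m' r : frame ws m m' -> (1, r)%N \notin ws -> iarr m' r = iarr m r.
Proof. by case=> _ h _ _ /h. Qed.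
Lemma frR ws m m' r : frame ws m m' -> (2, r)%N \notin ws -> rreg m' r = rreg m r.
Proof. by case=> _ _ h _ /h. Qed.
Lemma frAR ws m m' r : frame ws m m' -> (3, r)%N \notin ws -> rarr m' r = rarr m r.
Proof. by case=> _ _ _ h /h. Qed.

Lemma frame_refl ws m : frame ws m m. Proof. by []. Qed.

Lemma frame_trans ws m2 m1 m3 : frame ws m1 m2 -> frame ws m2 m3 -> frame ws m1 m3.
Proof.
by move=> [a b c d] [a' b' c' d']; split=> r hr;
  [rewrite a' ?a|rewrite b' ?b|rewrite c' ?c|rewrite d' ?d].
Qed.

Lemma frame_sub ws ws' m m' : {subset ws <= ws'} -> frame ws m m' -> frame ws' m m'.
Proof.
move=> sub [a b c d]; split=> r hr; [apply: a|apply: b|apply: c|apply: d];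
  by apply: contra hr; exact: sub.
Qed.

Lemma hruns_frame s m t m' : hruns s m t m' -> frame (writes s) m m'.
Proof.
elim=> {s m t m'} /=.
- by [].
- move=> r e m; split=> // r'; rewrite inE /= /upd => /negbTE.
  by rewrite xpair_eqE eqxx /= => ->.
- move=> r e m; split=> // r'; rewrite inE /= /upd => /negbTE.
  by rewrite xpair_eqE eqxx /= => ->.
- move=> a x e m; split=> // r'; rewrite inE /= /upd => /negbTE.
  by rewrite xpair_eqE eqxx /= => ->.
- move=> a x e m; split=> // r'; rewrite inE /= /upd => /negbTE.
  by rewrite xpair_eqE eqxx /= => ->.
- move=> p q m1 m2 m3 t u _ f1 _ f2; apply: (frame_trans (m2 := m2)).
    by apply: frame_sub f1 => x hx; rewrite mem_cat hx.
  by apply: frame_sub f2 => x hx; rewrite mem_cat hx orbT.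
- move=> b p q m t m' _; apply: frame_sub => x hx; rewrite mem_cat.
  by move: hx; case: evB => ->; rewrite ?orbT.
- by [].
- by move=> b p m1 m2 m3 t u _ _ f1 _ f2; apply: frame_trans f1 f2.
Qed.

(** Total correctness within [t] steps. The frame condition is part of the triple so
    that what a statement does not write need not be mentioned in postconditions. *)
Definition triple s m (t : nat) (Q : state R -> Prop) : Prop :=
  exists t' m', [/\ hruns s m t' m', (t' <= t)%N, frame (writes s) m m' & Q m'].

Lemma triple_exec s m (Q : state R -> Prop) :
  loopfree s -> Q (exec s m) -> triple s m (cost s) Q.
Proof.
move=> lf hQ; have [t ht le] : exists2 t, hruns s m t (exec s m) & (t <= cost s)%N.
  elim: s m lf {Q hQ} => //=.
  - by move=> m; exists 1%N => //; constructor.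
  - by move=> r e m; eexists; first by constructor.
  - by move=> r e m; eexists; first by constructor.
  - by move=> a x e m; eexists; first by constructor.
  - by move=> a x e m; eexists; first by constructor.
  - move=> p IHp q IHq m /andP[lp lq].
    have [t1 r1 l1] := IHp m lp; have [t2 r2 l2] := IHq (exec p m) lq.
    by exists (t1 + t2)%N; [apply: hr_seq r1 r2|rewrite leq_add].
  - move=> b p IHp q IHq m /andP[lp lq].
    have [t1 r1 l1] := IHp m lp; have [t2 r2 l2] := IHq m lq.
    exists (coB b + 1 + (if evB b m then t1 else t2).+1)%N.
      by apply: hr_if; case: evB.
    by case: evB; lia.
by exists t, (exec s m); split=> //; exact: hruns_frame ht.
Qed.

Lemma triple_seq p q m t u (P Q : state R -> Prop) :
  triple p m t P ->
  (forall m', frame (writes p) m m' -> P m' -> triple q m' u Q) ->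
  triple (SSq p q) m (t + u) Q.
Proof.
move=> [t1 [m1 [r1 l1 f1 p1]]] h; have [t2 [m2 [r2 l2 f2 q2]]] := h m1 f1 p1.
exists (t1 + t2)%N, m2; split=> //; [exact: hr_seq r1 r2|exact: leq_add|];
  exact: hruns_frame (hr_seq r1 r2).
Qed.

Lemma triple_weaken s m t u (P Q : state R -> Prop) :
  triple s m t P -> (t <= u)%N ->
  (forall m', frame (writes s) m m' -> P m' -> Q m') -> triple s m u Q.
Proof.
move=> [t1 [m1 [r1 l1 f1 p1]]] le h; exists t1, m1; split=> //; last exact: h.
exact: leq_trans le.
Qed.

Lemma triple_if b p q m t (Q : state R -> Prop) :
  (evB b m -> triple p m t Q) -> (~~ evB b m -> triple q m t Q) ->
  triple (SIf b p q) m (coB b + 2 + t) Q.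
Proof.
move=> hp hq.
have : triple (if evB b m then p else q) m t Q.
  by case: ifP => h; [apply: hp|apply: hq; rewrite h].
move=> [t1 [m1 [r1 l1 f1 p1]]]; have r2 := hr_if r1.
exists (coB b + 1 + t1.+1)%N, m1; split=> //; last exact: hruns_frame r2.
lia.
Qed.

(** The measure bounds the number of rounds. The invariant need not repeat what the
    body does not write, as the frame relates every round to the start. *)
Lemma triple_while b s c (Inv : state R -> Prop) (mu : state R -> nat) m0 :
  Inv m0 ->
  (forall m, frame (writes s) m0 m -> Inv m -> evB b m ->
     triple s m c (fun m' => Inv m' /\ (mu m' < mu m)%N)) ->
  triple (SWh b s) m0 ((c + coB b + 2) * (mu m0).+1)
    (fun m' => Inv m' /\ ~~ evB b m').
Proof.
move=> i0 step.
suff H k m : frame (writes s) m0 m -> Inv m -> (mu m <= k)%N ->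
    exists t' m', [/\ hruns (SWh b s) m t' m',
      (t' <= (c + coB b + 2) * k.+1)%N & Inv m' /\ ~~ evB b m'].
  have [t' [m' [r l q]]] := H (mu m0) m0 (frame_refl _ _) i0 (leqnn _).
  by exists t', m'; split=> //; exact: hruns_frame r.
elim: k m => [|k IH] m fm im le; have [bm|bm] := boolP (evB b m).
- have [t1 [m1 [r1 l1 f1 [i1 d1]]]] := step m fm im bm; lia.
- exists (coB b + 1 + 1)%N, m; split=> //; [exact: hr_whf|lia].
- have [t1 [m1 [r1 l1 f1 [i1 d1]]]] := step m fm im bm.
  have le1 : (mu m1 <= k)%N by lia.
  have [t2 [m2 [r2 l2 q2]]] := IH m1 (frame_trans fm f1) i1 le1.
  exists (coB b + 1 + (t1 + t2).+1)%N, m2; split=> //; first exact: hr_wht r2.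
  rewrite mulnS; lia.
- exists (coB b + 1 + 1)%N, m; split=> //; [exact: hr_whf|nia].
Qed.

Lemma triple_loop b s (Inv : state R -> Prop) (mu : state R -> nat) m0 :
  loopfree s -> Inv m0 ->
  (forall m, frame (writes s) m0 m -> Inv m -> evB b m ->
     Inv (exec s m) /\ (mu (exec s m) < mu m)%N) ->
  triple (SWh b s) m0 ((cost s + coB b + 2) * (mu m0).+1)
    (fun m' => Inv m' /\ ~~ evB b m').
Proof.
move=> lf i0 step; apply: triple_while => // m fm im bm.
by apply: triple_exec => //; exact: step.
Qed.

End Triples.

(** * Notations and counting loops *)

Arguments cost _ : simpl never.
Declare Scope iexp_scope.
Declare Scope rexp_scope.
Delimit Scope iexp_scope with I.
Delimit Scope rexp_scope with X.
Arguments IV _%_N.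
Arguments IC _%_N.
Arguments IP _%_I _%_I.
Arguments IM _%_I _%_I.
Arguments IG _%_N _%_I.
Arguments RV _%_N.
Arguments RC _%_N.
Arguments RP _%_X _%_X.
Arguments RM _%_X _%_X.
Arguments RT _%_X _%_X.
Arguments RQ _%_X _%_X.
Arguments RG _%_N _%_I.
Arguments BIlt _%_I _%_I.
Arguments BIeq _%_I _%_I.
Arguments BRlt _%_X _%_X.
Arguments BReq _%_X _%_X.
Arguments SI _%_N _%_I.
Arguments SR _%_N _%_X.
Arguments SAI _%_N _%_I _%_I.
Arguments SAR _%_N _%_I _%_X.
Notation "$ r" := (IV r) (at level 1, r at level 0, format "$ r") : iexp_scope.
Notation "x + y" := (IP x y) : iexp_scope.
Notation "x - y" := (IM x y) : iexp_scope.
Notation "c .[ x ]" := (IG c x) : iexp_scope.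
Notation "$ r" := (RV r) (at level 1, r at level 0, format "$ r") : rexp_scope.
Notation "x + y" := (RP x y) : rexp_scope.
Notation "x - y" := (RM x y) : rexp_scope.
Notation "x * y" := (RT x y) : rexp_scope.
Notation "x / y" := (RQ x y) : rexp_scope.
Notation "c .[ x ]" := (RG c x) : rexp_scope.
Notation "s ;; t" := (SSq s t) (at level 90, right associativity).

Definition For (i : nat) (lim : iexp) (s : stm) : stm :=
  SI i (IC 0) ;; SWh (BIlt (IV i) lim) (s ;; SI i (IP (IV i) (IC 1))).

Arguments For _%_N _%_I _.

(* what a frame leaves unchanged, by computation *)
Notation frI_ f r := (frI (r := r%N) f isT).
Notation frAI_ f r := (frAI (r := r%N) f isT).
Notation frR_ f r := (frR (r := r%N) f isT).
Notation frAR_ f r := (frAR (r := r%N) f isT).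

Section For.
Variable R : realType.
Implicit Type m : state R.

Lemma triple_for i lim s (Inv : nat -> state R -> Prop) L m0 :
  loopfree s -> (0, i)%N \notin writes s ->
  (forall m, frame (writes (For i lim s)) m0 m -> evI lim m = L) ->
  Inv 0%N (set_ireg m0 i 0) ->
  (forall p m, frame (writes (For i lim s)) m0 m -> ireg m i = p -> (p < L)%N ->
     Inv p m -> Inv p.+1 (set_ireg (exec s m) i p.+1)) ->
  triple (For i lim s) m0 ((cost s + coI lim + 12) * L.+1) (Inv L).
Proof.
move=> lf nw hl i0 step.
have bnd : (2 + ((cost s + 4) + (1 + coI lim + 2) + 2) * L.+1 <=
    (cost s + coI lim + 12) * L.+1)%N by lia.
have fr0 m : frame (writes s ++ [:: (0, i)]) (set_ireg m0 i 0) m ->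
    frame (writes (For i lim s)) m0 m.
  move=> f; have : frame (writes (For i lim s)) m0 (set_ireg m0 i 0).
    split=> //= r; rewrite inE negb_or => /andP[h _]; rewrite /upd.
    by have [e|//] := eqVneq r i; rewrite e eqxx in h.
  move/frame_trans; apply; apply: frame_sub f => x hx.
  by rewrite /= inE hx orbT.
apply: triple_weaken bnd _; last first.
  move=> m _; exact: id.
apply: (triple_seq (P := fun m => m = set_ireg m0 i 0) (t := 2)).
  by apply: (triple_exec (s := SI i (IC 0))).
move=> m1 _ ->.
have := @triple_loop R (BIlt (IV i) lim) (s ;; SI i (IP (IV i) (IC 1)))
  (fun m => Inv (ireg m i) m /\ (ireg m i <= L)%N) (fun m => L - ireg m i)%N
  (set_ireg m0 i 0).
have -> : ireg (set_ireg m0 i 0) i = 0%N by rewrite /= upd_eq.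
rewrite subn0 => H; apply: triple_weaken (H _ _ _) _ _.
- by rewrite /= lf.
- by [].
- move=> m f [inv le]; rewrite /= hl; last exact: fr0.
  move=> lt; set m' := exec s m.
  have e : ireg m' i = ireg m i.
    have [t2 [m2 [_ _ f2 e2]]] := triple_exec (Q := fun x => x = m') lf erefl; rewrite -e2.
    exact: frI f2 nw.
  rewrite upd_eq e addn1; split; last by rewrite subnS prednK // subn_gt0.
  by split=> //; rewrite -[set_ireg _ _ _]/(set_ireg (exec s m) i _); apply: step => //; apply: fr0.
- by rewrite /=.
- move=> m f [[inv le]] /=; rewrite hl; last exact: fr0.
  by rewrite -leqNgt => ge; have <- : ireg m i = L by apply/eqP; rewrite eqn_leq le.
Qed.

Lemma triple_le s m t u (Q : state R -> Prop) : triple s m t Q -> (t <= u)%N ->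
  triple s m u Q.
Proof. by move=> h /(triple_weaken h); apply. Qed.

Lemma triple_after p q m u (Q : state R -> Prop) : loopfree p ->
  triple q (exec p m) u Q -> triple (p ;; q) m (cost p + u) Q.
Proof.
move=> lf h; apply: (triple_seq (P := fun m' => m' = exec p m)).
  exact: triple_exec.
by move=> m' _ ->.
Qed.

End For.

(** * Graham's scan as a program *)

(** Names for the registers and arrays. The input has [r_n] half-planes; [r_ex] is
    the index of one to leave out, or [r_n]. The family at hand has [r_cnt] members,
    the first [r_nu] of which, in the order [c_ord], are above their boundaries. A
    scan is about the [r_len] members from [r_off] on, starting at the [r_rot]-th of
    them; [c_ls] lists these, going round twice, [d_x] and [d_y] their dual vectors,
    and [c_st] is the stack. [c_col] are the colours, [c_sg] the types, [c_ty] the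
    types with some half-planes complemented, [d_a] and [d_b] the slopes and
    intercepts, [d_th] and [d_str] the keys for sorting. *)
Notation r_n := 0%N (only parsing).
Notation r_ex := 1%N (only parsing).
Notation r_cnt := 2%N (only parsing).
Notation r_nu := 3%N (only parsing).
Notation r_off := 4%N (only parsing).
Notation r_len := 5%N (only parsing).
Notation r_rot := 6%N (only parsing).
Notation r_p := 7%N (only parsing).
Notation r_q := 8%N (only parsing).
Notation r_sz := 9%N (only parsing).
Notation r_j := 10%N (only parsing).
Notation x_cx := 2%N (only parsing).
Notation x_cy := 3%N (only parsing).
Notation x_h := 8%N (only parsing).
Notation c_col := 0%N (only parsing).
Notation c_sg := 1%N (only parsing).
Notation c_ty := 2%N (only parsing).
Notation c_ord := 3%N (only parsing).
Notation c_tmp := 4%N (only parsing).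
Notation c_ls := 5%N (only parsing).
Notation c_st := 6%N (only parsing).
Notation d_a := 3%N (only parsing).
Notation d_b := 4%N (only parsing).
Notation d_x := 5%N (only parsing).
Notation d_y := 6%N (only parsing).
Notation d_th := 7%N (only parsing).
Notation d_str := 8%N (only parsing).

Definition Fill_body : stm :=
  SAI c_ls ($r_p) (c_ord.[$r_off + $r_q]) ;;
  SR x_h (d_b.[c_ls.[$r_p]] + d_a.[c_ls.[$r_p]] * $x_cx - $x_cy) ;;
  SAR d_x ($r_p) ((RC 0 - d_a.[c_ls.[$r_p]]) / $x_h) ;;
  SAR d_y ($r_p) (RC 1 / $x_h) ;;
  SI r_q ($r_q + IC 1) ;; SIf (BIeq ($r_q) ($r_len)) (SI r_q (IC 0)) SSkip.

Definition Fill : stm :=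
  SI r_q ($r_rot) ;; For r_p ($r_len + $r_len + IC 1)%I Fill_body.

Definition Cross (p q : iexp) : rexp := (d_x.[p] * d_y.[q] - d_y.[p] * d_x.[q])%X.
Definition Dot (p q : iexp) : rexp := (d_x.[p] * d_x.[q] + d_y.[p] * d_y.[q])%X.

Definition Graham_body : stm :=
  let t := c_st.[$r_sz - IC 1]%I in let s := c_st.[$r_sz - IC 2]%I in let j := IV r_j in
  SIf (BAnd (BIlt (IC 1) ($r_sz)) (BAnd (BRlt (RC 0) (Cross s j))
        (BNot (BRlt (Cross s j) (Cross t j + Cross s t)))))
    (SI r_sz ($r_sz - IC 1))
  (SIf (BAnd (BIlt ($r_j) ($r_len))
        (BAnd (BReq (Cross t j) (RC 0)) (BRlt (RC 0) (Dot t j))))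
    (SI r_j ($r_j + IC 1))
    (SAI c_st ($r_sz) ($r_j) ;; SI r_sz ($r_sz + IC 1) ;; SI r_j ($r_j + IC 1))).

Definition Graham : stm :=
  (SAI c_st (IC 0) (IC 0) ;; SI r_sz (IC 1) ;; SI r_j (IC 1)) ;;
  SWh (BNot (BIlt ($r_len) ($r_j))) Graham_body.

Definition Cyc : stm := Fill ;; Graham.

Section Cyc.
Variable R : realType.
Implicit Type m : state R.

Definition types m : nat -> bool := fun i => iarr m c_ty i == 1%N.
Definition slopes m : nat -> R := rarr m d_a.
Definition icepts m : nat -> R := rarr m d_b.
Definition segment m : nat -> nat := fun q => iarr m c_ord (ireg m r_off + q)%N.
Definition vec m p : R * R := (rarr m d_x p, rarr m d_y p).

Let next_mod (x N : nat) : (0 < N)%N ->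
  (x.+1 %% N)%N = if (x %% N + 1)%N == N then 0%N else ((x %% N).+1)%N.
Proof.
move=> N0; rewrite modnS addn1; congr (if _ then _ else _).
have lt : (x %% N < N)%N by rewrite ltn_mod.
have -> : (N %| x.+1)%N = (N %| (x %% N).+1)%N.
  by rewrite {1}(divn_eq x N) -addnS dvdn_addr // dvdn_mull.
apply/idP/eqP => [/dvdn_leq -/(_ isT) le|->//].
by apply/eqP; rewrite eqn_leq le lt.
Qed.

(** Two rounds are filled in because the ears around the last hull vertex reach into
    the second one. *)
Lemma fill_ok m : (ireg m r_rot < ireg m r_len)%N ->
  triple Fill m ((cost Fill_body + 50) * (ireg m r_len + ireg m r_len + 3))
   (fun m' => forall p, (p <= ireg m r_len + ireg m r_len)%N ->
     iarr m' c_ls p = rot (ireg m r_len) (ireg m r_rot) (segment m) p /\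
     vec m' p = rotv (slopes m) (icepts m) (rreg m x_cx) (rreg m x_cy)
       (ireg m r_len) (ireg m r_rot) (segment m) p).
Proof.
set N := ireg m r_len; set r := ireg m r_rot => rN.
set ids := segment m.
pose Inv (j : nat) m' := ireg m' r_q = ((r + j) %% N)%N /\ forall p, (p < j)%N ->
   iarr m' c_ls p = rot N r ids p /\
   vec m' p = rotv (slopes m) (icepts m) (rreg m x_cx) (rreg m x_cy) N r ids p.
apply: (@triple_weaken _ _ _ (2 + (cost Fill_body + 20) * (N + N + 1).+1) _ (Inv (N + N + 1)%N)).
- apply: (triple_seq (P := fun m' => m' = set_ireg m r_q r)).
    by apply: (triple_exec (s := SI r_q ($r_rot))).
  move=> m1 _ ->.
  apply: triple_weaken.
  + apply: (triple_for (L := (N + N + 1)%N) (Inv := Inv)).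
    * by [].
    * by [].
    * by move=> m' f; rewrite /= (frI f).
    * split; last by [].
      by rewrite /= addn0 modn_small.
    * move=> p m' f ep lt [eq IH].
      have fa := frAR_ f 3; have fb := frAR_ f 4; have fo := frAI_ f 3.
      have f4 := frI_ f 4; have f5 := frI_ f 5; have g2 := frR_ f 2; have g3 := frR_ f 3.
      rewrite /= in fa fb fo f4 f5 g2 g3.
      have N0 : (0 < N)%N by apply: leq_ltn_trans rN.
      have nx := next_mod (r + p) N0; rewrite -addnS in nx.
      have new : iarr m' 3 (ireg m' 4 + ireg m' 8) = rot N r ids p.
        by rewrite fo f4 eq.
      rewrite /Inv /vec /= ep /upd /= eqxx new fa fb g2 g3 eq f5 -/N sub0r.
      split; first by rewrite nx; case: eqP; rewrite /= ?eqxx // addn1.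
      move=> p0; rewrite ltnS leq_eqVlt => /predU1P[->|lt0].
        by case: (_ == N); rewrite /= /upd /= !eqxx.
      have [h1 h2] := IH p0 lt0.
      by case: (_ == N); rewrite /= /upd /= !(ltn_eqF lt0).
  + by rewrite leq_mul2r; apply/orP; right; rewrite -addnA leq_add2l.
  + by move=> ? _.
- by move: (cost _) (N + N)%N; clear; lia.
- by move=> m' _ [_ h] p le; apply: h; rewrite addn1.
Qed.

(** Every round pops, skips or pushes. Twice the number of positions left plus the
    size of the stack decreases each time, which makes the scan linear. *)
Lemma graham_ok m w th : let N := ireg m r_len in angular N w th ->
  (forall p, (p <= N)%N -> vec m p = w p) ->
  triple Graham m ((cost Graham_body + 50) * (N + N + 3))
    (fun m' => exists k, [/\ (0 < k)%N, ireg m' r_sz = k.+1 &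
       graham N w th (iarr m' c_st) k.+1 N.+1]).
Proof.
move=> N ang vw; have N0 := ang_N ang.
pose Inv m' := graham N w th (iarr m' c_st) (ireg m' r_sz) (ireg m' r_j).
pose mu m' := ((N.+1 - ireg m' r_j) + (N.+1 - ireg m' r_j) + ireg m' r_sz)%N.
pose m1 := set_ireg (set_ireg (set_iarr m c_st 0 0) r_sz 1) r_j 1.
apply: (@triple_weaken _ _ _ (7 + (cost Graham_body + 6 + 2) * (mu m1).+1) _
   (fun m' => Inv m' /\ ~~ ~~ (ireg m' r_len < ireg m' r_j)%N)).
- apply: triple_after => //; apply: triple_loop => //.
    by apply: graham_init.
  move=> m' f; have fx := frAR_ f 5; have fy := frAR_ f 6; have f5 : ireg m' 5 = N by rewrite (frI_ f 5).
  rewrite /= in fx fy; rewrite /Inv /mu /Graham_body /= fx fy f5.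
  set st := iarr m' 6; set sz := ireg m' 9; set j := ireg m' 10 => g.
  rewrite -leqNgt => jN.
  have cr p q : (p <= N)%N -> (q <= N)%N ->
      rarr m 5 p * rarr m 6 q - rarr m 6 p * rarr m 5 q = cross (w p) (w q).
    by move=> pN qN; rewrite -!vw.
  have dt p q : (p <= N)%N -> (q <= N)%N ->
      rarr m 5 p * rarr m 5 q + rarr m 6 p * rarr m 6 q = dot (w p) (w q).
    by move=> pN qN; rewrite -!vw.
  have tN : (st (sz - 1) <= N)%N.
    by rewrite subn1; apply: leq_trans jN; apply: ltnW; apply: gr_top g.
  have sN : (1 < sz)%N -> (st (sz - 2) < st (sz - 1))%N.
    by case: sz g {tN} => [|[|z]] // g _; rewrite !subSS !subn0; apply: (gr_lt g).
  have [/and3P[s1 pos con]|npop] := ifP.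
    have sN' : (st (sz - 2) <= N)%N by apply: leq_trans (ltnW (sN s1)) tN.
    rewrite /= /upd /= -/st -/j -/sz; split.
      rewrite !cr // in pos con; rewrite -leNgt in con.
      move: s1 g pos con; case: sz {tN sN sN'} => [|[|z]] // _ g pos con.
      by rewrite subSS subn0; rewrite !subSS !subn0 in pos con; apply: (graham_pop ang g jN pos con).
    by rewrite ltn_add2l ltn_subrL (ltnW s1).
  have [/and3P[jl c0 d0]|nskip] := ifP.
    rewrite /= /upd /= -/st -/j -/sz; split.
      rewrite cr // dt // in c0 d0; rewrite addn1; apply: (graham_skip ang g jl) => //.
        by rewrite -subn1; apply/eqP.
      by rewrite -subn1.
    rewrite ltn_add2r !addn1 !subSS; move: jN; clear; lia.
  rewrite /= /upd /= -/st -/j -/sz; split; last first.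
    by rewrite !addn1; move: jN; clear; lia.
  have := gr_sz g; case esz : sz => [//|z] _; rewrite esz in g.
  rewrite !addn1; rewrite esz subSS subn0 in tN npop nskip sN; apply: (graham_push ang g jN).
  - have [->|nN] := eqVneq j N; first by left.
    right=> -[c0 d0]; move/negP: nskip; apply; rewrite ltn_neqAle nN jN /=.
    by rewrite cr // dt // c0 eqxx.
  - move=> s ez [pos con]; move/negP: npop; apply; rewrite ez in tN sN con *.
    rewrite !subSS subn0 in sN *; have sN' := leq_trans (ltnW (sN isT)) tN.
    by rewrite !cr // pos -leNgt con.
  - by move=> i le; rewrite ltn_eqF // ltnS.
  - by rewrite eqxx.
- have -> : mu m1 = (N + N + 1)%N by rewrite /mu /= /upd /= subSS subn0.
  by move: (cost _) (N + N)%N; clear; lia.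
- move=> m' f [g]; rewrite negbK /= (frI_ f 5) -/N => jN.
  have ej : ireg m' 10 = N.+1 by apply/eqP; rewrite eqn_leq jN (gr_j g).
  rewrite /Inv ej in g; have := gr_sz g; case ez : (ireg m' 9) => [//|k] _; exists k; split=> //.
    case: k ez => // ez; have := gr_end g erefl; rewrite ez (gr_0 g) => e.
    by rewrite -e in N0.
  by rewrite -ez.
Qed.

Definition seg_listing m : Prop := listing (types m) (slopes m) (icepts m)
  (rreg m x_cx) (rreg m x_cy) (ireg m r_len) (ireg m r_rot) (segment m).
Definition seg_rotv m : nat -> R * R := rotv (slopes m) (icepts m)
  (rreg m x_cx) (rreg m x_cy) (ireg m r_len) (ireg m r_rot) (segment m).
Definition seg_rott m : nat -> R := rott (types m) (slopes m)
  (ireg m r_len) (ireg m r_rot) (segment m).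

(** What Graham's scan still lacks for a closed hull is convexity at its start. *)
Definition start_convex N (w : nat -> R * R) (th : nat -> R) : Prop := forall k st,
  (0 < k)%N -> graham N w th st k.+1 N.+1 -> th (st 1%N) + 4 - th (st k.-1) < 2 ->
   cross (w (st k.-1)) (w (st 1%N)) <
   cross (w 0%N) (w (st 1%N)) + cross (w (st k.-1)) (w 0%N).

Lemma cyc_ok m : seg_listing m -> start_convex (ireg m r_len) (seg_rotv m) (seg_rott m) ->
  triple Cyc m ((cost Fill_body + cost Graham_body + 100) * (ireg m r_len + ireg m r_len + 3))
   (fun m' => exists k, [/\ ireg m' r_sz = k.+1, iarr m' c_st 0 = 0%N,
      iarr m' c_st k = ireg m r_len,
      chull (ireg m r_len) (seg_rotv m) (seg_rott m) k (closed_up (ireg m r_len) (iarr m' c_st) k) &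
      forall p, (p <= ireg m r_len + ireg m r_len)%N ->
        iarr m' c_ls p = rot (ireg m r_len) (ireg m r_rot) (segment m) p /\
        vec m' p = seg_rotv m p]).
Proof.
move=> L sc; have ang := listing_angular L.
pose X := (ireg m r_len + ireg m r_len + 3)%N.
apply: (@triple_le _ _ _ ((cost Fill_body + 50) * X + (cost Graham_body + 50) * X)).
- apply: (triple_seq (fill_ok (ls_r L))) => m' f fil.
  have f5 := frI_ f 5.
  have := @graham_ok m' (seg_rotv m) (seg_rott m); rewrite /= f5 => H.
  have {H} := H ang (fun p le => proj2 (fil p (leq_trans le (leq_addr _ _)))).
  move=> T; apply: (triple_weaken T (leqnn _)) => m2 f2 [k [k0 ek g]].
  exists k; split=> //; [exact: gr_0 g|by have := gr_end g erefl|..].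
    by apply: chull_graham => //; apply: sc.
  move=> p /fil[h1 h2]; rewrite (frAI_ f2 5) h1; split=> //.
  by rewrite /vec (frAR_ f2 5) (frAR_ f2 6).
- by rewrite -mulnDl leq_mul2r; apply/orP; right; move: (cost _) (cost _); clear; lia.
Qed.

(** The angles of half-planes of one type span less than a half turn, so that the two
    neighbours of the start are more than a half turn apart. *)
Lemma start_convex_one_type m c : seg_listing m -> ireg m r_rot = 0%N ->
  (forall p, (p < ireg m r_len)%N -> types m (segment m p) = c) ->
  start_convex (ireg m r_len) (seg_rotv m) (seg_rott m).
Proof.
move=> L r0 uc k st k0 g lt; exfalso; move: lt; apply/negP; rewrite -leNgt.
set N := ireg m r_len in uc g *; have N0 : (0 < N)%N := leq_ltn_trans (leq0n _) (ls_r L).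
have ang := listing_angular L.
have thE p : (p < N)%N -> (if c then -1 else 1) < seg_rott m p < (if c then 1 else 3).
  move=> pN; rewrite /seg_rott /rott /rot r0 -/N add0n modn_small // divn_small //.
  by rewrite mulr0 addr0 uc // theta_bound.
have stk : st k = N by have := gr_end g erefl.
have top : (st k.-1 < N)%N.
  by rewrite -stk; have := gr_lt g (i := k.-1); rewrite prednK //; apply.
have t1 := thE _ top.
have := thE _ N0; have := gr_th g (i := 0) (k0 : (1 < k.+1)%N); rewrite (gr_0 g).
by move: t1; case: (c) => /andP[t1 t2] t3 /andP[t4 t5]; lra.
Qed.

(** The neighbours are in the disc on whose boundary a longest vector is, and the
    disc is strictly convex. *)
Lemma start_convex_max m : seg_listing m -> (forall p, (p < ireg m r_len)%N ->
    dot (seg_rotv m p) (seg_rotv m p) <= dot (seg_rotv m 0%N) (seg_rotv m 0%N)) ->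
  start_convex (ireg m r_len) (seg_rotv m) (seg_rott m).
Proof.
move=> L mx k st k0 g lt.
have ang := listing_angular L; set N := ireg m r_len in mx g ang.
have N0 := ang_N ang.
set w := seg_rotv m in mx g *; set th := seg_rott m in g lt.
have wm p : dot (w p) (w p) <= dot (w 0%N) (w 0%N).
  have -> : w p = w (p %% N)%N.
    by rewrite {1}(divn_eq p N) addnC mulnC; exact: (w_turn ang).
  by apply: mx; rewrite ltn_mod.
have thN p : th (p + N)%N = th p + 4 := ang_thN ang p.
have stk : st k = N by have := gr_end g erefl.
have t1 := gr_th g (i := 0) (k0 : (1 < k.+1)%N); rewrite (gr_0 g) in t1.
have t2 : th (st k.-1) < th 0%N + 4.
  have := gr_th g (i := k.-1); rewrite prednK // stk => /(_ (leqnn _)).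
  by have := thN 0%N; rewrite add0n => <-.
have wN p : w (p + N)%N = w p := ang_wN ang p.
have ac p q : 0 < th q - th p -> th q - th p < 2 -> 0 < cross (w p) (w q) :=
  @ang_cross _ _ _ _ ang p q.
have c1 : 0 < cross (w (st k.-1)) (w (st 1%N)).
  rewrite -(wN (st 1%N)); by apply: ac; rewrite thN; lra.
have c2 : 0 < cross (w 0%N) (w (st 1%N)).
  by apply: ac; lra.
have c3 : 0 < cross (w (st k.-1)) (w 0%N).
  rewrite -(wN 0%N); by apply: ac; rewrite thN; lra.
have m1 := wm (st 1%N); have m2 := wm (st k.-1).
move: c1 c2 c3 m1 m2; clear; rewrite /cross /dot.
case: (w 0%N) => v1 v2; case: (w (st 1%N)) => x1 x2; case: (w (st k.-1)) => p1 p2 /=.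
move=> c1 c2 c3 m1 m2; rewrite ltNge; apply/negP => le.
set D := p1 * x2 - p2 * x1 in c1 le; set A := v1 * x2 - v2 * x1 in c2 le.
set B := p1 * v2 - p2 * v1 in c3 le; set V := v1 * v1 + v2 * v2 in m1 m2.
have id1 : V * D = A * (v1 * p1 + v2 * p2) + B * (v1 * x1 + v2 * x2).
  by rewrite /V /D /A /B; ring.
have sq y1 y2 : (v1 != y1) || (v2 != y2) -> y1 * y1 + y2 * y2 <= V ->
    v1 * y1 + v2 * y2 < V.
  move=> ne le2.
  have : 0 < (v1 - y1) * (v1 - y1) + (v2 - y2) * (v2 - y2).
    have s1 := sqr_ge0 (v1 - y1); have s2 := sqr_ge0 (v2 - y2).
    rewrite !expr2 in s1 s2; rewrite lt_neqAle addr_ge0 // andbT eq_sym paddr_eq0 //.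
    by rewrite !mulf_eq0 !orbb !subr_eq0 negb_and.
  have -> : (v1 - y1) * (v1 - y1) + (v2 - y2) * (v2 - y2) =
    V + (y1 * y1 + y2 * y2) - 2 * (v1 * y1 + v2 * y2) by rewrite /V; ring.
  by move=> pos; lra.
have ps : v1 * p1 + v2 * p2 < V.
  apply: sq => //; rewrite -negb_and; apply/negP => /andP[/eqP e1 /eqP e2].
  by move: c3; rewrite /B -e1 -e2 mulrC subrr ltxx.
have xs : v1 * x1 + v2 * x2 < V.
  apply: sq => //; rewrite -negb_and; apply/negP => /andP[/eqP e1 /eqP e2].
  by move: c2; rewrite /A -e1 -e2 mulrC subrr ltxx.
have V0 : 0 <= V by rewrite addr_ge0 // -expr2 sqr_ge0.
have l1 : A * (v1 * p1 + v2 * p2) < A * V by rewrite ltr_pM2l.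
have l2 : B * (v1 * x1 + v2 * x2) < B * V by rewrite ltr_pM2l.
have l3 : V * (A + B) <= V * D by apply: ler_wpM2l.
by move: l3; rewrite id1 mulrDr !(mulrC V); lra.
Qed.

End Cyc.

(** * Merge sort as a program *)

Notation r_w := 26%N (only parsing).
Notation r_k := 27%N (only parsing).
Notation r_si := 28%N (only parsing).
Notation r_sj := 29%N (only parsing).
Notation r_mid := 30%N (only parsing).
Notation r_hi := 31%N (only parsing).

Definition Or (p q : bexp) : bexp := BNot (BAnd (BNot p) (BNot q)).
(** Subtraction is truncated. *)
Definition Min (x y : iexp) : iexp := (x - (x - y))%I.

Definition Before (x y : iexp) : bexp :=
  Or (BRlt (d_th.[x]) (d_th.[y]))
     (BAnd (BReq (d_th.[x]) (d_th.[y])) (BRlt (d_str.[x]) (d_str.[y]))).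

Arguments Min _%_I _%_I.
Arguments Before _%_I _%_I.

(** One round moves one element, or starts the next pair of blocks; this avoids
    nested loops. *)
Definition Merge_body : stm :=
  let left := c_ord.[$r_si]%I in let right := c_ord.[$r_sj]%I in
  SIf (BIeq ($r_k) ($r_hi))
    (SI r_si ($r_hi) ;; SI r_mid (Min ($r_hi + $r_w) ($r_cnt)) ;; SI r_sj ($r_mid) ;;
     SI r_hi (Min ($r_mid + $r_w) ($r_cnt)))
    (SIf (BAnd (BIlt ($r_si) ($r_mid))
               (BNot (BAnd (BIlt ($r_sj) ($r_hi)) (Before right left))))
       (SAI c_tmp ($r_k) left ;; SI r_si ($r_si + IC 1) ;; SI r_k ($r_k + IC 1))
       (SAI c_tmp ($r_k) right ;; SI r_sj ($r_sj + IC 1) ;; SI r_k ($r_k + IC 1))).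

Definition Pass : stm :=
  (SI r_k (IC 0) ;; SI r_si (IC 0) ;; SI r_sj (IC 0) ;; SI r_mid (IC 0) ;; SI r_hi (IC 0)) ;;
  SWh (BIlt ($r_k) ($r_cnt)) Merge_body.

Definition Sort : stm :=
  SI r_w (IC 1) ;;
  SWh (BIlt ($r_w) ($r_cnt))
    (Pass ;; For r_p ($r_cnt) (SAI c_ord ($r_p) (c_tmp.[$r_p])) ;; SI r_w ($r_w + $r_w)).

Section Sort.
Variable R : realType.
Implicit Type m : state R.

Lemma exec_if b p q m :
  exec (SIf b p q) m = if evB b m then exec p m else exec q m.
Proof. by []. Qed.

Lemma evOr p q m : evB (Or p q) m = evB p m || evB q m.
Proof. by rewrite /= negb_and !negbK. Qed.

Definition before m (i j : nat) : bool := (rarr m d_th i < rarr m d_th j) ||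
  ((rarr m d_th i == rarr m d_th j) && (rarr m d_str i < rarr m d_str j)).

Definition keyle m (i j : nat) : bool := ~~ before m j i.

Lemma keyleE m i j : keyle m i j = (rarr m d_th i < rarr m d_th j) ||
  ((rarr m d_th i == rarr m d_th j) && (rarr m d_str i <= rarr m d_str j)).
Proof. by rewrite /keyle /before; case: ltgtP => //=; rewrite leNgt. Qed.

Lemma keyle_total m : total (keyle m).
Proof.
move=> i j; rewrite !keyleE; case: ltgtP => //= _; exact: le_total.
Qed.

Lemma keyle_trans m : transitive (keyle m).
Proof.
move=> j i k; rewrite !keyleE.
case: (ltgtP (rarr m d_th i)) => //= [h1 _|<-].
  case: (ltgtP (rarr m d_th j)) => //= [h2 _|<- _]; last by rewrite h1.
  by rewrite (lt_trans h1 h2).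
case: ltgtP => //= _; exact: le_trans.
Qed.

Lemma evBefore x y m : evB (Before x y) m = before m (evI x m) (evI y m).
Proof. by rewrite evOr. Qed.

Lemma pass_ok m : let N := ireg m r_cnt in let W := ireg m r_w in (0 < W)%N ->
  sorted_blocks (keyle m) N W (iarr m c_ord) ->
  triple Pass m ((cost Merge_body + 30) * (N + N + 2)) (fun m' =>
    perm_eq [seq iarr m' c_tmp p | p <- iota 0 N] [seq iarr m c_ord p | p <- iota 0 N] /\
    sorted_blocks (keyle m) N W.*2 (iarr m' c_tmp)).
Proof.
move=> N W W0 srt.
pose Inv m' := exists lo, merging (keyle m) N W (iarr m c_ord) (iarr m' c_tmp)
  (ireg m' r_k) (ireg m' r_si) (ireg m' r_sj) (ireg m' r_mid) (ireg m' r_hi) lo.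
pose mu m' := ((N - ireg m' r_k) + (N - ireg m' r_k) + (ireg m' r_k == ireg m' r_hi))%N.
apply: (@triple_weaken _ _ _ (10 + (cost Merge_body + 4 + 2) * (N + N + 1).+1) _
   (fun m' => Inv m' /\ ~~ (ireg m' r_k < N)%N)).
- apply: triple_after => //.
  have := @triple_loop _ (BIlt ($r_k) ($r_cnt)) Merge_body Inv mu.
  move=> /(_ (exec (SI r_k (IC 0) ;; SI r_si (IC 0) ;; SI r_sj (IC 0) ;; SI r_mid (IC 0) ;; SI r_hi (IC 0)) m) isT) T.
  apply: (triple_weaken (T _ _)).
  + by exists 0%N; apply: merging_init.
  + move=> m' f [lo mg].
    have ecnt : ireg m' r_cnt = N by rewrite (frI_ f 2).
    have ew : ireg m' r_w = W by rewrite (frI_ f 26).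
    have eo : iarr m' c_ord = iarr m c_ord by rewrite (frAI_ f 3).
    have bf i j : before m' i j = before m i j.
      by rewrite /before (frAR_ f 7) (frAR_ f 8).
    rewrite [evB _ _]/= ecnt => kN; rewrite /Merge_body exec_if [evB (BIeq _ _) _]/=.
    have [e|ne] := eqVneq (ireg m' 27) (ireg m' 31).
      have [mg' lt] := merging_next W0 srt kN mg e.
      rewrite /Inv /mu /= /upd /= ecnt ew -!minnE; split; first by exists (ireg m' 31).
      by rewrite ltn_add2l e -{1}e (ltn_eqF lt) eqxx.
    have kh : (ireg m' 27 < ireg m' 31)%N.
      rewrite ltn_neqAle ne; case: mg => _ [_ x1 x2 x3] _ x4 _ _ _ _ _.
      by move: x1 x2 x3 x4; clear; lia.
    have cond : evB (BAnd (BIlt ($r_si) ($r_mid))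
        (BNot (BAnd (BIlt ($r_sj) ($r_hi)) (Before (c_ord.[$r_sj]) (c_ord.[$r_si]))))) m' =
      (ireg m' 28 < ireg m' 30)%N && ~~ ((ireg m' 29 < ireg m' 31)%N &&
        before m (iarr m 3 (ireg m' 29)) (iarr m 3 (ireg m' 28))).
      by rewrite -bf -eo -(evBefore (c_ord.[$r_sj])%I (c_ord.[$r_si])%I).
    rewrite exec_if cond.
    have fin (st : stm) (left : bool) :
        st = (SAI c_tmp ($r_k) (if left then c_ord.[$r_si]%I else c_ord.[$r_sj]%I) ;;
          (if left then SI r_si ($r_si + IC 1) else SI r_sj ($r_sj + IC 1)) ;;
          SI r_k ($r_k + IC 1)) ->
        (if left then ireg m' 28 < ireg m' 30 else ireg m' 29 < ireg m' 31)%N ->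
        (if left then (ireg m' 29 < ireg m' 31)%N ->
            keyle m (iarr m 3 (ireg m' 28)) (iarr m 3 (ireg m' 29))
         else (ireg m' 28 < ireg m' 30)%N ->
            keyle m (iarr m 3 (ireg m' 29)) (iarr m 3 (ireg m' 28))) ->
        Inv (exec st m') /\ (mu (exec st m') < mu m')%N.
      move=> -> av cmp; rewrite /Inv /mu.
      have D : (N - (ireg m' 27).+1 + (N - (ireg m' 27).+1) + 1 <
          N - ireg m' 27 + (N - ireg m' 27))%N by move: kN; clear; lia.
      split; last first.
        case: left {av cmp} => /=; rewrite /upd /= !addn1;
          apply: leq_trans (leq_addr _ _); apply: leq_ltn_trans D;
          by rewrite leq_add2l leq_b1.
      exists lo.
      have := @merging_take _ (@keyle_trans m) (@keyle_total m) N W W0 _ _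
        (upd (iarr m' c_tmp) (ireg m' 27)
          (if left then iarr m 3 (ireg m' 28) else iarr m 3 (ireg m' 29)))
        _ _ _ _ _ _ left mg kh av cmp.
      case: left {av cmp} => /= H; rewrite /upd /= !addn1 eo; apply: H.
      - by move=> p pk; rewrite /upd ltn_eqF.
      - by rewrite /upd eqxx.
      - by move=> p pk; rewrite /upd ltn_eqF.
      - by rewrite /upd eqxx.
    have [/andP[h1 h2]|no] := ifP.
      apply: (fin _ true) => // jh; rewrite jh in h2; exact: h2.
    move/negbT: no; rewrite negb_and negbK => no.
    apply: (fin _ false) => //.
      have [//|ge] := ltnP (ireg m' 29) (ireg m' 31).
      case/orP: no => [|/andP[]]; last by rewrite ltnNge ge.
      case: mg => _ [_ _ _ x3] _ x4 _ _ _ _ _.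
      by rewrite -leqNgt; move: kh x3 x4 ge; clear; lia.
    move=> ih; move: no; rewrite ih /= => /andP[_ b]; rewrite keyleE.
    by case/orP: b => [->//|/andP[-> /ltW ->]]; rewrite orbT.
  + by rewrite (_ : mu _ = (N + N + 1)%N) // /mu /= /upd /= subn0.
  + by move=> m' f' [i e]; split=> //; move: e; rewrite /= (frI_ f' 2).
- by move: (cost _) (N + N)%N; clear; lia.
- move=> m' f [[lo mg]]; rewrite -leqNgt => kN.
  exact: merging_done mg kN.
Qed.

(** The width of the sorted blocks doubles with every pass, until it reaches the
    length of the list. *)
Lemma sort_ok m : let N := ireg m r_cnt in
  triple Sort m ((cost Merge_body + 100) * (N + N + 2) * (trunc_log 2 N + 2)) (fun m' =>
    perm_eq [seq iarr m' c_ord p | p <- iota 0 N] [seq iarr m c_ord p | p <- iota 0 N] /\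
    forall p q, (p < q)%N -> (q < N)%N -> keyle m (iarr m' c_ord p) (iarr m' c_ord q)).
Proof.
move=> N.
pose Inv m' := exists k, [/\ ireg m' r_w = (2 ^ k)%N, (k <= (trunc_log 2 N).+1)%N,
  perm_eq [seq iarr m' c_ord p | p <- iota 0 N] [seq iarr m c_ord p | p <- iota 0 N] &
  sorted_blocks (keyle m) N (2 ^ k)%N (iarr m' c_ord)].
pose mu m' := ((trunc_log 2 N).+1 - trunc_log 2 (ireg m' r_w))%N.
pose c := ((cost Merge_body + 30) * (N + N + 2) + (30 * N.+1 + 4))%N.
have T : triple (SWh (BIlt ($r_w) ($r_cnt))
    (Pass ;; For r_p ($r_cnt) (SAI c_ord ($r_p) (c_tmp.[$r_p])) ;; SI r_w ($r_w + $r_w)))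
    (exec (SI r_w (IC 1)) m) ((c + 4 + 2) * (mu (exec (SI r_w (IC 1)) m)).+1)
    (fun m' => Inv m' /\ ~~ evB (BIlt ($r_w) ($r_cnt)) m').
  apply: triple_while.
    exists 0%N; split=> //; exact: sorted_blocks1.
  move=> m1 f1 [k [ek kle pe srt]] lt.
  have N1 : ireg m1 r_cnt = N by rewrite (frI_ f1 2).
  have kq : keyle m1 = keyle m.
    by apply/funext => i; apply/funext => j; rewrite /keyle /before (frAR_ f1 7) (frAR_ f1 8).
  rewrite /= N1 ek in lt.
  have := @pass_ok m1; rewrite /= ek N1 kq expn_gt0 => /(_ isT srt) P1.
  apply: (triple_seq P1) => m2 f2 [pe2 srt2].
  have N2 : ireg m2 r_cnt = N by rewrite (frI_ f2 2).
  have w2 : ireg m2 r_w = (2 ^ k)%N by rewrite (frI_ f2 26).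
  pose Copied j m' := forall p, (p < j)%N -> iarr m' c_ord p = iarr m2 c_tmp p.
  have P2 := @triple_for _ r_p ($r_cnt)%I (SAI c_ord ($r_p) (c_tmp.[$r_p])) Copied N m2 isT isT.
  have {P2} P2 : triple (For r_p ($r_cnt) (SAI c_ord ($r_p) (c_tmp.[$r_p]))) m2
      (30 * N.+1) (Copied N).
    apply: (triple_le (P2 _ _ _)) => //.
    - by move=> m' f; rewrite /= (frI_ f 2).
    - move=> p m' f ep pN IH q; rewrite ltnS /= ep => le; rewrite /upd.
      have [->|ne] := eqVneq q p; first by rewrite !eqxx (frAI_ f 4).
      by rewrite eqxx (negbTE ne); apply: IH; rewrite ltn_neqAle ne.
    - by apply: leq_mul.
  apply: (triple_seq P2) => m3 f3 cop.
  have w3 : ireg m3 r_w = (2 ^ k)%N by rewrite (frI_ f3 26).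
  have dbl : (2 ^ k + 2 ^ k = 2 ^ k.+1)%N by rewrite addnn -mul2n expnS.
  have ktl : (k <= trunc_log 2 N)%N by apply: trunc_log_max; rewrite // ltnW.
  apply: (triple_exec (s := SI r_w ($r_w + $r_w))) => //; split.
    exists k.+1; split.
    - by rewrite /= upd_eq w3.
    - by rewrite ltnS.
    - apply: perm_trans pe; apply: perm_trans pe2.
      rewrite (_ : [seq _ | p <- _] = [seq iarr m2 c_tmp p | p <- iota 0 N]) //.
      by apply/eq_in_map => p; rewrite mem_iota add0n => /cop.
    - move=> p q pq qN; rewrite -dbl addnn [iarr _ _]/= !cop ?(ltn_trans pq) //.
      exact: srt2.
  rewrite /mu [ireg _ _]/= upd_eq w3 ek dbl !trunc_expnK //.
  by move: ktl; clear; lia.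
apply: (@triple_weaken _ _ _ (2 + (c + 4 + 2) * (mu (exec (SI r_w (IC 1)) m)).+1) _
  (fun m' => Inv m' /\ ~~ (ireg m' r_w < N)%N)).
- apply: triple_after => //; apply: (triple_weaken T) => // m' f [i e]; split=> //.
  by move: e; rewrite /= (frI_ f 2).
- have -> : mu (exec (SI r_w (IC 1)) m) = (trunc_log 2 N).+1.
    by rewrite /mu /= /upd /= -(expn0 2) trunc_expnK // subn0.
  rewrite /c; move: (cost Merge_body) => C; move: (trunc_log 2 N) => t; move: (N); clear; nia.
- move=> m' f [[k [ek _ pe srt]]]; rewrite ek -leqNgt => Nk; split=> //.
  exact: sorted_blocksN Nk srt.
Qed.

End Sort.

(** * Walking along the envelopes as a program *)

(** [c_cu] and [c_cl] are the envelopes, of [r_ku] and [r_kl] lines; the walk is at the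
    abscissa [x_xr] and at their members number [r_i] and [r_wj]. [r_pv] is the line
    left last, and [r_isu] tells whether it is of the lower envelope. The result is
    of kind [r_res], with the point [x_ox], [x_oy] or the cover [r_p1], [r_p2],
    [r_p3]. *)
Notation r_ku := 11%N (only parsing).
Notation r_kl := 12%N (only parsing).
Notation r_i := 13%N (only parsing).
Notation r_isu := 14%N (only parsing).
Notation r_pv := 15%N (only parsing).
Notation r_res := 16%N (only parsing).
Notation r_p1 := 17%N (only parsing).
Notation r_p2 := 18%N (only parsing).
Notation r_p3 := 19%N (only parsing).
Notation r_wj := 32%N (only parsing).
Notation x_ox := 4%N (only parsing).
Notation x_oy := 5%N (only parsing).
Notation x_xr := 6%N (only parsing).
Notation c_cu := 7%N (only parsing).
Notation c_cl := 8%N (only parsing).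

Definition Line (i : iexp) (x : rexp) : rexp := (d_a.[i] * x + d_b.[i])%X.
Definition Meet (i j : iexp) : rexp := ((d_b.[j] - d_b.[i]) / (d_a.[i] - d_a.[j]))%X.
Arguments Line _%_I _%_X.
Arguments Meet _%_I _%_I.

(** The walk starts to the right of the meeting points [m1], [m2] and [m3]: one plus a
    sum of squares exceeds each of the numbers squared. If an envelope has one line
    only, the cells read for [m1] or [m2] hold other numbers, and the start is just
    further to the right. *)
Definition Walk_init : stm :=
  let m1 := Meet (c_cu.[IC 0]) (c_cu.[IC 1]) in
  let m2 := Meet (c_cl.[$r_kl - IC 2]) (c_cl.[$r_kl - IC 1]) in
  let m3 := Meet (c_cu.[IC 0]) (c_cl.[$r_kl - IC 1]) in
  SI r_i (IC 0) ;; SI r_wj ($r_kl - IC 1) ;; SI r_isu (IC 0) ;; SI r_pv (IC 0) ;;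
  SR x_xr (RC 1 + (m1 * m1 + (m2 * m2 + m3 * m3))).

(** Moves on to the next meeting point to the left, on either envelope. *)
Definition Walk_body : stm :=
  let mu := Meet (c_cu.[$r_i]) (c_cu.[$r_i + IC 1]) in
  let ml := Meet (c_cl.[$r_wj - IC 1]) (c_cl.[$r_wj]) in
  SIf (BAnd (BIlt (IC 0) ($r_wj)) (Or (BNot (BIlt ($r_i + IC 1) ($r_ku))) (BRlt mu ml)))
    (SR x_xr ml ;; SI r_pv (c_cl.[$r_wj]) ;; SI r_wj ($r_wj - IC 1) ;; SI r_isu (IC 0))
    (SR x_xr mu ;; SI r_pv (c_cu.[$r_i]) ;; SI r_i ($r_i + IC 1) ;; SI r_isu (IC 1)).

Definition Walk_end : stm :=
  let i := c_cu.[$r_i]%I in let j := c_cl.[$r_wj]%I in let x := RV x_xr in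
  let m := Meet i j in
  SIf (BRlt (d_a.[i]) (d_a.[j]))
    (SR x_ox (RC 0 - (RC 1 + (m * m + x * x))) ;;
     SR x_oy ((Line i ($x_ox) + Line j ($x_ox)) / RC 2) ;; SI r_res (IC 0))
  (SIf (BRlt (Line j x) (Line i x))
    (SR x_ox x ;; SR x_oy ((Line i ($x_ox) + Line j ($x_ox)) / RC 2) ;; SI r_res (IC 0))
  (SIf (BReq (d_a.[i]) (d_a.[j]))
    (SI r_p1 i ;; SI r_p2 j ;; SI r_res (IC 1))
  (SI r_res (IC 2) ;; SIf (BIeq ($r_isu) (IC 1))
    (SI r_p1 ($r_pv) ;; SI r_p2 i ;; SI r_p3 j)
    (SI r_p1 j ;; SI r_p2 ($r_pv) ;; SI r_p3 i)))).

Definition Walk : stm :=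
  Walk_init ;;
  SWh (BAnd (BRlt (d_a.[c_cu.[$r_i]]) (d_a.[c_cl.[$r_wj]]))
            (Or (BIlt ($r_i + IC 1) ($r_ku)) (BIlt (IC 0) ($r_wj)))) Walk_body ;;
  Walk_end.

Section Walk.
Variable R : realType.
Implicit Type m : state R.

(** What a search for an uncovered point can end with. In the second case the cover
    is the pair of the first two registers. *)
Definition outcome (u : nat -> bool) (a b : nat -> R) (H : seq nat) m : Prop :=
  let pts := [:: ireg m r_p1; ireg m r_p2; ireg m r_p3] in
  [\/ ireg m r_res = 0%N /\
      {in H, forall i, side (u i) (a i) (b i) (rreg m x_ox) (rreg m x_oy) < 0},
      [/\ ireg m r_res = 1%N, covers u a b (take 2 pts) & {subset take 2 pts <= H}] |
      [/\ ireg m r_res = 2%N, covers u a b pts, {subset pts <= H} &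
          strict3 u a (ireg m r_p1) (ireg m r_p2) (ireg m r_p3)]].

(** The walk ends when the slope of the lower envelope is no longer the smaller one,
    or at the left ends. Either the envelopes leave a gap between them, at [x] or far
    to the left, or the lines at [x] give a cover. *)
Lemma walk_ok m (u : nat -> bool) FU FL : let kU := ireg m r_ku in let kL := ireg m r_kl in
  let a := slopes m in let b := icepts m in
  chain a b true FU kU (iarr m c_cu) -> chain a b false FL kL (iarr m c_cl) ->
  {in FU, forall z, u z} -> {in FL, forall z, ~~ u z} ->
  triple Walk m ((cost Walk_init + cost Walk_body + cost Walk_end + 100) * (kU + kL + 1))
    (outcome u a b (FU ++ FL)).
Proof.
move=> kU kL a b chU chL uU uL.
pose cu := iarr m c_cu; pose cl := iarr m c_cl.
pose Inv m' := exists st, walk a b FU FL kU kL cu cl (ireg m' r_i) (ireg m' r_wj)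
  (rreg m' x_xr) st (ireg m' r_isu == 1%N) (ireg m' r_pv).
pose mu m' := ((kU - ireg m' r_i) + ireg m' r_wj)%N.
set m1 := exec Walk_init m.
have I1 : Inv m1.
  exists false; rewrite /m1 /= /upd /= !subn1 !subn2.
  have sq (x1 x2 x3 : R) : [/\ x1 < 1 + (x1 * x1 + (x2 * x2 + x3 * x3)),
      x2 < 1 + (x1 * x1 + (x2 * x2 + x3 * x3)) & x3 < 1 + (x1 * x1 + (x2 * x2 + x3 * x3))].
    have s1 := sqr_ge0 x1; have s2 := sqr_ge0 x2; have s3 := sqr_ge0 x3.
    have t1 := sqr_ge0 (x1 - 1); have t2 := sqr_ge0 (x2 - 1); have t3 := sqr_ge0 (x3 - 1).
    by rewrite !expr2 in s1 s2 s3 t1 t2 t3; split; nra.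
  have [l1 l2 l3] := sq (meet a b (cu 0%N) (cu 1%N)) (meet a b (cl kL.-2) (cl kL.-1))
    (meet a b (cu 0%N) (cl kL.-1)).
  by apply: walk_init; [| |left|left|].
apply: (@triple_le _ _ _ (cost Walk_init + ((cost Walk_body +
  coB (BAnd (BRlt (d_a.[c_cu.[$r_i]]) (d_a.[c_cl.[$r_wj]]))
            (Or (BIlt ($r_i + IC 1) ($r_ku)) (BIlt (IC 0) ($r_wj)))) + 2) * (mu m1).+1
  + cost Walk_end))).
  apply: triple_after => //; apply: triple_seq; first apply: (triple_loop (Inv := Inv)).
  - by [].
  - exact: I1.
  - move=> m' f [st wk]; rewrite [evB _ _]/= => /andP[lt more].
    have f11 : ireg m' 11 = kU by rewrite (frI_ f 11).
    have fu : iarr m' 7 = cu by rewrite (frAI_ f 7).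
    have fl : iarr m' 8 = cl by rewrite (frAI_ f 8).
    have fa : rarr m' 3 = a by rewrite (frAR_ f 3).
    have fb : rarr m' 4 = b by rewrite (frAR_ f 4).
    rewrite fu fl fa in lt; rewrite f11 negb_and !negbK addn1 in more.
    rewrite /Inv /mu /Walk_body exec_if.
    rewrite [evB _ _]/= fa fb fl fu f11 !subn1 !addn1 negb_and !negbK.
    rewrite -[_ / _ < _ / _]/(meet a b (cu (ireg m' 13)) (cu (ireg m' 13).+1) <
      meet a b (cl (ireg m' 32).-1) (cl (ireg m' 32))).
    have [/andP[j0 cmp]|no] := ifP.
      split; last first.
        rewrite /= /upd /= ltn_add2l subn1; by case: (ireg m' 32) j0.
      exists true; rewrite /= /upd /= fa fb fl subn1.
      case ej : (ireg m' 32) j0 => [//|j] _; rewrite ej /= in wk cmp lt *.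
      apply: (walk_L chU chL wk lt) => ik; rewrite ik /= in cmp; exact: ltW.
    have ik : ((ireg m' 13).+1 < kU)%N.
      by case/orP: more => // j0; move: no; rewrite j0 /=; case: ltnP.
    split; last first.
      by rewrite /= /upd /= ltn_add2r addn1 ltn_sub2l // ltnW.
    exists true; rewrite /= /upd /= fa fb fu addn1.
    apply: (walk_U chU chL wk lt ik) => j0; move: no; rewrite j0 ik /= => /negbT.
    by rewrite -leNgt.
  - move=> m' f [[st wk]].
    have f11 : ireg m' 11 = kU by rewrite (frI_ f 11).
    have fu : iarr m' 7 = cu by rewrite (frAI_ f 7).
    have fl : iarr m' 8 = cl by rewrite (frAI_ f 8).
    have fa : rarr m' 3 = a by rewrite (frAR_ f 3).
    have fb : rarr m' 4 = b by rewrite (frAR_ f 4).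
    rewrite [evB _ _]/= fu fl fa f11 addn1 negb_and !negbK => nl.
    apply: triple_exec => //; rewrite /Walk_end.
    set i := ireg m' 13 in wk nl *; set j := ireg m' 32 in wk nl *.
    set x := rreg m' 6 in wk *.
    have sg x' y : active a b true FU (cu i) x' -> active a b false FL (cl j) x' ->
        line a b (cl j) x' < line a b (cu i) x' ->
        y = (line a b (cu i) x' + line a b (cl j) x') / 2%:R ->
        {in FU ++ FL, forall z, side (u z) (a z) (b z) x' y < 0}.
      move=> h1 h2 h3 -> z; have [g1 g2] := gap h1 h2 h3.
      rewrite mem_cat => /orP[zU|zL]; first by rewrite uU //; apply: g1.
      by rewrite (negbTE (uL _ zL)); apply: g2.
    rewrite exec_if [evB _ _]/= fu fl fa -/i -/j; have [lt|ge] := ltP (a (cu i)) (a (cl j)).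
      rewrite lt /= in nl; move: nl; rewrite -leqNgt -eqn0Ngt => /andP[ni /eqP j0].
      constructor 1; rewrite /= /upd /= fu fl fa fb -/i -/j -/x; split=> //.
      rewrite -/(meet a b (cu i) (cl j)) sub0r.
      set y := - _; have [yx ym] : y <= x /\ y < meet a b (cu i) (cl j).
        rewrite /y; set z := meet _ _ _ _; have s1 := sqr_ge0 z; have s2 := sqr_ge0 x.
        have t1 := sqr_ge0 (z + 1); have t2 := sqr_ge0 (x + 1).
        by rewrite !expr2 in s1 s2 t1 t2; split; nra.
      have ni' : ~ (i.+1 < kU)%N by apply/negP; rewrite -leqNgt.
      have [h1 h2 h3] := walk_left chU chL wk lt ni' j0 yx ym.
      exact: (sg _ _ h1 h2 h3).
    have hU := wk_U wk; have hL := wk_L wk.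
    rewrite exec_if [evB _ _]/= fu fl fa fb -/i -/j -/x.
    have [lt2|ge2] := ltP (a (cl j) * x + b (cl j)) (a (cu i) * x + b (cu i)).
      constructor 1; rewrite /= /upd /= fu fl fa fb -/i -/j -/x; split=> //.
      exact: (sg _ _ hU hL lt2).
    have iU := cn_F chU (wk_i wk); have jL := cn_F chL (wk_j wk).
    have ui := uU _ iU; have uj := uL _ jL.
    rewrite exec_if [evB _ _]/= fu fl fa -/i -/j.
    have [eq|ne] := eqVneq (a (cu i)) (a (cl j)).
      constructor 2; rewrite /= /upd /= fu fl -/i -/j; split=> //.
        exact: (pair_cover ui uj eq ge2).
      by move=> z; rewrite !inE mem_cat => /orP[/eqP ->|/eqP ->]; rewrite ?iU ?jL ?orbT.
    have lt : a (cl j) < a (cu i) by rewrite lt_neqAle eq_sym ne.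
    have := walk_cover chU chL uU uL wk lt ge2.
    constructor 3; move: H; rewrite /= /upd /=.
    by case: (ireg m' 14 == 1%N) => -[h1 h2 h3]; rewrite /= fu fl.
have -> : (mu m1 = kU + (kL - 1))%N by rewrite /mu /m1 /= /upd /= subn0.
have kL0 : (0 < kL)%N := cn_k chL.
move: (cost Walk_init) (cost Walk_body) (cost Walk_end) => A B C; rewrite /=.
move: (kU) (kL) kL0 A B C; clear => x y y0 A B C; nia.
Qed.

End Walk.

(** * Searching for an uncovered point or a small cover *)

Notation x_m := 1%N (only parsing).

(** Lists the members of the family and computes the keys for sorting them. *)
Definition Prep_body : stm :=
  SIf (BIeq ($r_p) ($r_ex)) SSkip
   (SAI c_ord ($r_cnt) ($r_p) ;; SI r_cnt ($r_cnt + IC 1) ;;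
    SIf (BRlt (d_a.[$r_p]) (RC 0))
      (SAR d_th ($r_p) (d_a.[$r_p] / (RC 1 - d_a.[$r_p])))
      (SAR d_th ($r_p) (d_a.[$r_p] / (RC 1 + d_a.[$r_p]))) ;;
    SIf (BIeq (c_ty.[$r_p]) (IC 1))
      (SAR d_str ($r_p) (d_b.[$r_p]) ;; SI r_nu ($r_nu + IC 1))
      (SAR d_str ($r_p) (RC 0 - d_b.[$r_p]) ;; SAR d_th ($r_p) (d_th.[$r_p] + RC 2))).

Definition Prep : stm := (SI r_cnt (IC 0) ;; SI r_nu (IC 0)) ;; For r_p ($r_n) Prep_body.

Definition r_chain (c : bool) : nat := if c then r_ku else r_kl.
Definition c_chain (c : bool) : nat := if c then c_cu else c_cl.

Definition Chain_of (c : bool) : stm :=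
  Cyc ;; SI (r_chain c) ($r_sz - IC 1) ;;
  For r_p (IV (r_chain c)) (SAI (c_chain c) ($r_p) (c_ls.[c_st.[$r_p]])).

(** Below all lines, at height [- x_m], a point is uncovered by upper half-planes, and
    above all lines by lower ones. These points answer the search if there is one
    type only, and are otherwise the centers of the two scans. *)
Definition Search : stm :=
  Prep ;; Sort ;;
  SIf (BIeq ($r_nu) (IC 0)) (SR x_ox (RC 0) ;; SR x_oy ($x_m) ;; SI r_res (IC 0))
  (SIf (BIeq ($r_nu) ($r_cnt)) (SR x_ox (RC 0) ;; SR x_oy (RC 0 - $x_m) ;; SI r_res (IC 0))
  ((SI r_off (IC 0) ;; SI r_len ($r_nu) ;; SI r_rot (IC 0) ;;
    SR x_cx (RC 0) ;; SR x_cy (RC 0 - $x_m)) ;; Chain_of true ;;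
   (SI r_off ($r_nu) ;; SI r_len ($r_cnt - $r_nu) ;; SI r_rot (IC 0) ;;
    SR x_cx (RC 0) ;; SR x_cy ($x_m)) ;; Chain_of false ;; Walk)).

Section Search.
Variable R : realType.
Implicit Type m : state R.

Definition members n ex : seq nat := [seq i <- iota 0 n | i != ex].

Lemma prep_ok m : let H := members (ireg m r_n) (ireg m r_ex) in
  triple Prep m ((cost Prep_body + 30) * (ireg m r_n).+1) (fun m' =>
    [/\ [seq iarr m' c_ord p | p <- iota 0 (ireg m' r_cnt)] = H,
        ireg m' r_nu = count (types m) H &
        {in H, forall i, rarr m' d_th i = theta (types m i) (slopes m i) /\
           rarr m' d_str i = strength (types m i) (icepts m i)}]).
Proof.
set n := ireg m 0%N => H.
pose Inv j m' := [/\ [seq iarr m' c_ord p | p <- iota 0 (ireg m' r_cnt)] = members j (ireg m r_ex),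
        ireg m' r_nu = count (types m) (members j (ireg m r_ex)) &
        {in members j (ireg m r_ex), forall i, rarr m' d_th i = theta (types m i) (slopes m i) /\
           rarr m' d_str i = strength (types m i) (icepts m i)}].
apply: (@triple_le _ _ _ (cost (SI r_cnt (IC 0) ;; SI r_nu (IC 0)) + (cost Prep_body + coI ($r_n)%I + 12) * n.+1)).
  apply: triple_after => //; apply: (triple_for (Inv := Inv)) => //.
    by move=> m' f; rewrite /= (frI_ f 0).
  move=> p m' f ep pn [h1 h2 h3].
  have fe : ireg m' 1 = ireg m 1 by rewrite (frI_ f 1).
  have fa : rarr m' 3 = slopes m by rewrite (frAR_ f 3).
  have fb : rarr m' 4 = icepts m by rewrite (frAR_ f 4).
  have ft : iarr m' 2 = iarr m 2 by rewrite (frAI_ f 2).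
  have memS : members p.+1 (ireg m 1) =
      if p == ireg m 1 then members p (ireg m 1) else rcons (members p (ireg m 1)) p.
    rewrite /members -[p.+1]addn1 iotaD filter_cat /= add0n.
    by case: eqP => _; rewrite /= ?cats0 ?cats1.
  rewrite /Inv memS /Prep_body exec_if [evB _ _]/= ep fe.
  case: eqP => _; first by split.
  set st := (_ ;; _); set m2 := exec st m'.
  have [A B C [D E]] : [/\ forall q, iarr m2 3 q = if q == ireg m' 2 then p else iarr m' 3 q,
      ireg m2 2 = (ireg m' 2).+1, ireg m2 3 = (ireg m' 3 + types m p)%N &
      (forall q, rarr m2 7 q = if q == p then theta (types m p) (slopes m p) else rarr m' 7 q) /\
      (forall q, rarr m2 8 q = if q == p then strength (types m p) (icepts m p) else rarr m' 8 q)].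
    rewrite /m2 /st /= /upd /= ep fa /types /theta /strength.
    case: ltP => ha; rewrite /= /upd /= ft ep; case: eqP => ty;
      rewrite /= /upd /= ?ft ?fb ?addn1 ?addn0 ?sub0r ?eqxx ?addr0;
      (split; [by []|by []|by []|]); split => q;
      first [rewrite (ltr0_norm ha)|rewrite (ger0_norm ha)|idtac]; by case: (q == p).
  split.
  - have -> : ireg (set_ireg m2 7 p.+1) 2 = (ireg m' 2 + 1)%N.
      by rewrite [LHS]/= /upd [LHS]/= B addn1.
    rewrite iotaD map_cat /= add0n.
    rewrite A eqxx cats1; congr rcons; rewrite -h1; apply/eq_in_map => q.
    by rewrite mem_iota add0n A => /andP[_ /ltn_eqF ->].
  - by rewrite [LHS]/= /upd /= C h2 -cats1 count_cat /= addn0.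
  - move=> i; rewrite mem_rcons inE [rarr _ 7]/= [rarr _ 8]/= D E.
    by have [->|ne] //= := eqVneq i p; apply: h3.
rewrite (_ : cost (SI r_cnt _ ;; _) = 4%N) //=; move: (cost Prep_body) (n) => C x; clear; nia.
Qed.

Lemma chain_ext (a b : nat -> R) c F k ci ci' : (forall i, (i < k)%N -> ci' i = ci i) ->
  chain a b c F k ci -> chain a b c F k ci'.
Proof.
move=> e [k0 cF clt sup mn mx one]; have kk : (k.-1 < k)%N by rewrite prednK.
split=> //; rewrite ?e //.
- by move=> i ik; rewrite e //; apply: cF.
- by move=> i ik; rewrite !e ?(ltnW ik) //; apply: clt.
- by move=> i ik; rewrite !e ?(ltnW ik) //; apply: sup.
Qed.

(** The scan of one type from the first position, by [chain_of_hull]. *)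
Lemma chain_ok m (c : bool) : seg_listing m -> ireg m r_rot = 0%N ->
  (forall p, (p < ireg m r_len)%N -> types m (segment m p) = c) ->
  triple (Chain_of c) m
    ((cost Fill_body + cost Graham_body + 200) * (ireg m r_len + ireg m r_len + 3))
    (fun m' => chain (slopes m) (icepts m) c [seq segment m p | p <- iota 0 (ireg m r_len)]
      (ireg m' (r_chain c)) (iarr m' (c_chain c)) /\ (ireg m' (r_chain c) <= ireg m r_len)%N).
Proof.
move=> L r0 uc; set N := ireg m r_len.
have ang := listing_angular L.
pose X := (N + N + 3)%N.
apply: (@triple_le _ _ _ ((cost Fill_body + cost Graham_body + 100) * X + (4 + 30 * N.+1))).
  apply: triple_seq; first by apply: cyc_ok => //; apply: (start_convex_one_type L r0 uc).
  move=> m1 f1 [k [ek s0 sk hull ls]].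
  pose Inv j m' := forall p, (p < j)%N -> iarr m' (c_chain c) p = iarr m1 c_ls (iarr m1 c_st p).
  have kN : (k <= N)%N.
    have e := ch_per hull 0; rewrite (ch_0 hull) !add0n -/N in e; rewrite -e.
    have le i : (i <= closed_up N (iarr m1 6) k i)%N; last exact: le.
    by elim: i => [//|i IH]; apply: leq_ltn_trans IH (ch_lt hull i).
  have stN p : (p < k)%N -> (iarr m1 c_st p <= N)%N.
    move=> pk; have := h_mono hull (ltnW pk); rewrite /closed_up modnn modn_small //.
    by rewrite divnn divn_small // (ch_k hull) muln0 addn0 s0 muln1.
  apply: triple_seq.
    by apply: (triple_exec (s := SI (r_chain c) ($r_sz - IC 1)) (Q := fun m' => m' = set_ireg m1 (r_chain c) k)) => //=; rewrite ek subn1.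
  move=> m2 _ ->.
  apply: (triple_weaken (u := 30 * N.+1) (triple_for (L := k) (Inv := Inv) _ _ _ _ _)).
  - by [].
  - by case: (c).
  - by move=> m' f; rewrite /=; case: (c) f => f; rewrite (frI_ f 11) || rewrite (frI_ f 12).
  - by [].
  - move=> p m' f ep pk IH q; rewrite ltnS => le /=; rewrite ep /upd eqxx.
    have [->|ne] := eqVneq q p.
      by case: (c) f => f; rewrite (frAI_ f 5) (frAI_ f 6).
    by apply: IH; rewrite ltn_neqAle ne.
  - by apply: leq_mul.
  - move=> m' f inv.
    have er : ireg m' (r_chain c) = k.
      by case: (c) f => f; [rewrite (frI_ f 11)|rewrite (frI_ f 12)].
    rewrite er; split=> //.
    apply: chain_ext (chain_of_hull L r0 uc hull) => i ik.
    rewrite inv // (proj1 (ls _ _)); last by apply: leq_trans (stN i ik) (leq_addr _ _).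
    by rewrite /closed_up modn_small // divn_small // muln0 addn0.
by rewrite /X; move: (cost Fill_body) (cost Graham_body) (N) => A B x; clear; nia.
Qed.

(** A predicate that holds on a prefix only; its length is the number of members. *)
Let prefix_count (P : nat -> bool) N : (forall p q, (p < q)%N -> (q < N)%N -> P q -> P p) ->
  forall q, (q < N)%N -> P q = (q < count P (iota 0 N))%N.
Proof.
elim: N => [//|N IH] mono q; rewrite -[N.+1]addn1 iotaD count_cat /= add0n addn0 addn1 => ltq.
have {}IH := IH (fun p q pq qN => mono p q pq (ltnW qN : q < N.+1)%N).
have [PN|PN] := boolP (P N).
  have all : {in iota 0 N, forall p, P p}.
    by move=> p; rewrite mem_iota add0n => /andP[_ pN]; apply: mono PN.
  have -> : count P (iota 0 N) = N.
    by apply/eqP; rewrite -[X in _ == X](size_iota 0) -all_count; apply/allP.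
  rewrite addn1 ltq; move: ltq; rewrite ltnS leq_eqVlt => /predU1P[->|qN]; first by rewrite PN.
  by rewrite (mono q N).
rewrite addn0; move: ltq; rewrite ltnS leq_eqVlt => /predU1P[->|qN]; last exact: IH.
rewrite (negbTE PN) ltnNge; apply/esym/negbF.
by rewrite -[X in (_ <= X)%N](size_iota 0) count_size.
Qed.

(** The members of the family [H], in the order in which the scan needs them. *)
Record listed (u : nat -> bool) (a b : nat -> R) (H : seq nat) m : Prop := Listed {
  ld_cnt : ireg m r_cnt = size H;
  ld_perm : perm_eq [seq iarr m c_ord p | p <- iota 0 (size H)] H;
  ld_sorted : forall p q, (p < q)%N -> (q < size H)%N ->
    let i := iarr m c_ord p in let j := iarr m c_ord q in
    theta (u i) (a i) < theta (u j) (a j) \/ (theta (u i) (a i) = theta (u j) (a j) /\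
      strength (u i) (b i) <= strength (u j) (b j)) }.

Lemma outcome_eq u a b H H' m : H =i H' -> outcome u a b H m -> outcome u a b H' m.
Proof.
move=> e [[? h]|[? ? h]|[? ? h ?]].
- by constructor 1; split=> // i; rewrite -e; apply: h.
- by constructor 2; split=> // i /h; rewrite e.
- by constructor 3; split=> // i /h; rewrite e.
Qed.

Definition search_cost : nat := (cost Prep_body + cost Merge_body + cost Fill_body +
  cost Graham_body + cost Walk_init + cost Walk_body + cost Walk_end + 1000)%N.

Lemma search_ok m : let n := ireg m r_n in let H := members n (ireg m r_ex) in
  let u := types m in let a := slopes m in let b := icepts m in
  {in H, forall i, `|b i| < rreg m x_m} ->
  triple Search m (search_cost * 20 * n.+1 * (trunc_log 2 n + 2))
    (fun m' => outcome u a b H m' /\ listed u a b H m').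
Proof.
move=> n H u a b bM; pose N := size H.
have Nn : (N <= n)%N by rewrite /N size_filter (leq_trans (count_size _ _)) // size_iota.
apply: (@triple_le _ _ _ ((cost Prep_body + 30) * n.+1 +
  ((cost Merge_body + 100) * (N + N + 2) * (trunc_log 2 N + 2) +
   (10 + (10 + (20 + ((cost Fill_body + cost Graham_body + 200) * (N + N + 3) +
     (20 + ((cost Fill_body + cost Graham_body + 200) * (N + N + 3) +
     (cost Walk_init + cost Walk_body + cost Walk_end + 100) * (N + N + 1)))))))))).
  apply: (triple_seq (prep_ok m)) => m1 f1 []; rewrite -/n -/u -/a -/b -/H => h1 h2 h3.
  have cnt1 : ireg m1 2 = N by rewrite /N -h1 size_map size_iota.
  rewrite cnt1 in h1.
  have := sort_ok m1; rewrite /= cnt1 => S1; apply: (triple_seq S1) => {S1} m2 f2 [].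
  rewrite h1 => pe srt; pose ids q := iarr m2 c_ord q; rewrite -/(ids _) in pe.
  have cnt2 : ireg m2 2 = N by rewrite (frI_ f2 2).
  have nu2 : ireg m2 3 = count u H by rewrite (frI_ f2 3).
  have ids_in q : (q < N)%N -> ids q \in H.
    by move=> qN; rewrite -(perm_mem pe) map_f // mem_iota add0n.
  have ld : listed u a b H m2.
    split=> // p q pq qN /=; have := srt p q pq qN; rewrite keyleE -!/(ids _).
    have pN := ltn_trans pq qN.
    have [-> ->] := h3 _ (ids_in p pN); have [-> ->] := h3 _ (ids_in q qN).
    by case/orP => [|/andP[/eqP]]; [left|right].
  set rest := SIf _ _ _; set T := (10 + _)%N.
  suff T1 : triple rest m2 T (outcome u a b H).
    apply: (triple_weaken T1) => // m3 f3 o3; split=> //.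
    by case: ld => l1 l2 l3; split; rewrite ?(frI_ f3 2) ?(frAI_ f3 3).
  have am : slopes m2 = a by rewrite /slopes (frAR_ f2 3) (frAR_ f1 3).
  have bm : icepts m2 = b by rewrite /icepts (frAR_ f2 4) (frAR_ f1 4).
  have um : iarr m2 2 = iarr m 2 by rewrite (frAI_ f2 2) (frAI_ f1 2).
  have Mm : rreg m2 1 = rreg m 1 by rewrite (frR_ f2 1) (frR_ f1 1).
  set M := rreg m 1 in bM Mm; set nu := count u H in nu2.
  have uids q : (q < N)%N -> u (ids q) = (q < nu)%N.
    rewrite /nu -(permP pe) count_map; move: q; apply: prefix_count => p q pq qN uq.
    have := ld_sorted ld pq qN; rewrite /= -!/(ids _) => h.
    have {h} : theta (u (ids p)) (a (ids p)) <= theta (u (ids q)) (a (ids q)).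
      by case: h => [/ltW//|[->]].
    have uq' : u (ids q) = true := uq.
    have := theta_bound (u (ids q)) (a (ids q)); have := theta_bound (u (ids p)) (a (ids p)).
    rewrite uq' /=; case: (u (ids p)) => //= /andP[t1 t2] /andP[t3 t4] le.
    by have := lt_le_trans t1 le; rewrite ltNge (ltW t4).
  have outU i : i \in H -> side true (a i) (b i) 0 (0 - M) < 0.
    move=> iH; have := bM i iH; rewrite ltr_norml /side mulr0 => /andP[? ?]; lra.
  have outL i : i \in H -> side false (a i) (b i) 0 M < 0.
    move=> iH; have := bM i iH; rewrite ltr_norml /side mulr0 => /andP[? ?]; lra.
  have nuN : (nu <= N)%N by rewrite /nu count_size.
  pose T2 := (20 + ((cost Fill_body + cost Graham_body + 200) * (N + N + 3) +
     (20 + ((cost Fill_body + cost Graham_body + 200) * (N + N + 3) +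
     (cost Walk_init + cost Walk_body + cost Walk_end + 100) * (N + N + 1)))))%N.
  rewrite /rest /T -/T2.
  apply: (triple_le (triple_if (t := (10 + T2)%N) _ _)).
  - rewrite [evB _ _]/= nu2 => nu0; apply: triple_le (leq_addr _ _); apply: (triple_le (triple_exec _ _)) => //.
    constructor 1; rewrite [ireg _ _]/= [rreg _ _]/=; split=> // i iH.
    have -> : u i = false.
      by apply/negbTE/negP => ui; move: nu0; rewrite -leqn0 leqNgt -has_count => /hasP; apply; exists i.
    by rewrite /= /upd /= Mm; apply: outL.
  - rewrite [evB _ _]/= nu2 => nu0.
    apply: (triple_le (triple_if (t := T2) _ _)).
    + rewrite [evB _ _]/= nu2 cnt2 => nuN'; apply: triple_le (leq_addr _ _).
      apply: (triple_le (triple_exec _ _)) => //.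
      constructor 1; rewrite [ireg _ _]/=; split=> // i iH.
      have -> : u i by move: nuN'; rewrite /nu -all_count => /allP; apply.
      by rewrite /= /upd /= Mm; apply: outU.
    + rewrite [evB _ _]/= nu2 cnt2 => nuN'.
      have nu1 : (0 < nu)%N by rewrite lt0n.
      have nu3 : (nu < N)%N by rewrite ltn_neqAle nuN' nuN.
      apply: triple_after => //; set m3 := exec _ m2.
      have lst o c l (x : R) m4 : (0 < l)%N -> (o + l <= N)%N ->
          types m4 = u -> slopes m4 = a -> icepts m4 = b ->
          (forall q, (q < l)%N -> u (ids (o + q)%N) = c) ->
          ireg m4 r_off = o -> ireg m4 r_len = l -> ireg m4 r_rot = 0%N -> iarr m4 c_ord = ids ->
          rreg m4 x_cx = 0 -> rreg m4 x_cy = x ->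
          (forall i, i \in H -> side c (a i) (b i) 0 x < 0) ->
          [/\ seg_listing m4, ireg m4 r_rot = 0%N,
            (forall p, (p < ireg m4 r_len)%N -> types m4 (segment m4 p) = c) &
            [seq segment m4 p | p <- iota 0 (ireg m4 r_len)] = [seq ids p | p <- iota o l]].
        move=> l0 ol e1 e2 e3 uc e4 e5 e6 e7 e8 e9 o1.
        have eseg q : segment m4 q = ids (o + q)%N by rewrite /segment e7 e4.
        have lN p : (p < l)%N -> (o + p < N)%N.
          by move=> pl; apply: leq_trans ol; rewrite ltn_add2l.
        split=> //; rewrite ?e5 ?e1.
        - rewrite /seg_listing e1 e2 e3 e5 e6 e8 e9; split=> //.
          + by move=> p pl; rewrite eseg uc // o1 // ids_in // lN.
          + move=> p q pq ql; rewrite !eseg; apply: (ld_sorted ld); rewrite ?ltn_add2l //.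
            exact: lN.
        - by move=> p pl; rewrite eseg uc.
        - have -> : iota o l = map (addn o) (iota 0 l) by rewrite -iotaDl addn0.
          by rewrite -map_comp; apply: eq_map => q /=; exact: eseg.
      pose C1 := ((cost Fill_body + cost Graham_body + 200) * (N + N + 3))%N.
      pose CW := ((cost Walk_init + cost Walk_body + cost Walk_end + 100) * (N + N + 1))%N.
      apply: (@triple_le _ _ _ (C1 + (16 + (C1 + CW)))); last first.
        by rewrite -/C1 -/CW; move: (C1) (CW); clear; lia.
      have bnd l : (l <= N)%N ->
         ((cost Fill_body + cost Graham_body + 200) * (l + l + 3) <= C1)%N.
        by move=> lN; rewrite leq_mul2l leq_add2r leq_add ?orbT.
      have [|||||||||||||L3 r3 uc3 F3] := @lst 0%N true nu (0 - M) m3; rewrite ?/m3 //=.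
      * by rewrite /types [iarr _ _]/= um.
      * by move=> q qn; rewrite add0n uids ?qn // (leq_trans qn).
      * by rewrite /upd /= Mm.
      have P3 := chain_ok L3 r3 uc3.
      have e3 : ireg m3 5 = nu by [].
      rewrite F3 e3 -[slopes m3]/(slopes m2) -[icepts m3]/(icepts m2) am bm in P3.
      have {}P3 := triple_le P3 (bnd _ nuN).
      apply: (triple_seq P3) => m4 f4 [c4 k4].
      apply: (@triple_le _ _ _ (12 + (C1 + CW))); last by rewrite leq_add2r.
      apply: triple_after => //; set m5 := exec _ m4.
      have nu4 : ireg m4 3 = nu by rewrite (frI_ f4 3).
      have cnt4 : ireg m4 2 = N by rewrite (frI_ f4 2).
      have [|||||||||||||L5 r5 uc5 F5] := @lst nu false (N - nu)%N M m5; rewrite ?/m5 //=.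
      * by rewrite subn_gt0.
      * by rewrite subnKC.
      * by rewrite /types [iarr _ _]/= (frAI_ f4 2) um.
      * by rewrite /slopes /= (frAR_ f4 3).
      * by rewrite /icepts /= (frAR_ f4 4).
      * move=> q qn; rewrite uids; first by apply/negbTE; rewrite -leqNgt leq_addr.
        by rewrite -ltn_subRL.
      * by rewrite /upd /= nu4 cnt4.
      * by rewrite (frAI_ f4 3).
      * by rewrite /upd /= (frR_ f4 1) /= /upd /= Mm.
      have P5 := chain_ok L5 r5 uc5.
      have e5 : ireg m5 5 = (N - nu)%N by rewrite /m5 /= /upd /= nu4 cnt4.
      have s5 : slopes m5 = a by rewrite /slopes /m5 [rarr _]/= (frAR_ f4 3).
      have i5 : icepts m5 = b by rewrite /icepts /m5 [rarr _]/= (frAR_ f4 4).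
      rewrite F5 e5 s5 i5 in P5.
      have {}P5 := triple_le P5 (bnd _ (leq_subr _ _)).
      apply: (triple_seq P5) => m6 f6 [c6 k6].
      rewrite [r_chain true]/= in c4 k4; rewrite [r_chain false]/= in c6 k6.
      rewrite [c_chain true]/= in c4; rewrite [c_chain false]/= in c6.
      have ku6 : ireg m6 11 = ireg m4 11 by rewrite (frI_ f6 11).
      have cu6 : iarr m6 7 = iarr m4 7 by rewrite (frAI_ f6 7).
      have s6 : slopes m6 = a by rewrite /slopes (frAR_ f6 3).
      have i6 : icepts m6 = b by rewrite /icepts (frAR_ f6 4).
      have := @walk_ok _ m6 u [seq ids p | p <- iota 0 nu] [seq ids p | p <- iota nu (N - nu)].
      rewrite /= s6 i6 ku6 cu6 => W; have {}W := W c4 c6 _ _.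
      apply: triple_weaken (W _ _) _ _.
      * move=> z /mapP[q]; rewrite mem_iota => /andP[_ qn] ->.
        by rewrite uids // (leq_trans qn).
      * move=> z /mapP[q]; rewrite mem_iota subnKC // => /andP[nq qn] ->.
        by rewrite uids // -leqNgt.
      * rewrite leq_mul2l leq_add2r; apply/orP; right; apply: leq_add; first exact: leq_trans k4 nuN.
        exact: leq_trans k6 (leq_subr _ _).
      * move=> m7 f7; apply: outcome_eq => z.
        by rewrite -map_cat -iotaD subnKC // (perm_mem pe).
    + by rewrite leq_add2r.
  - by rewrite leq_add2r.
have tt : (trunc_log 2 N <= trunc_log 2 n)%N by apply: leq_trunc_log.
have le c y d : (c <= search_cost)%N -> (y <= d * (n.+1 * (trunc_log 2 n + 2)))%N ->
    (c * y <= d * (search_cost * (n.+1 * (trunc_log 2 n + 2))))%N.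
  by move=> h1 h2; apply: leq_trans (leq_mul h1 h2) _; rewrite mulnCA.
set X := (n.+1 * (trunc_log 2 n + 2))%N in le.
have X1 : (n.+1 <= X)%N by rewrite /X -[X in (X <= _)%N]muln1 leq_mul2l; apply/orP; right; rewrite addn2.
have l1 := @le (cost Prep_body + 30)%N n.+1 1%N.
have l2 := @le (cost Merge_body + 100)%N ((N + N + 2) * (trunc_log 2 N + 2))%N 2%N.
have l3 := @le (cost Fill_body + cost Graham_body + 200)%N (N + N + 3)%N 3%N.
have l4 := @le (cost Walk_init + cost Walk_body + cost Walk_end + 100)%N (N + N + 1)%N 3%N.
have l5 := @le 70%N 1%N 1%N.
have Y2 : ((N + N + 2) * (trunc_log 2 N + 2) <= 2 * X)%N.
  rewrite /X mulnA; apply: leq_mul; last by rewrite leq_add2r.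
  by move: Nn; clear; lia.
have -> : (search_cost * 20 * n.+1 * (trunc_log 2 n + 2) = 20 * (search_cost * X))%N.
  by rewrite /X [(search_cost * 20)%N]mulnC -!mulnA.
rewrite -[((cost Merge_body + 100) * _ * _)%N]mulnA.
have c1 : (cost Prep_body + 30 <= search_cost)%N by rewrite /search_cost; lia.
have c2 : (cost Merge_body + 100 <= search_cost)%N by rewrite /search_cost; lia.
have c3 : (cost Fill_body + cost Graham_body + 200 <= search_cost)%N by rewrite /search_cost; lia.
have c4 : (cost Walk_init + cost Walk_body + cost Walk_end + 100 <= search_cost)%N.
  by rewrite /search_cost; lia.
have c5 : (70 <= search_cost)%N by rewrite /search_cost; lia.
have y1 : (n.+1 <= 1 * X)%N by rewrite mul1n.
have y3 : (N + N + 3 <= 3 * X)%N by move: X1 Nn; clear; lia.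
have y4 : (N + N + 1 <= 3 * X)%N by move: X1 Nn; clear; lia.
have y5 : (1 <= 1 * X)%N by move: X1; clear; lia.
move: (l1 c1 y1) (l2 c2 Y2) (l3 c3 y3) (l4 c4 y4) (l5 c5 y5); clear.
set z1 := (_ * n.+1)%N; set z2 := (_ * (_ * (_ + 2)))%N; set z3 := (_ * (N + N + 3))%N.
set z4 := (_ * (N + N + 1))%N; set z := (_ * X)%N.
move: z1 z2 z3 z4 z; clear; lia.
Qed.

End Search.

(** * Colouring around an uncovered point as a program *)

Notation r_ok := 33%N (only parsing).
Notation x_best := 7%N (only parsing).
Notation x_nrm := 9%N (only parsing).

(** The scan has to start at a longest dual vector, see [start_convex_max]. Taking the
    first one ensures that no vector of the same direction precedes it. *)
Definition Longest_init : stm :=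
  SR x_cx ($x_ox) ;; SR x_cy ($x_oy) ;; SI r_off (IC 0) ;; SI r_len ($r_cnt) ;;
  SI r_rot (IC 0) ;; SR x_best (RC 0).

Definition Longest_body : stm :=
  let i := c_ord.[$r_p]%I in
  SR x_h (d_b.[i] + d_a.[i] * $x_cx - $x_cy) ;;
  SR x_nrm ((d_a.[i] / $x_h) * (d_a.[i] / $x_h) + (RC 1 / $x_h) * (RC 1 / $x_h)) ;;
  SIf (BRlt ($x_best) ($x_nrm)) (SR x_best ($x_nrm) ;; SI r_rot ($r_p)) SSkip.

Definition Longest : stm := Longest_init ;; For r_p ($r_cnt) Longest_body.

(** For the hull vertex number [r_i], [r_q] runs through the positions between its
    neighbours, and [r_ok] tells whether its ear is empty so far. One loop does both,
    so that the number of rounds is bounded by the length of all ears together. *)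
Definition Pick_body : stm :=
  let prev := c_st.[$r_i - IC 1]%I in let this := c_st.[$r_i]%I in
  let next := c_st.[$r_i + IC 1]%I in let q := IV r_q in
  SIf (BIlt q next)
    (SIf (BAnd (BNot (BIeq q this))
            (BRlt (Cross prev next) (Cross q next + Cross prev q))) (SI r_ok (IC 0)) SSkip ;;
     SI r_q ($r_q + IC 1))
    (SIf (BAnd (BAnd (BIeq ($r_ok) (IC 1)) (BRlt (RC 0) (Cross prev next)))
            (BAnd (BIeq (c_col.[c_ls.[prev]]) (IC 1)) (BIeq (c_col.[c_ls.[next]]) (IC 1))))
       (SAI c_col (c_ls.[this]) (IC 0)) SSkip ;;
     SI r_q (this + IC 1) ;; SI r_i ($r_i + IC 1) ;; SI r_ok (IC 1)).

Definition Pick : stm :=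
  (SAI c_st ($r_sz) ($r_len + c_st.[IC 1]) ;; SI r_ku ($r_sz - IC 1)) ;;
  For r_p ($r_ku) (SAI c_col (c_ls.[c_st.[$r_p]]) (IC 1)) ;;
  (SI r_i (IC 1) ;; SI r_q (IC 1) ;; SI r_ok (IC 1)) ;;
  SWh (BIlt ($r_i) ($r_sz)) Pick_body.

Definition Greedy : stm :=
  SIf (BIlt (IC 0) ($r_cnt)) (Longest ;; Cyc ;; Pick) SSkip.

Section Greedy.
Variable R : realType.
Implicit Type m : state R.

Lemma exec_seq p q m : exec (p ;; q) m = exec q (exec p m).
Proof. by []. Qed.

Lemma longest_ok m : (0 < ireg m r_cnt)%N ->
  let nrm q := dot (dual (slopes m) (icepts m) (rreg m x_ox) (rreg m x_oy) (iarr m c_ord q))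
    (dual (slopes m) (icepts m) (rreg m x_ox) (rreg m x_oy) (iarr m c_ord q)) in
  (forall q, (q < ireg m r_cnt)%N -> 0 < nrm q) ->
  triple Longest m ((cost Longest_body + 50) * (ireg m r_cnt).+1) (fun m' =>
    [/\ [/\ rreg m' x_cx = rreg m x_ox, rreg m' x_cy = rreg m x_oy, ireg m' r_off = 0%N &
         ireg m' r_len = ireg m r_cnt],
      (ireg m' r_rot < ireg m r_cnt)%N,
      forall q, (q < ireg m r_cnt)%N -> nrm q <= nrm (ireg m' r_rot) &
      forall q, (q < ireg m' r_rot)%N -> nrm q < nrm (ireg m' r_rot)]).
Proof.
move=> N0 nrm pos; set N := ireg m 2 in N0 pos *.
pose Inv j m' := [/\ rreg m' x_best = (if j is 0 then 0 else nrm (ireg m' r_rot)),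
   (ireg m' r_rot < j)%N \/ (j = 0%N /\ ireg m' r_rot = 0%N),
   forall q, (q < j)%N -> nrm q <= rreg m' x_best &
   forall q, (q < ireg m' r_rot)%N -> nrm q < rreg m' x_best].
apply: (@triple_le _ _ _ (cost Longest_init + (cost Longest_body + coI ($r_cnt)%I + 12) * N.+1)).
  apply: triple_after => //.
  apply: (triple_weaken (triple_for (L := N) (Inv := Inv) _ _ _ _ _) (leqnn _)) => //.
  - by move=> m' f; rewrite /= (frI_ f 2).
  - by split=> //; right.
  - move=> p m' f ep pN [h1 h2 h3 h4].
    have fo : iarr m' 3 = iarr m 3 by rewrite (frAI_ f 3).
    have fa : rarr m' 3 = slopes m by rewrite (frAR_ f 3).
    have fb : rarr m' 4 = icepts m by rewrite (frAR_ f 4).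
    have g2 : rreg m' 2 = rreg m 4 by rewrite (frR_ f 2).
    have g3 : rreg m' 3 = rreg m 5 by rewrite (frR_ f 3).
    have new : slopes m (iarr m 3 p) / (icepts m (iarr m 3 p) + slopes m (iarr m 3 p) * rreg m 4 - rreg m 5) *
        (slopes m (iarr m 3 p) / (icepts m (iarr m 3 p) + slopes m (iarr m 3 p) * rreg m 4 - rreg m 5)) +
        1 / (icepts m (iarr m 3 p) + slopes m (iarr m 3 p) * rreg m 4 - rreg m 5) *
        (1 / (icepts m (iarr m 3 p) + slopes m (iarr m 3 p) * rreg m 4 - rreg m 5)) = nrm p.
      by rewrite /nrm /dot /dual /height /= !mulNr mulrN opprK.
    rewrite /Inv /Longest_body /= /upd /= ep fo fa fb g2 g3 new.
    have [lt|ge] := ltP (rreg m' 7) (nrm p); rewrite /= /upd /=.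
      split=> //; first by left.
      - move=> q; rewrite ltnS leq_eqVlt => /predU1P[->//|qp].
        by apply: le_trans (h3 q qp) (ltW lt).
      - by move=> q qp; apply: le_lt_trans (h3 q qp) lt.
    case: p ep pN h1 h2 h3 ge {new} => [|p] ep pN h1 h2 h3 ge.
      by have := pos 0%N N0; rewrite -h1 ltNge ge.
    split=> //.
      by case: h2 => [h2|[]//]; left; apply: ltnW.
    by move=> q; rewrite ltnS leq_eqVlt => /predU1P[->//|qp]; apply: h3.
  - move=> m' f [h1 h2 h3 h4]; have [e2 e3 e4 e5] : [/\ rreg m' 2 = rreg m 4, rreg m' 3 = rreg m 5,
        ireg m' 4 = 0%N & ireg m' 5 = N].
      by rewrite (frR_ f 2) (frR_ f 3) (frI_ f 4) (frI_ f 5).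
    have N1 : N = N.-1.+1 by rewrite prednK.
    rewrite N1 in h1; rewrite h1 in h3 h4; split=> //.
    by case: h2 => // -[e]; rewrite e in N0.
by move: (cost Longest_body) (N) => C x; rewrite (_ : cost Longest_init = 12%N) //=; clear; nia.
Qed.

Section Pick.
Variables (u : nat -> bool) (a b : nat -> R) (cx cy : R) (N r : nat) (ids : nat -> nat).
Hypothesis L : listing u a b cx cy N r ids.
Hypothesis inj : forall p q, (p < N)%N -> (q < N)%N -> ids p = ids q -> p = q.
Let w := rotv a b cx cy N r ids.
Let th := rott u a N r ids.
Let id := rot N r ids.

(** The vertices from 1 to [k] are considered, the last one being the start again; its
    right neighbour is at the stack position [k + 1] that is added first. On
    the step to the next vertex [r_q] moves back, but by less than the distance of
    the two vertices, so the measure counts what is left for both. *)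
Lemma pick_ok m k : let h := closed_up N (iarr m c_st) k in
  ireg m r_len = N -> ireg m r_sz = k.+1 ->
  iarr m c_st 0%N = 0%N -> iarr m c_st k = N -> chull N w th k h ->
  (forall p, (p <= N + N)%N -> iarr m c_ls p = id p /\ vec m p = w p) ->
  (forall x, iarr m c_col x = 0%N) ->
  triple Pick m ((cost Pick_body + 100) * (N + N + N + N + N + N + 3)) (fun m' =>
    hull_coloring w k h (blue N r ids h (iarr m' c_col)) /\
    forall x, iarr m' c_col x = 0%N \/ (iarr m' c_col x = 1%N /\ exists j, x = id (h j))).
Proof.
move=> h len sz s0 sk hull pos col0.
have ang := listing_angular L; have N0 := ang_N ang; have k0 := ch_k hull.
pose st := iarr m c_st.
have hE i : (i < k)%N -> h i = st i.
  by move=> ik; rewrite /h /closed_up modn_small // divn_small // muln0 addn0.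
have hk : h k = N by have := ch_per hull 0; rewrite (ch_0 hull) !add0n.
have hk1 : h k.+1 = (N + h 1%N)%N.
  by have := ch_per hull 1; rewrite add1n addnC => ->.
have h1 : h 1%N = st 1%N.
  case: (ltnP 1 k) => [/hE//|k1]; have e1 : k = 1%N by apply/eqP; rewrite eqn_leq k1.
  by rewrite -[in LHS]e1 hk -sk e1.
have h1N : (h 1%N <= N)%N by rewrite -hk; exact: (h_mono hull k0).
have hkN : (k <= N)%N.
  rewrite -hk; have le i : (i <= h i)%N; last exact: le.
  by elim: i => [//|i IH]; apply: leq_ltn_trans IH (ch_lt hull i).
have h2N i : (i <= k.+1)%N -> (h i <= N + N)%N.
  by move=> ik; apply: leq_trans (h_mono hull ik) _; rewrite hk1 leq_add2l.
pose m1 := exec (SAI c_st ($r_sz) ($r_len + c_st.[IC 1]) ;; SI r_ku ($r_sz - IC 1)) m.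
have st1 i : (i <= k.+1)%N -> iarr m1 c_st i = h i.
  rewrite /m1 /= /upd /= sz len => ik; have [->|ne] := eqVneq i k.+1.
    by rewrite hk1 h1.
  have : (i <= k)%N by rewrite -ltnS ltn_neqAle ne.
  by rewrite leq_eqVlt => /predU1P[->|/hE//]; rewrite hk -sk.
pose Inv1 j m' := (forall x, iarr m' c_col x = 0%N \/
    (iarr m' c_col x = 1%N /\ exists j, x = id (h j))) /\
  (forall j', (j' < j)%N -> iarr m' c_col (id (h j')) = 1%N).
have pos1 p m' : frame (writes Pick) m m' -> (p <= N + N)%N ->
    iarr m' c_ls p = id p /\ vec m' p = w p.
  by move=> f /pos; rewrite /vec (frAI_ f 5) (frAR_ f 5) (frAR_ f 6).
apply: (@triple_le _ _ _ (10 + ((30 * N.+1) + (6 + (cost Pick_body + 10) *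
  (N + N + N + N + N + N + 1))))%N); last first.
  by move: (cost Pick_body) (N); clear => C x; nia.
apply: triple_after => //; rewrite -/m1.
have f01 : frame (writes Pick) m m1.
  have [t1 [m2 [_ _ f2 e2]]] := @triple_exec _ (SAI c_st ($r_sz) ($r_len + c_st.[IC 1]) ;; SI r_ku ($r_sz - IC 1))
    m (fun x => x = m1) isT erefl.
  by rewrite -e2; apply: frame_sub f2 => x; rewrite !inE => /orP[] /eqP ->.
have P1 := @triple_for _ r_p ($r_ku)%I (SAI c_col (c_ls.[c_st.[$r_p]]) (IC 1)) Inv1 k m1 isT isT.
have {}P1 : triple (For r_p ($r_ku) (SAI c_col (c_ls.[c_st.[$r_p]]) (IC 1))) m1
    (30 * N.+1) (Inv1 k).
apply: (triple_le (P1 _ _ _)) => {P1}.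
- by move=> m' f; rewrite /= (frI_ f 11) /= /upd /= sz subn1.
- by split=> // x; left; exact: col0.
- move=> p m' f ep pk [c1 c2].
  have lsE : iarr m' 5 (iarr m' 6 p) = id (h p).
    rewrite (frAI_ f 5) (frAI_ f 6) st1; last by rewrite ltnW // ltnS ltnW.
    by rewrite (proj1 (pos1 _ _ f01 _)) // h2N // ltnW // ltnS ltnW.
  rewrite /Inv1 /= ep /upd /= lsE; split=> [x|j].
    have [->|ne] := eqVneq x (id (h p)); last exact: c1.
    by right; split=> //; exists p.
  rewrite ltnS leq_eqVlt => /predU1P[->|jp]; first by rewrite eqxx.
  by case: eqP => // _; apply: c2.
- by apply: leq_mul.
apply: (triple_seq P1) => m2 f2 [c1 c2].
pose col m' := iarr m' c_col.
pose Inv m' := exists i0, [/\ ireg m' r_i = i0.+1, (i0 <= k)%N,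
  picked a b cx cy N r ids h (col m') i0.+1, (h i0 < ireg m' r_q <= h i0.+2)%N &
  (ireg m' r_ok == 1%N) <-> (forall p, (p < ireg m' r_q)%N -> ~~ in_ear w h i0 p)].
pose mu m' := ((h k.+1 - ireg m' r_q) + (h k.+1 - h (ireg m' r_i)) +
  ((k.+1 - ireg m' r_i) + (k.+1 - ireg m' r_i)))%N.
pose m3 := exec (SI r_i (IC 1) ;; SI r_q (IC 1) ;; SI r_ok (IC 1)) m2.
apply: (@triple_weaken _ _ _ (6 + ((cost Pick_body + coB (BIlt ($r_i) ($r_sz)) + 2) *
   (mu m3).+1)) _ (fun m' => Inv m' /\ ~~ (ireg m' r_i < k.+1)%N)).
- apply: triple_after => //; rewrite -/m3.
  apply: (triple_weaken (triple_loop (Inv := Inv) (mu := mu) _ _ _) (leqnn _)).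
  + by [].
  + exists 0%N; split=> //.
    * by apply: (picked_init hull) => // j /c2.
    * by rewrite /= /upd /= (ch_0 hull) /=; apply: leq_ltn_trans (ch_lt hull 1).
    * split=> // _ p; rewrite /= /upd /= /in_ear (ch_0 hull) ltnS leqn0 => /eqP ->.
      by rewrite ltnn.
  + move=> m' f [i0 [ei ik pk /andP[q1 q2] okP]].
    have e9 : ireg m' 9 = k.+1.
      by rewrite (frI_ f 9) -[LHS]/(ireg m2 9) (frI_ f2 9) -[LHS]/(ireg m 9).
    have e6 i : (i <= k.+1)%N -> iarr m' 6 i = h i.
      by move=> le; rewrite (frAI_ f 6) -[iarr _ 6]/(iarr m2 6) (frAI_ f2 6) st1.
    have e5 p : (p <= N + N)%N -> iarr m' 5 p = id p.
      by move=> le; rewrite (frAI_ f 5) -[iarr _ 5]/(iarr m2 5) (frAI_ f2 5) -(proj1 (pos p le)).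
    have cr p q : (p <= N + N)%N -> (q <= N + N)%N ->
        rarr m' 5 p * rarr m' 6 q - rarr m' 6 p * rarr m' 5 q = cross (w p) (w q).
      move=> pN qN; rewrite (frAR_ f 5) -[rarr _ 5]/(rarr m2 5) (frAR_ f2 5).
      rewrite (frAR_ f 6) -[rarr _ 6]/(rarr m2 6) (frAR_ f2 6).
      by rewrite -(proj2 (pos p pN)) -(proj2 (pos q qN)).
    rewrite [evB _ _]/= ei e9 ltnS => ik1.
    have n0 := h2N i0 (leq_trans ik (leqnSn k)).
    have n1 : (h i0.+1 <= N + N)%N by apply: h2N; apply: leqW.
    have n2 : (h i0.+2 <= N + N)%N by apply: h2N.
    have x1 : iarr m' 6 i0 = h i0 by apply: e6; apply: leqW.
    have x2 : iarr m' 6 i0.+1 = h i0.+1 by apply: e6; apply: leqW.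
    have x3 : iarr m' 6 i0.+2 = h i0.+2 by apply: e6.
    have hk2 : (h i0.+2 <= h k.+1)%N by apply: (h_mono hull).
    rewrite /Pick_body exec_if.
    rewrite [evB (BIlt _ _) _]/= ei addn1 x3.
    have [lt|ge] := ltnP (ireg m' 8) (h i0.+2).
      have qN : (ireg m' 8 <= N + N)%N by apply: leq_trans (ltnW lt) n2.
      set cnd := (BAnd _ _); have cE : evB cnd m' = in_ear w h i0 (ireg m' 8).
        by rewrite /cnd /= ei subn1 /= addn1 x1 x2 x3 !cr // /in_ear q1 lt.
      rewrite exec_seq exec_if cE /Inv /mu.
      have D : (h k.+1 - (ireg m' 8).+1 < h k.+1 - ireg m' 8)%N.
        by apply: ltn_sub2l => //; apply: leq_trans lt hk2.
      split; last first.
        by case: in_ear; rewrite /= /upd /= ei addn1 !ltn_add2r.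
      exists i0; case: ifP => ear; rewrite /= /upd /= addn1.
        split=> //; first by rewrite ltnW.
        by split=> // /(_ _ (ltnSn _)); rewrite ear.
      split=> //; first by rewrite ltnW.
      split=> [/okP hp p|hp].
        by rewrite ltnS leq_eqVlt => /predU1P[->|]; [rewrite ear|exact: hp].
      by apply/okP => p pq; apply: hp; apply: ltnW.
    have qE : ireg m' 8 = h i0.+2 by apply/eqP; rewrite eqn_leq q2 ge.
    have no : (ireg m' 33 == 1%N) = true <-> forall p, ~~ in_ear w h i0 p.
      split=> [/okP hp p|hp]; last by apply/okP => p _; exact: hp.
      have [pl|pg] := ltnP p (ireg m' 8); first exact: hp.
      by apply/negP => /and3P[_ + _]; rewrite ltnNge -qE pg.
    have colP x : (col m' x == 1%N) = (col m' x != 0%N).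
      by case: (pk_col pk x) => [->|[->]].
    set cnd := (BAnd _ _).
    have cE : evB cnd m' = [&& ireg m' 33 == 1%N, 0 < cross (w (h i0)) (w (h i0.+2)),
        ~~ blue N r ids h (col m') i0 & ~~ blue N r ids h (col m') i0.+2].
      rewrite /cnd /= ei subn1 /= addn1 x1 x3 !e5 // cr // -andbA.
      by rewrite -!/(col m' _) !colP.
    rewrite exec_seq exec_if cE.
    set m4 := (if _ then _ else _).
    have [col4 ei4 ls4 st4] : [/\ picked a b cx cy N r ids h (col m4) i0.+2, ireg m4 13 = i0.+1,
        ireg m4 9 = k.+1 & iarr m4 6 = iarr m' 6].
      rewrite /m4; case: ifP => [/and4P[h4 h5 h6 h7]|hn].
        split; [|exact: ei|exact: e9|by []].
        apply: (picked_take L inj hull pk) => //; first by split=> //; apply/no.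
        by move=> x; rewrite /col /= /upd /= ei x2 e5.
      split=> //; apply: (picked_skip pk) => -[h5 /no h4]; move: hn.
      by rewrite h4 h5 /= => /negbT; rewrite negb_and !negbK.
    rewrite /Inv /mu; split.
      exists i0.+1; rewrite /= /upd /= ei4 addn1 st4 x2; split=> //.
        by rewrite addn1 ltnSn /=; apply: leq_ltn_trans (ltnW (ch_lt hull _)) (ch_lt hull _).
      split=> // _ p; rewrite addn1 ltnS => le; rewrite /in_ear.
      by rewrite ltnNge le.
    rewrite /= /upd /= ei4 addn1 st4 x2 addn1 qE ei subSS.
    move: (ch_lt hull i0.+1) hk2 ik1; move: (h k.+1) (h i0.+2) (h i0.+1); clear => A B C; lia.
  + move=> m' f [inv]; rewrite /= (frI_ f 9) => h4; split=> //.
    by move: h4; rewrite -[ireg _ 9]/(ireg m2 9) (frI_ f2 9) -[ireg _ 9]/(ireg m 9) sz.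
- rewrite leq_add2l; apply: leq_mul; first by rewrite -addnA leq_add2l.
  rewrite addn1 ltnS.
  rewrite /mu /m3 /= /upd /= subSS subn0.
  by move: (h2N k.+1 (leqnn _)) hkN; move: (h k.+1) (h 1%N); clear => A B; lia.
- move=> m' f [[i0 [ei ik pk _ _]]]; rewrite ei -leqNgt ltnS => ki.
  have ek : i0 = k by apply/eqP; rewrite eqn_leq ik.
  rewrite ek in pk; split; first exact: (picked_all L hull pk).
  exact: pk_col pk.
Qed.

End Pick.

Definition greedy_cost : nat :=
  (cost Longest_body + cost Fill_body + cost Graham_body + cost Pick_body + 1000)%N.

Definition two_coloured n (u : nat -> bool) (a b : nat -> R) m : Prop :=
  good_lines n u a b (fun i => iarr m c_col i == 1%N) /\ forall i, (iarr m c_col i < 2)%N.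

(** Of two parallel half-planes of one type, the larger one is closer to the center. *)
Let dual_norm (a b : nat -> R) cx cy i j (v : bool) : a i = a j ->
  strength v (b i) <= strength v (b j) ->
  side v (a i) (b i) cx cy < 0 -> side v (a j) (b j) cx cy < 0 ->
  dot (dual a b cx cy j) (dual a b cx cy j) <= dot (dual a b cx cy i) (dual a b cx cy i).
Proof.
move=> e sb oi oj; have e2 k : dot (dual a b cx cy k) (dual a b cx cy k) =
   (a k ^+ 2 + 1) * ((height a b cx cy k) ^-1) ^+ 2.
  by rewrite /dot /dual /=; ring.
rewrite !e2 e; apply: ler_wpM2l; first by rewrite addr_ge0 ?sqr_ge0.
have ni := height_neq0 oi; have nj := height_neq0 oj.
rewrite !exprVn ler_pV2 ?inE ?unitfE ?expf_neq0 //=; try by rewrite exprn_even_gt0.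
move: sb oi oj {ni nj e2}; rewrite /strength /side /height e; case: v => sb oi oj.
  by rewrite ler_sqr ?nnegrE; lra.
by rewrite -[X in X <= _]sqrrN -[X in _ <= X]sqrrN ler_sqr ?nnegrE; lra.
Qed.

(** The half-plane [ex] that was left out stays blue, by [good_hull]. *)
Lemma greedy_ok m n ex : let H := members n ex in
  let u := types m in let a := slopes m in let b := icepts m in
  listed u a b H m ->
  {in H, forall i, side (u i) (a i) (b i) (rreg m x_ox) (rreg m x_oy) < 0} ->
  (forall x, iarr m c_col x = 0%N) ->
  triple Greedy m (greedy_cost * 12 * n.+1) (two_coloured n u a b).
Proof.
move=> H u a b ld out col0; set N := size H.
have Nn : (N <= n)%N by rewrite /N size_filter (leq_trans (count_size _ _)) // size_iota.
have cnt := ld_cnt ld; rewrite -/N in cnt.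
have memH i : (i \in H) = (i < n)%N && (i != ex).
  by rewrite mem_filter mem_iota add0n andbC.
apply: (@triple_le _ _ _ (coB (BIlt (IC 0) ($r_cnt)) + 2 + ((cost Longest_body + 50) * N.+1 +
   ((cost Fill_body + cost Graham_body + 100) * (N + N + 3) +
   (cost Pick_body + 100) * (N + N + N + N + N + N + 3)))))%N; last first.
  rewrite (_ : coB _ = 4%N) // /greedy_cost; move: (cost Longest_body) (cost Fill_body).
  move: (cost Graham_body) (cost Pick_body) (N) Nn; clear => A B x xn C D.
  set K := (_ + 1000)%N; have -> : (K * 12 * n.+1 = 12 * (K * n.+1))%N by rewrite mulnAC mulnC.
  have le c y d : (c <= K)%N -> (y <= d * n.+1)%N -> (c * y <= d * (K * n.+1))%N.
    by move=> h1 h2; apply: leq_trans (leq_mul h1 h2) _; rewrite mulnCA.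
  have l1 : (6 * 1 <= 1 * (K * n.+1))%N by apply: le => //; rewrite /K; clear; lia.
  have l2 : ((C + 50) * x.+1 <= 1 * (K * n.+1))%N.
    by apply: le; rewrite ?mul1n // /K; clear; lia.
  have l3 : ((D + A + 100) * (x + x + 3) <= 3 * (K * n.+1))%N.
    by apply: le; [rewrite /K; clear; lia|move: xn; clear; lia].
  have l4 : ((B + 100) * (x + x + x + x + x + x + 3) <= 6 * (K * n.+1))%N.
    by apply: le; [rewrite /K; clear; lia|move: xn; clear; lia].
  apply: leq_trans (leq_add l1 (leq_add l2 (leq_add l3 l4))) _.
  by rewrite -!mulnDl leq_mul2r orbT.
apply: triple_if; rewrite [evB _ _]/= cnt => N0; last first.
  have {N0} N0 : N = 0%N by apply/eqP; rewrite -leqn0 leqNgt.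
  apply: (@triple_le _ _ _ 1); last first.
    by rewrite addn_gt0 muln_gt0 addn_gt0 orbT.
  apply: triple_exec => //; split=> [x y i j l iN jN lN ij jl il|i]; last by rewrite /= col0.
  have nin z : (z < n)%N -> z = ex.
    move=> zn; apply/eqP; apply: contraTT isT => ze.
    by have := memH z; rewrite (size0nil N0) zn ze.
  by move: ij; rewrite (nin i iN) (nin j jN) eqxx.
pose ids q := iarr m 3 q.
have pe := ld_perm ld; rewrite -/N in pe.
have ids_in q : (q < N)%N -> ids q \in H.
  by move=> qN; rewrite -(perm_mem pe) map_f // mem_iota add0n.
have inj p q : (p < N)%N -> (q < N)%N -> ids p = ids q -> p = q.
  move=> pN qN e; have un : uniq [seq ids p | p <- iota 0 N].
    by rewrite (perm_uniq pe) filter_uniq // iota_uniq.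
  apply/eqP; rewrite -(nth_uniq 0%N _ _ un) ?size_map ?size_iota //.
  by rewrite !(nth_map 0%N) ?size_iota // !nth_iota // !add0n e.
have onto i : (i < n)%N -> i != ex -> exists2 p, (p < N)%N & i = ids p.
  move=> iN ie; have : i \in H by rewrite memH iN ie.
  by rewrite -(perm_mem pe) => /mapP[p]; rewrite mem_iota add0n => /andP[_ pN] ->; exists p.
set ox := rreg m x_ox in out; set oy := rreg m x_oy in out.
have nrm_pos q : (q < N)%N -> 0 < dot (dual a b ox oy (ids q)) (dual a b ox oy (ids q)).
  move=> qN; have hn := height_neq0 (out _ (ids_in q qN)).
  rewrite /dot /dual /= mul1r; apply: ltr_wpDl; first by rewrite -expr2 sqr_ge0.
  by rewrite -expr2 exprn_even_gt0 //= invr_eq0.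
have := longest_ok (m := m); rewrite /= cnt => LO.
apply: (triple_seq (LO N0 nrm_pos)) => {LO} m1 f1 [[c1 c2 o1 l1] rN mx first].
set r := ireg m1 6 in rN mx first.
have um : types m1 = u by rewrite /types (frAI_ f1 2).
have am : slopes m1 = a by rewrite /slopes (frAR_ f1 3).
have bm : icepts m1 = b by rewrite /icepts (frAR_ f1 4).
have sg : segment m1 = ids.
  by apply/funext => q; rewrite /segment o1 add0n (frAI_ f1 3).
have L : listing u a b ox oy N r ids.
  split=> //.
  - by move=> p pN; apply: out; apply: ids_in.
  - by move=> p q pq qN; apply: (ld_sorted ld).
  - move=> p pr; have pN := ltn_trans pr rN.
    have [//|[te se]] := ld_sorted ld pr rN.
    have ue : u (ids p) = u (ids r).
      have := theta_bound (u (ids p)) (a (ids p)); rewrite te.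
      have := theta_bound (u (ids r)) (a (ids r)).
      move: (theta _ _) => t; case: (u (ids p)); case: (u (ids r)) => //= /andP[t1 t2] /andP[t3 t4].
        by have := lt_trans t1 t4; rewrite ltxx.
      by have := lt_trans t3 t2; rewrite ltxx.
    have ae : a (ids p) = a (ids r) by move: te; rewrite -!/(ids _) ue; apply: theta_inj.
    have := first p pr; rewrite ltNge => /negP[].
    apply: (@dual_norm a b ox oy (ids p) (ids r) (u (ids r)) ae).
    - by move: se; rewrite -!/(ids _) ue.
    - by rewrite -ue; apply: out; apply: ids_in.
    - by apply: out; apply: ids_in.
have Lm : seg_listing m1 by rewrite /seg_listing um am bm c1 c2 l1 sg.
have sc : start_convex (ireg m1 r_len) (seg_rotv m1) (seg_rott m1).
  apply: start_convex_max => // p _; rewrite /seg_rotv am bm c1 c2 l1 sg /rotv /rot addn0.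
  by rewrite -/r [(r %% N)%N]modn_small //; apply: mx; rewrite ltn_mod.
have := cyc_ok Lm sc; rewrite /seg_rotv /seg_rott um am bm c1 c2 l1 sg -/r => C.
apply: (triple_seq C) => {C} m2 f2 [k [sz s0 sk hull pos]].
have len2 : ireg m2 r_len = N by rewrite (frI_ f2 5).
have col2 x : iarr m2 c_col x = 0%N by rewrite (frAI_ f2 0) (frAI_ f1 0).
apply: (triple_weaken (pick_ok L inj len2 sz s0 sk hull pos col2) (leqnn _)) => m3 f3 [hc cols].
split; last by move=> i; case: (cols i) => [->|[->]].
apply: (@good_hull _ n u a b ox oy N r ids k _ _ _ ex L inj onto _ hull hc).
- by move=> p /ids_in; rewrite memH => /andP[].
- by move=> j; rewrite /blue; case: (cols (rot N r ids (closed_up N (iarr m2 6) k j))) => [->|[->]].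
- move=> i /eqP e; case: (cols i) => [e0|[_ [j ej]]]; first by rewrite e0 in e.
  by exists j => //; rewrite /blue -ej e.
Qed.

End Greedy.

(** * The whole algorithm *)

Notation x_k := 0%N (only parsing).

(** With [k] greater than all [- b / a], the substitution [x = X + k y] makes the
    coefficients [b + k a] of [y] nonzero. Dividing by zero gives zero. *)
Definition Shear_body : stm :=
  SR x_k ($x_k + (1.[$r_p] / 0.[$r_p]) * (1.[$r_p] / 0.[$r_p])).
Definition Norm_body : stm :=
  SR x_h (1.[$r_p] + $x_k * 0.[$r_p]) ;;
  SAR d_a ($r_p) ((RC 0 - 0.[$r_p]) / $x_h) ;; SAR d_b ($r_p) (2.[$r_p] / $x_h) ;;
  SR x_m ($x_m + d_b.[$r_p] * d_b.[$r_p]) ;;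
  SIf (BRlt ($x_h) (RC 0)) (SAI c_sg ($r_p) (IC 1)) (SAI c_sg ($r_p) (IC 0)).
Definition Norm : stm :=
  SR x_k (RC 1) ;; For r_p ($r_n) Shear_body ;; SR x_m (RC 1) ;; For r_p ($r_n) Norm_body.

Definition Copy : stm := For r_p ($r_n) (SAI c_ty ($r_p) (c_sg.[$r_p])).
Definition Flip3 (r1 r2 r3 : nat) : stm :=
  SAI c_ty ($r1) (IC 1 - c_sg.[$r1]) ;; SAI c_ty ($r2) (IC 1 - c_sg.[$r2]) ;;
  SAI c_ty ($r3) (IC 1 - c_sg.[$r3]).
Definition Paint3 (r1 r2 r3 : nat) : stm :=
  SAI c_col ($r1) (IC 1) ;; SAI c_col ($r2) (IC 1) ;; SAI c_col ($r3) (IC 1).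
Definition Save3 (r1 r2 r3 : nat) : stm :=
  SI r1 ($r_p1) ;; SI r2 ($r_p2) ;; SI r3 ($r_p3).

Notation r_e1 := 20%N (only parsing).
Notation r_e2 := 21%N (only parsing).
Notation r_e3 := 22%N (only parsing).
Notation r_f1 := 23%N (only parsing).
Notation r_f2 := 24%N (only parsing).
Notation r_f3 := 25%N (only parsing).
Notation r_g1 := 34%N (only parsing).
Notation r_g2 := 35%N (only parsing).
Notation r_g3 := 36%N (only parsing).

(** An uncovered point leads to the colouring of a hull; a pair that covers is a good
    set of red half-planes, since at most two half-planes are red. *)
Definition Resolve (cont : stm) : stm :=
  SIf (BIeq ($r_res) (IC 0)) Greedy
    (SIf (BIeq ($r_res) (IC 1)) (Paint3 r_p1 r_p2 r_p2) cont).

(** Looks for exact points of the first two covers by complementing their members. If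
    both have some, the third cover has none. *)
Definition Exact : stm :=
  SI r_ex ($r_n) ;; (Copy ;; Flip3 r_e1 r_e2 r_e3) ;; Search ;;
  SIf (BIeq ($r_res) (IC 0))
    ((Copy ;; Flip3 r_f1 r_f2 r_f3) ;; Search ;;
     SIf (BIeq ($r_res) (IC 0)) (Paint3 r_g1 r_g2 r_g3) (Paint3 r_f1 r_f2 r_f3))
    (Paint3 r_e1 r_e2 r_e3).

(** The second and the third search leave out the members [e1] and [e2] of the first
    cover. *)
Definition Main : stm :=
  Norm ;; Copy ;; SI r_ex ($r_n) ;; Search ;;
  Resolve ((Save3 r_e1 r_e2 r_e3 ;; SI r_ex ($r_e1)) ;; Search ;;
  Resolve ((Save3 r_f1 r_f2 r_f3 ;; SI r_ex ($r_e2)) ;; Search ;;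
  Resolve (Save3 r_g1 r_g2 r_g3 ;; Exact))).

Section Main.
Variable R : realType.
Implicit Type m : state R.

(** Divided by its nonzero coefficient of [y], an inequality keeps or changes its
    direction; this is the type of the half-plane. *)
Lemma norm_ok m : let n := ireg m r_n in
  (forall i, (i < n)%N -> (rarr m 0 i != 0) || (rarr m 1 i != 0)) ->
  (forall i, iarr m c_sg i = 0%N) ->
  triple Norm m ((cost Shear_body + cost Norm_body + 60) * n.+1) (fun m' =>
    [/\ forall i, (iarr m' c_sg i < 2)%N, forall i, (n <= i)%N -> iarr m' c_sg i = 0%N &
    forall i, (i < n)%N -> `|icepts m' i| < rreg m' x_m /\
      forall x y, (rarr m 0 i * x + rarr m 1 i * y <= rarr m 2 i) =
        (0 <= side (iarr m' c_sg i == 1%N) (slopes m' i) (icepts m' i) (x - rreg m' x_k * y) y)]).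
Proof.
move=> n ne sg0.
pose A := rarr m 0; pose B := rarr m 1; pose C := rarr m 2.
apply: (@triple_le _ _ _ (2 + ((cost Shear_body + 13) * n.+1 + (2 + (cost Norm_body + 13) * n.+1)))%N); last first.
  by move: (cost Shear_body) (cost Norm_body) (n); clear => x y z; nia.
apply: triple_after => //.
pose Inv1 j m' := 1 <= rreg m' x_k /\ forall i, (i < j)%N ->
   1 + (B i / A i) * (B i / A i) <= rreg m' x_k.
apply: (triple_seq (triple_for (L := n) (Inv := Inv1) _ _ _ _ _)) => //.
- by move=> m' f; rewrite /= (frI_ f 0).
- move=> p m' f ep pn [h1 h2].
  have fA : rarr m' 0 = A by rewrite (frAR_ f 0).
  have fB : rarr m' 1 = B by rewrite (frAR_ f 1).
  have s0 : 0 <= (B p / A p) * (B p / A p) by rewrite -expr2 sqr_ge0.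
  rewrite /Inv1 /= /upd /= ep fA fB; split=> [|i]; first by rewrite ler_wpDr.
  rewrite ltnS leq_eqVlt => /predU1P[->|ip]; first by rewrite lerD2r.
  by apply: le_trans (h2 i ip) _; rewrite lerDl.
move=> m1 f1 [k1 k2]; apply: triple_after => //.
have nz i : (i < n)%N -> B i + rreg m1 x_k * A i != 0.
  move=> iN; have := ne i iN; rewrite -/(A i) -/(B i); have [->|a0 _] := eqVneq (A i) 0.
    by rewrite /= mulr0 addr0.
  have := k2 i iN; set t := B i / A i => kt.
  have -> : B i + rreg m1 x_k * A i = A i * (t + rreg m1 x_k).
    by rewrite mulrDr /t mulrCA divff // mulr1 mulrC.
  rewrite mulf_neq0 // gt_eqF //.
  have q1 := sqr_ge0 (t + 1); have q2 := sqr_ge0 t; rewrite !expr2 in q1 q2; nra.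
pose K := rreg m1 x_k.
pose Inv2 j m' := [/\ forall i, (iarr m' c_sg i < 2)%N,
    forall i, (n <= i)%N -> iarr m' c_sg i = 0%N, 1 <= rreg m' x_m &
  forall i, (i < j)%N -> [/\ 1 + icepts m' i * icepts m' i <= rreg m' x_m,
    slopes m' i = - A i / (B i + K * A i), icepts m' i = C i / (B i + K * A i) &
    iarr m' c_sg i = (B i + K * A i < 0)]].
apply: (triple_weaken (triple_for (L := n) (Inv := Inv2) _ _ _ _ _)) => //.
- by move=> m' f; rewrite /= (frI_ f 0) /= (frI_ f1 0).
- by split=> [i|i _||i]; rewrite //= ?upd_eq // (frAI_ f1 1) sg0.
- move=> p m' f ep pn [h0 hz h1 h2].
  have fA : rarr m' 0 = A by rewrite (frAR_ f 0) [rarr _ _]/= (frAR_ f1 0).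
  have fB : rarr m' 1 = B by rewrite (frAR_ f 1) [rarr _ _]/= (frAR_ f1 1).
  have fC : rarr m' 2 = C by rewrite (frAR_ f 2) [rarr _ _]/= (frAR_ f1 2).
  have fK : rreg m' 0 = K by rewrite (frR_ f 0).
  rewrite /Inv2 /icepts /slopes /Norm_body /= /upd /= ep fA fB fC fK eqxx sub0r.
  set D := B p + K * A p; set x := C p / D.
  have s0 : 0 <= x * x by rewrite -expr2 sqr_ge0.
  case: ltP => hD /=; rewrite /upd /= ?eqxx; split.
  + by move=> i; case: eqP.
  + by move=> i ni; rewrite gtn_eqF ?hz // (leq_trans pn).
  + by rewrite ler_wpDr.
  + move=> i; rewrite ltnS leq_eqVlt => /predU1P[->|ip].
      by rewrite eqxx lerD2r; split=> //; rewrite hD.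
    rewrite (ltn_eqF ip); have [x1 x2 x3 x4] := h2 i ip; split=> //.
    by apply: le_trans x1 _; rewrite lerDl.
  + by move=> i; case: eqP.
  + by move=> i ni; rewrite gtn_eqF ?hz // (leq_trans pn).
  + by rewrite ler_wpDr.
  + move=> i; rewrite ltnS leq_eqVlt => /predU1P[->|ip].
      by rewrite eqxx lerD2r; split=> //; rewrite ltNge hD.
    rewrite (ltn_eqF ip); have [x1 x2 x3 x4] := h2 i ip; split=> //.
    by apply: le_trans x1 _; rewrite lerDl.
move=> m2 f2 [h0 hz h1 h2]; split=> // i iN; have [x1 x2 x3 x4] := h2 i iN; split.
  rewrite ltr_norml; have q1 := sqr_ge0 (icepts m2 i + 1); have q2 := sqr_ge0 (icepts m2 i - 1).
  have q3 := sqr_ge0 (icepts m2 i); rewrite !expr2 in q1 q2 q3; apply/andP; split; nra.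
move=> x y; rewrite -/(A i) -/(B i) -/(C i) x2 x3 x4 (_ : rreg m2 0 = K); last by rewrite (frR_ f2 0).
have := nz i iN; rewrite -/K; set D := B i + K * A i => D0.
have e : A i * x + B i * y = A i * (x - K * y) + D * y by rewrite /D; ring.
rewrite e; set X := x - K * y.
have [neg|pos] := ltP D 0; rewrite /side /=.
  have -> : y - (- A i / D * X + C i / D) = (A i * X + D * y - C i) / D by field.
  by rewrite ler_ndivlMr // mul0r subr_le0.
have {}pos : 0 < D by rewrite lt_neqAle eq_sym D0.
have -> : - A i / D * X + C i / D - y = (C i - (A i * X + D * y)) / D by field.
by rewrite ler_pdivlMr // mul0r subr_ge0.
Qed.

(** The facts about the memory that hold from the normalization to the colouring. *)
Record ready n (u : nat -> bool) (a b : nat -> R) m : Prop := Ready {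
  rd_n : ireg m r_n = n;
  rd_a : slopes m = a;
  rd_b : icepts m = b;
  rd_m : forall i, (i < n)%N -> `|b i| < rreg m x_m;
  rd_col : forall i, iarr m c_col i = 0%N;
  rd_sg : forall i, iarr m c_sg i = u i }.

Let keeps (ws : seq (nat * nat)) : bool :=
  all [pred x | x \notin ws] [:: (0, r_n); (3, d_a); (3, d_b); (2, x_m); (1, c_col); (1, c_sg)]%N.

Lemma ready_frame ws n u a b m m' : ready n u a b m -> frame ws m m' -> keeps ws ->
  ready n u a b m'.
Proof.
move=> [h1 h2 h3 h4 h5 h6] f /= /and5P[k1 k2 k3 k4 /and3P[k5 k6 _]]; split.
- by rewrite (frI f).
- by rewrite /slopes (frAR f).
- by rewrite /icepts (frAR f).
- by rewrite (frR f).
- by rewrite (frAI f).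
- by rewrite (frAI f).
Qed.

(** The current types are [v]. Beyond the input they have to be those of [u], for
    [v] to be a flip of [u] as a function. *)
Definition typed n (u v : nat -> bool) m : Prop :=
  types m = v /\ forall i, (n <= i)%N -> iarr m c_ty i = u i.

Lemma copy_ok n u a b v m : ready n u a b m -> typed n u v m ->
  triple Copy m (30 * n.+1) (fun m' => ready n u a b m' /\ forall i, iarr m' c_ty i = u i).
Proof.
move=> rd [_ tl]; pose Inv j m' := forall i, (i < j)%N || (n <= i)%N -> iarr m' c_ty i = u i.
apply: (triple_weaken (triple_for (L := n) (Inv := Inv) _ _ _ _ _)) => //.
- by move=> m' f; rewrite /= (frI_ f 0) (rd_n rd).
- move=> p m' f ep pn inv i; rewrite /= ep /upd eqxx ltnS leq_eqVlt -orbA => /orP[/eqP ->|ip].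
    by rewrite eqxx (frAI_ f 1) (rd_sg rd).
  by case: eqP => [->|_]; [rewrite (frAI_ f 1) (rd_sg rd)|apply: inv].
- by apply: leq_mul.
- move=> m' f inv; split; first exact: ready_frame rd f _.
  by move=> i; apply: inv; case: ltnP.
Qed.

Lemma flip_ok n u a b v m r1 r2 r3 : ready n u a b m -> typed n u v m ->
  r1 != r_p -> r2 != r_p -> r3 != r_p ->
  let E := [:: ireg m r1; ireg m r2; ireg m r3] in {subset E <= iota 0 n} ->
  triple (Copy ;; Flip3 r1 r2 r3) m (60 * n.+1)
    (fun m' => ready n u a b m' /\ typed n u (flip u E) m').
Proof.
move=> rd ty p1 p2 p3 E sE.
apply: (@triple_le _ _ _ (30 * n.+1 + 30)); last by clear; lia.
apply: (triple_seq (copy_ok rd ty)) => m1 f1 [rd1 t1].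
have reg r : r != r_p -> ireg m1 r = ireg m r.
  move=> rp; apply: (frI f1); rewrite /= !inE !xpair_eqE /=.
  by rewrite (negbTE rp).
have sg i : iarr m1 1 i = u i := rd_sg rd1 i.
apply: (triple_le (triple_exec _ _)) => //; split; first by case: rd1.
rewrite /typed /types /Flip3 /= /upd /= !reg // !sg.
have lt i : i \in E -> (i < n)%N by move/sE; rewrite mem_iota.
have [l1 l2 l3] : [/\ (ireg m r1 < n)%N, (ireg m r2 < n)%N & (ireg m r3 < n)%N].
  by split; apply: lt; rewrite !inE eqxx ?orbT.
have bb (x : bool) : ((1 - x)%N == 1%N) = ~~ x by case: x.
split.
  apply/funext => i; rewrite /flip /E !inE.
  have [->|_] := eqVneq i (ireg m r3); first by rewrite bb !orbT addbT.
  have [->|_] := eqVneq i (ireg m r2); first by rewrite bb orbT addbT.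
  have [->|_] := eqVneq i (ireg m r1); first by rewrite bb addbT.
  by rewrite addbF t1; case: (u i).
move=> i ni; rewrite !gtn_eqF ?t1 //; exact: leq_trans ni.
Qed.

Lemma paint_ok n u a b m r1 r2 r3 : ready n u a b m ->
  good_lines n u a b [in [:: ireg m r1; ireg m r2; ireg m r3]] ->
  triple (Paint3 r1 r2 r3) m 9 (two_coloured n u a b).
Proof.
move=> rd gd; apply: triple_exec => //; have c0 := rd_col rd.
have e i : iarr (exec (Paint3 r1 r2 r3) m) c_col i = (i \in [:: ireg m r1; ireg m r2; ireg m r3]).
  rewrite /= /upd /= !inE c0; case: eqP => _; first by rewrite !orbT.
  by case: eqP => _; rewrite ?orbT //; case: eqP.
split; last by move=> i; rewrite e; case: (_ \in _).
move=> x y i j l iN jN lN ij jl il hi hj hl c.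
have [p hp sp] := gd x y i j l iN jN lN ij jl il hi hj hl c.
by exists p => //; rewrite e; case: (_ \in _) hp; case: c.
Qed.

(** All costs from here on are multiples of this. *)
Let X n := (n.+1 * (trunc_log 2 n + 2))%N.

Let X1 n : (n.+1 <= X n)%N.
Proof. by rewrite /X leq_pmulr // addn2. Qed.

Lemma typed_frame ws n u v m m' : typed n u v m -> frame ws m m' ->
  (1, c_ty)%N \notin ws -> typed n u v m'.
Proof. by move=> [h1 h2] f k; split; rewrite ?/types (frAI f) //; case: h1. Qed.

Lemma search_main n u v a b m e : ready n u a b m -> typed n u v m -> ireg m r_ex = e ->
  triple Search m (search_cost * 20 * X n) (fun m' =>
    [/\ outcome v a b (members n e) m', listed v a b (members n e) m', ready n u a b m' &
        typed n u v m']).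
Proof.
move=> rd ty ee; have [h1 h2 h3 h4 h5 h6] := rd.
have := search_ok (m := m); rewrite /= h1 ee h3 => T.
have {}T := T _; rewrite /X mulnA; apply: (triple_weaken (T _)) => //.
  by move=> i; rewrite mem_filter mem_iota add0n => /and3P[_ _ iN]; apply: h4.
move=> m' f [ho l]; have [ety _] := ty; rewrite h2 ety in ho l; split=> //.
  exact: ready_frame rd f _.
exact: typed_frame ty f _.
Qed.

Let pay s m c n t (Q : state R -> Prop) : triple s m t Q -> (t <= c * n.+1)%N ->
  triple s m (c * X n) Q.
Proof.
by move=> T le; apply: (triple_le T); apply: leq_trans le _; rewrite leq_mul2l X1 orbT.
Qed.

Let more s m t d n (Q : state R -> Prop) : triple s m (t * X n) Q -> (t <= d)%N ->
  triple s m (d * X n) Q.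
Proof. by move=> T le; apply: (triple_le T); rewrite leq_mul2r le orbT. Qed.

Let branch bt p q m c n (Q : state R -> Prop) : (coB bt <= 4)%N ->
  (evB bt m -> triple p m (c * X n) Q) -> (~~ evB bt m -> triple q m (c * X n) Q) ->
  triple (SIf bt p q) m ((c + 6) * X n) Q.
Proof.
move=> cb hp hq; apply: (triple_le (triple_if hp hq)); rewrite mulnDl addnC leq_add2l.
have := X1 n; move: cb; clear; move: (coB bt) (X n) => x y; lia.
Qed.

Let follow p q m c d n (P Q : state R -> Prop) : triple p m (c * X n) P ->
  (forall m', frame (writes p) m m' -> P m' -> triple q m' (d * X n) Q) ->
  triple (p ;; q) m ((c + d) * X n) Q.
Proof. by move=> h1 h2; rewrite mulnDl; apply: triple_seq h1 h2. Qed.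

Lemma resolve_ok n u a b m e c cont : ready n u a b m -> typed n u u m ->
  outcome u a b (members n e) m -> listed u a b (members n e) m ->
  (let T := [:: ireg m r_p1; ireg m r_p2; ireg m r_p3] in covers u a b T ->
   {subset T <= members n e} -> strict3 u a (ireg m r_p1) (ireg m r_p2) (ireg m r_p3) ->
   triple cont m (c * X n) (two_coloured n u a b)) ->
  triple (Resolve cont) m ((greedy_cost * 12 + 9 + c + 6 + 6) * X n) (two_coloured n u a b).
Proof.
move=> rd [ty _] out ld hc; have [h1 h2 h3 h4 h5 h6] := rd.
have memsub : {subset members n e <= iota 0 n}.
  by move=> i; rewrite mem_filter => /andP[].
apply: branch => // r0.
  case: out => [[_ o]|[r1 _ _]|[r2 _ _ _]]; last 2 first.
  - by move: r0; rewrite /= r1.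
  - by move: r0; rewrite /= r2.
  apply: (@more _ _ (greedy_cost * 12)%N); last by rewrite -!addnA leq_addr.
  have := greedy_ok (m := m) (n := n) (ex := e); rewrite /= ty h2 h3 => /(_ ld o h5) T.
  exact: pay T _.
apply: branch => // r1.
  apply: (@more _ _ 9); last by rewrite -addnA addnCA leq_addr.
  case: out => [[r2 _]|[_ cov sub]|[r2 _ _ _]].
  - by move: r1; rewrite /= r2.
  - apply: pay (paint_ok rd _) _; last by rewrite leq_pmulr.
    rewrite (_ : [in _] = [in take 2 [:: ireg m r_p1; ireg m r_p2; ireg m r_p3]]).
      by apply: good_cover => // z /sub /memsub.
    by apply/funext => z; rewrite /= !inE orbb.
  - by move: r1; rewrite /= r2.
apply: (@more _ _ c); last by rewrite addnC leq_addr.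
case: out => [[r2 _]|[r2 _ _]|[_ cov sub st]].
- by move: r0; rewrite /= r2.
- by move: r1; rewrite /= r2.
- exact: hc.
Qed.

Lemma members_all n : members n n = iota 0 n.
Proof. by apply/all_filterP/allP => i; rewrite mem_iota add0n => /andP[_ /ltn_eqF ->]. Qed.

Let S := (search_cost * 20)%N.
Let exact_cost := (2 + (60 + (S + ((60 + (S + (9 + 6))) + 6))))%N.

(** A search that ends with a cover shows that the flipped family covers the plane,
    and one that ends with a point yields an exact point. *)
Lemma exact_ok n u a b m : let E := [:: ireg m r_e1; ireg m r_e2; ireg m r_e3] in
  let F := [:: ireg m r_f1; ireg m r_f2; ireg m r_f3] in
  let G := [:: ireg m r_g1; ireg m r_g2; ireg m r_g3] in
  ready n u a b m -> typed n u u m ->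
  strict3 u a (ireg m r_e1) (ireg m r_e2) (ireg m r_e3) ->
  strict3 u a (ireg m r_f1) (ireg m r_f2) (ireg m r_f3) ->
  strict3 u a (ireg m r_g1) (ireg m r_g2) (ireg m r_g3) ->
  covers u a b E -> covers u a b F -> covers u a b G ->
  {subset E <= iota 0 n} -> {subset F <= iota 0 n} -> {subset G <= iota 0 n} ->
  ireg m r_e1 \notin F -> ireg m r_e2 \notin G ->
  triple Exact m (exact_cost * X n) (two_coloured n u a b).
Proof.
move=> E F G rd ty sE sF sG cE cF cG hE hF hG nF nG.
have cov v m' : outcome v a b (members n n) m' -> ireg m' r_res <> 0%N -> covers v a b (iota 0 n).
  rewrite members_all => -[[e _]|[_ c h]|[_ c h _]] ne; [by rewrite e in ne|..].
    exact: covers_sub h c.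
  exact: covers_sub h c.
apply: follow; first by apply: (pay (triple_exec _ (erefl (exec (SI r_ex ($r_n)) m)))); rewrite // leq_pmulr.
move=> m1 f1 e1.
have rd1 : ready n u a b m1 by apply: ready_frame rd f1 _.
have ty1 : typed n u u m1 by apply: typed_frame ty f1 _.
have ex1 : ireg m1 r_ex = n by rewrite -e1 /= /upd /= (rd_n rd).
have E1 : [:: ireg m1 r_e1; ireg m1 r_e2; ireg m1 r_e3] = E.
  by rewrite (frI_ f1 20) (frI_ f1 21) (frI_ f1 22).
have T1 := flip_ok rd1 ty1 (r1 := r_e1) (r2 := r_e2) (r3 := r_e3) isT isT isT.
rewrite /= E1 in T1; apply: follow; first by apply: (pay (T1 hE)).
move=> m2 f2 [rd2 ty2].
have ex2 : ireg m2 r_ex = n by rewrite (frI_ f2 1).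
apply: (follow (search_main rd2 ty2 ex2)) => m3 f3 [ho3 l3 rd3 ty3].
apply: branch => //; rewrite [evB _ _]/= => r0; last first.
  have E3 : [:: ireg m3 r_e1; ireg m3 r_e2; ireg m3 r_e3] = E.
    rewrite (frI_ f3 20) (frI_ f3 21) (frI_ f3 22) (frI_ f2 20) (frI_ f2 21) (frI_ f2 22).
    exact: E1.
  apply: (@more _ _ 9).
  2: by apply: leq_trans (leq_addl 60 _); apply: leq_trans (leq_addl S _).
  apply: pay (paint_ok rd3 _) _; last by rewrite leq_pmulr.
  rewrite E3; apply: (good_first sE cE cF cG hE hF hG nF nG).
  by apply: cov ho3 _; apply/eqP.
have oE : {in iota 0 n, forall i, side (flip u E i) (a i) (b i) (rreg m3 x_ox) (rreg m3 x_oy) < 0}.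
  case: ho3 => [[_]|[e]|[e]]; first by rewrite members_all.
    by rewrite e in r0.
  by rewrite e in r0.
have F3 : [:: ireg m3 r_f1; ireg m3 r_f2; ireg m3 r_f3] = F.
  rewrite (frI_ f3 23) (frI_ f3 24) (frI_ f3 25) (frI_ f2 23) (frI_ f2 24) (frI_ f2 25).
  by rewrite (frI_ f1 23) (frI_ f1 24) (frI_ f1 25).
have T3 := flip_ok rd3 ty3 (r1 := r_f1) (r2 := r_f2) (r3 := r_f3) isT isT isT.
rewrite /= F3 in T3; apply: follow; first by apply: (pay (T3 hF)).
move=> m4 f4 [rd4 ty4].
have ex4 : ireg m4 r_ex = n by rewrite (frI_ f4 1) (frI_ f3 1).
apply: (follow (search_main rd4 ty4 ex4)) => m5 f5 [ho5 l5 rd5 ty5].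
apply: branch => //; rewrite [evB _ _]/= => r5; last first.
  have F5 : [:: ireg m5 r_f1; ireg m5 r_f2; ireg m5 r_f3] = F.
    rewrite (frI_ f5 23) (frI_ f5 24) (frI_ f5 25) (frI_ f4 23) (frI_ f4 24) (frI_ f4 25).
    exact: F3.
  apply: pay (paint_ok rd5 _) _; last by rewrite leq_pmulr.
  rewrite F5; apply: (good_second sF cE cF cG hE hF hG nF nG).
  by apply: cov ho5 _; apply/eqP.
apply: pay (paint_ok rd5 _) _; last by rewrite leq_pmulr.
have oF : {in iota 0 n, forall i, side (flip u F i) (a i) (b i) (rreg m5 x_ox) (rreg m5 x_oy) < 0}.
  case: ho5 => [[_]|[e]|[e]]; first by rewrite members_all.
    by rewrite e in r5.
  by rewrite e in r5.
have -> : [:: ireg m5 r_g1; ireg m5 r_g2; ireg m5 r_g3] = G.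
  rewrite (frI_ f5 34) (frI_ f5 35) (frI_ f5 36) (frI_ f4 34) (frI_ f4 35) (frI_ f4 36).
  rewrite (frI_ f3 34) (frI_ f3 35) (frI_ f3 36) (frI_ f2 34) (frI_ f2 35) (frI_ f2 36).
  by rewrite (frI_ f1 34) (frI_ f1 35) (frI_ f1 36).
exact: (good_third sE sF sG cE cF cG hE hF hG nF nG oE oF).
Qed.

Definition triple_cover n (u : nat -> bool) (a b : nat -> R) (r1 r2 r3 : nat) m : Prop :=
  let T := [:: ireg m r1; ireg m r2; ireg m r3] in
  [/\ covers u a b T, {subset T <= iota 0 n} & strict3 u a (ireg m r1) (ireg m r2) (ireg m r3)].

Let members_sub n e : {subset members n e <= iota 0 n}.
Proof. by move=> i; rewrite mem_filter => /andP[]. Qed.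

Let members_out n e (s : seq nat) : {subset s <= members n e} -> e \notin s.
Proof. by move=> h; apply/negP => /h; rewrite mem_filter eqxx. Qed.

Lemma third_ok n u a b m : ready n u a b m -> typed n u u m ->
  triple_cover n u a b r_e1 r_e2 r_e3 m -> triple_cover n u a b r_f1 r_f2 r_f3 m ->
  triple_cover n u a b r_p1 r_p2 r_p3 m ->
  ireg m r_e1 \notin [:: ireg m r_f1; ireg m r_f2; ireg m r_f3] ->
  ireg m r_e2 \notin [:: ireg m r_p1; ireg m r_p2; ireg m r_p3] ->
  triple (Save3 r_g1 r_g2 r_g3 ;; Exact) m ((6 + exact_cost) * X n) (two_coloured n u a b).
Proof.
move=> rd ty [cE hE sE] [cF hF sF] [cG hG sG] nF nG.
apply: follow; first by apply: (pay (triple_exec _ (erefl (exec (Save3 r_g1 r_g2 r_g3) m)))); rewrite // leq_pmulr.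
move=> m1 f1 e1; have rd1 := ready_frame rd f1 isT; have ty1 := typed_frame ty f1 isT.
have [x1 x2 x3] : [/\ ireg m1 r_g1 = ireg m r_p1, ireg m1 r_g2 = ireg m r_p2 &
  ireg m1 r_g3 = ireg m r_p3] by rewrite -e1.
by apply: exact_ok => //; rewrite ?x1 ?x2 ?x3 ?(frI_ f1 20) ?(frI_ f1 21) ?(frI_ f1 22)
  ?(frI_ f1 23) ?(frI_ f1 24) ?(frI_ f1 25).
Qed.

Let G := (greedy_cost * 12)%N.
Let cost2 := (8 + (S + (G + 9 + (6 + exact_cost) + 6 + 6)))%N.

Lemma second_ok n u a b m : ready n u a b m -> typed n u u m ->
  triple_cover n u a b r_e1 r_e2 r_e3 m -> triple_cover n u a b r_p1 r_p2 r_p3 m ->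
  ireg m r_e1 \notin [:: ireg m r_p1; ireg m r_p2; ireg m r_p3] ->
  triple ((Save3 r_f1 r_f2 r_f3 ;; SI r_ex ($r_e2)) ;; Search ;;
      Resolve (Save3 r_g1 r_g2 r_g3 ;; Exact)) m (cost2 * X n) (two_coloured n u a b).
Proof.
move=> rd ty tE tF nF.
apply: follow; first by apply: (pay (triple_exec _ (erefl (exec (Save3 r_f1 r_f2 r_f3 ;; SI r_ex ($r_e2)) m)))); rewrite // leq_pmulr.
move=> m1 f1 e1; have rd1 := ready_frame rd f1 isT; have ty1 := typed_frame ty f1 isT.
have ex : ireg m1 r_ex = ireg m r_e2 by rewrite -e1.
have F1 : [/\ ireg m1 23 = ireg m 17, ireg m1 24 = ireg m 18 & ireg m1 25 = ireg m 19].
  by rewrite -e1.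
apply: (follow (search_main rd1 ty1 ex)) => m2 f2 [ho l rd2 ty2].
apply: (resolve_ok rd2 ty2 ho l) => T cT hT sT.
have [y1 y2 y3] : [/\ ireg m2 20 = ireg m 20, ireg m2 21 = ireg m 21 & ireg m2 22 = ireg m 22].
  by rewrite !(frI f2) // !(frI f1).
have [z1 z2 z3] : [/\ ireg m2 23 = ireg m 17, ireg m2 24 = ireg m 18 & ireg m2 25 = ireg m 19].
  by rewrite !(frI f2).
apply: third_ok => //.
- by rewrite /triple_cover y1 y2 y3.
- by rewrite /triple_cover z1 z2 z3.
- by split=> // z /hT /members_sub.
- by rewrite y1 z1 z2 z3.
- by rewrite y2; apply: members_out hT.
Qed.

Let cost1 := (8 + (S + (G + 9 + cost2 + 6 + 6)))%N.

Lemma first_ok n u a b m : ready n u a b m -> typed n u u m ->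
  triple_cover n u a b r_p1 r_p2 r_p3 m ->
  triple ((Save3 r_e1 r_e2 r_e3 ;; SI r_ex ($r_e1)) ;; Search ;;
    Resolve ((Save3 r_f1 r_f2 r_f3 ;; SI r_ex ($r_e2)) ;; Search ;;
      Resolve (Save3 r_g1 r_g2 r_g3 ;; Exact))) m (cost1 * X n) (two_coloured n u a b).
Proof.
move=> rd ty tE.
apply: follow; first by apply: (pay (triple_exec _ (erefl (exec (Save3 r_e1 r_e2 r_e3 ;; SI r_ex ($r_e1)) m)))); rewrite // leq_pmulr.
move=> m1 f1 e1; have rd1 := ready_frame rd f1 isT; have ty1 := typed_frame ty f1 isT.
have ex : ireg m1 r_ex = ireg m 17 by rewrite -e1.
have F1 : [/\ ireg m1 20 = ireg m 17, ireg m1 21 = ireg m 18 & ireg m1 22 = ireg m 19].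
  by rewrite -e1.
apply: (follow (search_main rd1 ty1 ex)) => m2 f2 [ho l rd2 ty2].
apply: (resolve_ok rd2 ty2 ho l) => T cT hT sT.
have [z1 z2 z3] : [/\ ireg m2 20 = ireg m 17, ireg m2 21 = ireg m 18 & ireg m2 22 = ireg m 19].
  by rewrite !(frI f2).
apply: second_ok => //.
- by rewrite /triple_cover z1 z2 z3.
- by split=> // z /hT /members_sub.
- by rewrite z1; apply: members_out hT.
Qed.

Definition main_cost : nat :=
  (cost Shear_body + cost Norm_body + 60 + (30 + (2 + (S + (G + 9 + cost1 + 6 + 6)))))%N.

Theorem main_ok m : let n := ireg m r_n in
  let holds p x y := rarr m 0 p * x + rarr m 1 p * y <= rarr m 2 p in
  (forall i, (i < n)%N -> (rarr m 0 i != 0) || (rarr m 1 i != 0)) ->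
  (forall c i, iarr m c i = 0%N) ->
  triple Main m (main_cost * (n.+1 * (trunc_log 2 n + 2))) (fun m' =>
    (forall i, (iarr m' c_col i < 2)%N) /\
    forall x y i j l, (i < n)%N -> (j < n)%N -> (l < n)%N -> i != j -> j != l -> i != l ->
      holds i x y -> holds j x y -> holds l x y ->
      forall c, exists2 p, (p < n)%N && ((iarr m' c_col p == 1%N) == c) & holds p x y).
Proof.
move=> n holds nd z0; rewrite -/(X n).
apply: follow; first by apply: (pay (norm_ok nd (z0 _))).
move=> m1 f1 [sg2 sgz hs].
pose u i := iarr m1 c_sg i == 1%N; pose a := slopes m1; pose b := icepts m1.
have n1 : ireg m1 r_n = n by rewrite (frI_ f1 0).
have rd1 : ready n u a b m1.
  split=> //.
  - by move=> i /hs[].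
  - by move=> i; rewrite (frAI_ f1 0) z0.
  - by move=> i; rewrite /u; case: (iarr m1 1 i) (sg2 i) => [|[|]].
have ty1 : typed n u (types m1) m1.
  by split=> // i ni; rewrite (frAI_ f1 2) z0 /u sgz.
apply: follow; first by apply: (pay (copy_ok rd1 ty1)).
move=> m2 f2 [rd2 t2]; have ty2 : typed n u u m2.
  by split=> // ; apply/funext => i; rewrite /types t2; case: (u i).
apply: follow; first by apply: (pay (triple_exec _ (erefl (exec (SI r_ex ($r_n)) m2)))); rewrite // leq_pmulr.
move=> m3 f3 e3; have rd3 := ready_frame rd2 f3 isT; have ty3 := typed_frame ty2 f3 isT.
have ex : ireg m3 r_ex = n by rewrite -e3 /= /upd /= (rd_n rd2).
apply: (follow (search_main rd3 ty3 ex)) => m4 f4 [ho l rd4 ty4].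
have R4 := @resolve_ok n u a b m4 n cost1 _ rd4 ty4 ho l.
apply: (triple_weaken (R4 _ _) (leqnn _)) => [T cT hT sT|m5 f5 [good c2]].
  by apply: first_ok => //; split=> // z /hT /members_sub.
split=> // x y i j k iN jN kN ij jk ik; pose X0 := x - rreg m1 x_k * y.
have hE p : (p < n)%N -> holds p x y = (0 <= side (u p) (a p) (b p) X0 y).
  by move=> pN; have [_ e] := hs p pN; exact: e.
rewrite !hE // => hi hj hk c.
have [p hp sp] := good X0 y i j k iN jN kN ij jk ik hi hj hk c.
by exists p => //; rewrite hE //; case/andP: hp.
Qed.

End Main.

Local Open Scope classical_set_scope.
Local Open Scope card_scope.
Local Open Scope ring_scope.

(** * From the program to the theorem *)

Definition main_time (n : nat) : nat := (main_cost * (n.+1 * (trunc_log 2 n + 2)))%N.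

Section Final.
Variable R : realType.

Lemma three_members (T : Type) (A : set T) : `I_3 #<= A ->
  exists x y z, [/\ A x, A y & A z] /\ [/\ x <> y, y <> z & x <> z].
Proof.
move=> /card_leP[f].
pose g i (i3 : `I_3 i) : T := val (f (SigSub (mem_set i3))).
have h i (i3 : `I_3 i) : A (g i i3) by apply: set_mem; rewrite /g; case: (f _).
have inj i j (i3 : `I_3 i) (j3 : `I_3 j) : g i i3 = g j j3 -> i = j.
  by move=> /val_inj /(@inj _ _ _ f) -/(_ (in_setT _) (in_setT _)) /(congr1 val).
exists (g 0%N isT), (g 1%N isT), (g 2%N isT); split; split; try exact: h.
- by move/inj.
- by move/inj.
- by move/inj.
Qed.

(** The conclusion about colourings in a form that does not mention hyperedges. *)
Definition splits (H : set (set (R * R))) (chi : set_type H -> 'I_2) : Prop :=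
  forall p : R * R, `I_3 #<= containing H p ->
    forall c : 'I_2, exists h : set_type H, (val h) p /\ chi h = c.

Lemma splits_good H (chi : set_type H -> 'I_2) : splits chi ->
  good_coloring (G := half_plane_hypergraph H) chi.
Proof.
move=> sp e [p [-> I3]] mono.
have [h0 [p0 c0]] := sp p I3 ord0; have [h1 [p1 c1]] := sp p I3 ord_max.
have mem (h : set_type H) : val h p -> containing H p (val h).
  by move=> hp; split=> //; apply: set_mem; case: h {hp}.
by have := mono h0 h1 (mem _ p0) (mem _ p1); rewrite c0 c1.
Qed.

(** The listing has no repetitions, so that a half-plane has one index and the colours
    in the array are a function on half-planes. *)
Lemma program_splits (H : set (set (R * R))) s : lists s H -> exists t m (chi : set_type H -> 'I_2),
  [/\ runs (compile Main) (input_state s) t m, (t <= main_time (size s))%N,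
      outputs m s chi & splits chi].
Proof.
move=> [nd un HE]; set m0 := input_state s.
pose hs := [seq half_plane l | l <- s].
have nz i : (i < size s)%N -> (rarr m0 0 i != 0) || (rarr m0 1 i != 0).
  by move=> iN; have /all_nthP := nd; apply.
have [t [m1 [r1 le1 _ [c2 good]]]] := @main_ok R m0 nz (fun _ _ => erefl).
have [m r [_ _ ea _]] := compile_ok r1 (isT : wf Main) (agr_refl 0 m0).
have lt2 i : (iarr m1 0 i < 2)%N := c2 i.
pose chi (h : set_type H) : 'I_2 := Ordinal (lt2 (index (val h) hs)).
have hsE i : (i < size s)%N -> nth set0 hs i = half_plane (nth (0, 0, 0) s i).
  by move=> iN; rewrite (nth_map (0, 0, 0)).
have szh : size hs = size s by rewrite size_map.
exists t, m, chi; split=> //.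
- move=> i h iN hE; rewrite /= ea; congr (iarr m1 0 _).
  by rewrite hE -hsE // index_uniq // szh.
- move=> p /three_members[x [y [z [[hx hy hz] [xy yz xz]]]]] c.
  have idx h : containing H p h -> exists2 i, (i < size s)%N & h = nth set0 hs i /\ half_plane (nth (0, 0, 0) s i) p.
    move=> [Hh hp]; rewrite HE in Hh.
    have ih : (index h hs < size s)%N by rewrite -szh index_mem.
    exists (index h hs) => //; split; first by rewrite nth_index.
    by rewrite -hsE // nth_index.
  have [i iN [xE ip]] := idx x hx; have [j jN [yE jp]] := idx y hy.
  have [k kN [zE kp]] := idx z hz.
  have ij : i != j by apply/eqP => e; apply: xy; rewrite xE yE e.
  have jk : j != k by apply/eqP => e; apply: yz; rewrite yE zE e.
  have ik : i != k by apply/eqP => e; apply: xz; rewrite xE zE e.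
  have [q /andP[qN cq] qp] := good p.1 p.2 i j k iN jN kN ij jk ik ip jp kp (c == ord_max).
  have Hq : H (nth set0 hs q) by rewrite HE /= mem_nth // szh.
  exists (SigSub (mem_set Hq)); split; first by rewrite /= hsE.
  apply: val_inj => /=; rewrite index_uniq ?szh //.
  move: cq; have := c2 q; rewrite /=; case: (iarr m1 0 q) => [|[|//]] _ /=.
    by case: c => [[|[|//]] ?].
  by case: c => [[|[|//]] ?].
Qed.

Lemma finite_lists (H : set (set (R * R))) : finite_set H ->
  (forall h, H h -> is_closed_half_plane h) -> exists s, lists s H.
Proof.
move=> /finite_seqP[hs HE] Hh.
have /choice[f fP] : forall h, exists l : R * R * R, H h -> Defs.nondegenerate l /\ h = half_plane l.
  move=> h; have [/Hh[l nl hl]|nh] := pselect (H h); first by exists l.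
  by exists (0, 0, 0).
have mem h : h \in undup hs -> H h by rewrite mem_undup HE.
have e : [seq half_plane l | l <- [seq f h | h <- undup hs]] = undup hs.
  rewrite -map_comp -[RHS]map_id; by apply/eq_in_map => h /mem /fP[_ /esym].
exists [seq f h | h <- undup hs]; split.
- by apply/allP => l /mapP[h /mem /fP[nl _] ->].
- by rewrite e undup_uniq.
- by rewrite e HE; apply/funext => h; rewrite /= mem_undup.
Qed.

Lemma chromatic_number_le (T : Type) (G : hypergraph T) k : colorable G k ->
  exists j, is_chromatic_number G j /\ (j <= k)%N.
Proof.
move=> ck; have ex : exists j, `[< colorable G j >] by exists k; apply/asboolP.
case: (ex_minnP ex) => j /asboolP cj min; exists j; split; last by apply: min; apply/asboolP.
by split=> // i ci; apply: min; apply/asboolP.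
Qed.

(** For [n] at least 2, [n + 1] and [trunc_log 2 n + 2] are at most [2 n] and
    [3 trunc_log 2 n], and [trunc_log 2 n * ln 2 <= ln n]. *)
Lemma main_time_bigO : (fun n : nat => (main_time n)%:R : R) =O_\oo
  (fun n : nat => n%:R * ln n%:R : R).
Proof.
have ln2 : 0 < ln 2 :> R by rewrite ln_gt0 // ltr1n.
apply/eqO_exP; exists ((main_cost * 6)%:R / ln 2).
  by rewrite divr_gt0 // ltr0n !muln_gt0.
near=> n.
have n2 : (2 <= n)%N by near: n; exists 2%N.
rewrite normr_nat ger0_norm; last first.
  by rewrite mulr_ge0 // ln_ge0 // ler1n ltnW.
have tl : (1 <= trunc_log 2 n)%N by apply: trunc_log_max.
have h1 : (main_time n <= main_cost * 6 * (n * trunc_log 2 n))%N.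
  rewrite /main_time -mulnA leq_mul2l; apply/orP; right.
  by move: n2 tl; clear; move: (trunc_log 2 n) => t; nia.
have h2 : (trunc_log 2 n)%:R * ln 2 <= ln n%:R :> R.
  rewrite mulrC mulr_natr -lnXn // -natrX ler_ln ?posrE ?ltr0n ?expn_gt0 ?ler_nat //.
    by apply: trunc_logP; rewrite // ltnW.
  by rewrite ltnW.
apply: (@le_trans _ _ ((main_cost * 6)%:R * (n%:R * (trunc_log 2 n)%:R))).
  by rewrite -!natrM ler_nat.
rewrite -mulrA ler_wpM2l // [_^-1 * _]mulrC -mulrA ler_wpM2l // ler_pdivlMr //.
Unshelve. all: by end_near.
Qed.

End Final.

Theorem theorem1 (R : realType) :
  (forall H : set (set (R * R)),
     finite_set H -> (forall h, H h -> is_closed_half_plane h) ->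
     (exists k : nat,
        is_chromatic_number (half_plane_hypergraph H) k /\ (k <= 2)%N) /\
     (exists chi : set_type H -> 'I_2,
        forall p : R * R, `I_3 #<= containing H p ->
          forall c : 'I_2, exists h : set_type H, (val h) p /\ chi h = c)) /\
  (exists (prog : program) (time : nat -> nat),
     computes_good_2coloring_in_time R prog time /\
     (fun n : nat => (time n)%:R : R) =O_\oo
       (fun n : nat => n%:R * ln n%:R : R)).
Proof.
split=> [H finH hpH|].
  have [s sH] := finite_lists finH hpH.
  have [t [m [chi [_ _ _ sp]]]] := program_splits sH.
  split; last by exists chi.
  by apply: chromatic_number_le; exists chi; apply: splits_good.
exists (compile Main), main_time; split; last exact: main_time_bigO.
move=> H s sH; have [t [m [chi [r le o sp]]]] := program_splits sH.
by exists t, m, chi; split=> //; apply: splits_good.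
Qed.
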